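(* If the structure sheaf is of Type 0 or of Type 1, then the standard abelian category $\mathcal{A}$ is of injective dimension $1$.
   Context: Let $\mathcal{K}$ be a nonempty countable set and $\mathcal{V}=\mathcal{K}\amalg\{K^*\}$. Modules are graded. Type 0 structure sheaf: $\mathcal{K}$ is infinite, $\mathcal{R}(K^* )=\mathbb{Q}$, $\mathcal{R}(F)=\mathbb{Q}$ for all $F\in\mathcal{K}$, and $\mathcal{S}\subseteq\prod_{F}\mathbb{Q}$ is the multiplicatively closed set of functions $\mathcal{K}\to\{0,1\}$ equal to $1$ at all but finitely many points. Type 1 structure sheaf: $\mathcal{R}(K^* )=\mathbb{Q}$, $\mathcal{R}(F)=\mathbb{Q}[c]$ (with $c$ of degree $-2$) for all $F\in\mathcal{K}$, and $\mathcal{S}\subseteq\prod_F\mathbb{Q}[c]$ is the multiplicatively closed set of elements $(c^{\epsilon(F)})_F$ for functions $\epsilon:\mathcal{K}\to\mathbb{Z}_{\geq 0}$ with finite support. In either case $\mathcal{O}_{\mathcal{K}}=\prod_{F\in\mathcal{K}}\mathcal{R}(F)$ and $e_F\in\mathcal{O}_{\mathcal{K}}$ is the idempotent supported at $F$. There is also a compatible component structure: finite groups $\mathcal{W}_F$ ($F\in\mathcal{K}$) and $\mathcal{W}_{K^*}$, homomorphisms $\mathcal{W}_F\to\mathcal{W}_{K^*}$ for almost all $F$ (all but finitely many $F$ in Type 0, all $F$ in Type 1), and actions of $\mathcal{W}_F$ on $\mathcal{R}(F)$ and $\mathcal{W}_{K^*}$ on $\mathcal{R}(K^* )$ by ring automorphisms,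 with $\mathcal{R}(K^* )\to\mathcal{R}(F)$ being $\mathcal{W}_F$-equivariant and the components of elements of $\mathcal{S}$ being invariant. The standard model $\mathcal{A}=\mathcal{A}(\mathcal{V},\mathcal{R},\mathcal{S},\mathcal{W})$ has as objects diagrams $N\to P\leftarrow V$ where $N$ is an $\mathcal{O}_{\mathcal{K}}$-module, $P$ an $\mathcal{S}^{-1}\mathcal{O}_{\mathcal{K}}$-module, $V$ an $\mathcal{R}(K^* )=\mathbb{Q}$-module, with maps linear over $\mathcal{O}_{\mathcal{K}}\to\mathcal{S}^{-1}\mathcal{O}_{\mathcal{K}}\leftarrow\mathcal{R}(K^* )$, such that the induced maps $\mathcal{S}^{-1}N\to P$ and $\mathcal{S}^{-1}\mathcal{O}_{\mathcal{K}}\otimes V\to P$ are isomorphisms; together with compatible actions of $\mathcal{W}_F$ on $e_FN$ and of $\mathcal{W}_{K^*}$ on $V$, such that $V\to\mathcal{S}^{-1}N\to\mathcal{S}^{-1}e_FN$ is $\mathcal{W}_F$-equivariant. Morphisms are maps of diagrams respecting all structure.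
   Formalization: Equivariance of V → S⁻¹N → S⁻¹e_F N is required on germs, with one element of S common to all F, not for each F separately: F by F the claim fails in Type 1 for infinite K, and in Type 0 the condition is vacuous. *)

(* Defs.v *)
From HB Require Import structures.
From mathcomp Require Import all_boot all_order all_algebra all_fingroup.
From mathcomp Require Import ring.
From mathcomp Require Import boolp classical_sets functions cardinality.

Set Implicit Arguments.
Unset Strict Implicit.
Unset Printing Implicit Defensive.

Import GRing.Theory.
Local Open Scope ring_scope.
Local Open Scope quotient_scope.

(* [repr] is shadowed by the group-theoretic one. *)
Local Notation qrepr := generic_quotient.repr.

Record category := Category {
  ob :> Type;
  hom : ob -> ob -> Type;
  idm : forall X, hom X X;
  comp : forall X Y Z, hom Y Z -> hom X Y -> hom X Z;
  zm : forall X Y, hom X Y;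
  compA : forall X Y Z T (h : hom Z T) (g : hom Y Z) (f : hom X Y),
    comp h (comp g f) = comp (comp h g) f;
  comp1m : forall X Y (f : hom X Y), comp (idm Y) f = f;
  compm1 : forall X Y (f : hom X Y), comp f (idm X) = f;
  comp0m : forall X Y Z (f : hom X Y), comp (zm Y Z) f = zm X Z;
  compm0 : forall X Y Z (f : hom Y Z), comp f (zm X Y) = zm X Z }.

Arguments hom {_}.
Arguments idm {_}.
Arguments comp {_ _ _ _}.
Arguments zm {_}.

Definition mono (C : category) (X Y : C) (i : hom X Y) : Prop :=
  forall (Z : C) (f g : hom Z X), comp i f = comp i g -> f = g.

Definition injective_ob (C : category) (I : C) : Prop :=
  forall (X Y : C) (i : hom X Y) (f : hom X I),
    mono i -> exists g : hom Y I, comp g i = f.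

Definition is_kernel (C : category) (X Y Z : C) (i : hom X Y) (p : hom Y Z) :=
  comp p i = zm X Z /\
  forall (T : C) (f : hom T Y), comp p f = zm T Z ->
    exists! g : hom T X, comp i g = f.

Definition is_cokernel (C : category) (X Y Z : C) (i : hom X Y) (p : hom Y Z) :=
  comp p i = zm X Z /\
  forall (T : C) (f : hom Y T), comp f i = zm X T ->
    exists! g : hom Z T, comp g p = f.

Definition short_exact (C : category) (X Y Z : C)
    (i : hom X Y) (p : hom Y Z) : Prop :=
  is_kernel i p /\ is_cokernel i p.

(* An injective resolution 0 -> X -> I_0 -> ... -> I_n -> 0, cut into short
   exact sequences; for n = 1 it is a short exact sequence
   0 -> X -> I_0 -> I_1 -> 0 with both I_0 and I_1 injective. *)
Fixpoint injdim_le (C : category) (n : nat) (X : C) : Prop :=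
  if n is m.+1 then
    exists (I J : C) (i : hom X I) (p : hom I J),
      [/\ injective_ob I, short_exact i p & injdim_le m J]
  else injective_ob X.

Definition has_injdim (C : category) (n : nat) : Prop :=
  (forall X : C, injdim_le n X) /\
  (forall m, (forall X : C, injdim_le m X) -> (n <= m)%N).

Record mulset (A : comPzRingType) := Mulset {
  mulset_set :> set A;
  mulset1 : mulset_set 1;
  mulsetM : forall s t, mulset_set s -> mulset_set t -> mulset_set (s * t) }.

Definition den (A : comPzRingType) (S : mulset A) :=
  {s : A | s \in (S : set A)}.

Section Localization.
Context (A : comPzRingType) (S : mulset A).
Implicit Types (s t u : den S).

Lemma den1_subproof : (1 : A) \in (S : set A).
Proof. by rewrite inE; exact: mulset1. Qed.
Definition den1 : den S := Sub (1 : A) den1_subproof.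

Lemma denM_subproof s t : val s * val t \in (S : set A).
Proof. by rewrite inE; apply: mulsetM; rewrite -inE; exact: valP. Qed.
Definition denM s t : den S := Sub (val s * val t) (denM_subproof s t).

Lemma val_den1 : val den1 = 1. Proof. by []. Qed.
Lemma val_denM s t : val (denM s t) = val s * val t. Proof. by []. Qed.
Definition val_denE := (val_den1, val_denM).

Section Module.
Context (M : lmodType A).

Definition loc_rel (x y : M * den S) : bool :=
  `[< exists u : den S,
      val u *: (val y.2 *: x.1) = val u *: (val x.2 *: y.1) >].

Lemma loc_rel_refl : reflexive loc_rel.
Proof. by move=> x; apply/asboolP; exists den1. Qed.

Lemma loc_rel_sym : symmetric loc_rel.
Proof. by move=> x y; apply: asbool_equiv_eq; split=> -[u eq_u]; exists u. Qed.

Lemma loc_rel_trans : transitive loc_rel.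
Proof.
move=> [n t] [m s] [p r] /asboolP[/= u eq_u] /asboolP[/= v eq_v].
apply/asboolP; exists (denM (denM u v) t) => /=.
have -> : (val u * val v * val t) *: (val r *: m)
        = (val v * val r) *: (val u *: (val t *: m)).
  by rewrite !scalerA; congr (_ *: _); ring.
rewrite eq_u.
have -> : (val v * val r) *: (val u *: (val s *: n))
        = (val u * val s) *: (val v *: (val r *: n)).
  by rewrite !scalerA; congr (_ *: _); ring.
by rewrite eq_v !scalerA /=; congr (_ *: _); ring.
Qed.

Canonical loc_equiv :=
  EquivRel loc_rel loc_rel_refl loc_rel_sym loc_rel_trans.

(* S^{-1}M, as a set of fractions *)
Definition loc := {eq_quot loc_equiv}.
HB.instance Definition _ := Choice.on loc.

Definition frac (n : M) (s : den S) : loc := \pi_loc (n, s).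

Lemma fracP n s m t :
  frac n s = frac m t <->
  exists u : den S, val u *: (val t *: n) = val u *: (val s *: m).
Proof.
split=> [/eqmodP/asboolP //|h]; apply/eqmodP; exact/asboolP.
Qed.

Lemma frac_repr (x : loc) : x = frac (qrepr x).1 (qrepr x).2.
Proof. by rewrite /frac -surjective_pairing reprK. Qed.

End Module.

Definition loc_ring := loc A^o.
HB.instance Definition _ := Choice.on loc_ring.

Definition rfrac (a : A) (s : den S) : loc_ring := frac (a : A^o) s.
Definition num (x : loc_ring) : A := (qrepr x).1.
Definition dnm (x : loc_ring) : den S := (qrepr x).2.

Lemma rfracP a s b t :
  rfrac a s = rfrac b t <->
  exists u : den S, val u * (val t * a) = val u * (val s * b).
Proof. exact: fracP. Qed.

Lemma rfrac_num x : x = rfrac (num x) (dnm x).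
Proof. exact: frac_repr. Qed.

Definition loc_add (x y : loc_ring) : loc_ring :=
  rfrac (val (dnm y) * num x + val (dnm x) * num y) (denM (dnm x) (dnm y)).
Definition loc_opp (x : loc_ring) : loc_ring := rfrac (- num x) (dnm x).
Definition loc_mul (x y : loc_ring) : loc_ring :=
  rfrac (num x * num y) (denM (dnm x) (dnm y)).

Lemma num_rfrac a s : exists u : den S,
  val u * (val s * num (rfrac a s)) = val u * (val (dnm (rfrac a s)) * a).
Proof. by apply/rfracP; rewrite -rfrac_num. Qed.

Lemma loc_addE a s b t :
  loc_add (rfrac a s) (rfrac b t) =
  rfrac (val t * a + val s * b) (denM s t).
Proof.
rewrite /loc_add; have [u eu] := num_rfrac a s; have [v ev] := num_rfrac b t.
move: (num (rfrac a s)) (num (rfrac b t)) eu ev.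
move: (dnm (rfrac a s)) (dnm (rfrac b t)) => s' t' a' b' eu ev.
apply/rfracP; exists (denM u v); rewrite !val_denE.
transitivity (val v * val t * val t' * (val u * (val s * a'))
            + val u * val s * val s' * (val v * (val t * b'))); first ring.
by rewrite eu ev; ring.
Qed.

Lemma loc_oppE a s : loc_opp (rfrac a s) = rfrac (- a) s.
Proof.
rewrite /loc_opp; have [u eu] := num_rfrac a s.
by apply/rfracP; exists u; rewrite !mulrN eu.
Qed.

Lemma loc_mulE a s b t :
  loc_mul (rfrac a s) (rfrac b t) = rfrac (a * b) (denM s t).
Proof.
rewrite /loc_mul; have [u eu] := num_rfrac a s; have [v ev] := num_rfrac b t.
move: (num (rfrac a s)) (num (rfrac b t)) eu ev.
move: (dnm (rfrac a s)) (dnm (rfrac b t)) => s' t' a' b' eu ev.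
apply/rfracP; exists (denM u v); rewrite !val_denE.
transitivity (val u * (val s * a') * (val v * (val t * b'))); first ring.
by rewrite eu ev; ring.
Qed.

Lemma loc_addA : associative loc_add.
Proof.
move=> x y z; rewrite [x]rfrac_num [y]rfrac_num [z]rfrac_num !loc_addE.
by apply/rfracP; exists den1; rewrite !val_denE; ring.
Qed.

Lemma loc_addC : commutative loc_add.
Proof.
move=> x y; rewrite [x]rfrac_num [y]rfrac_num !loc_addE.
by apply/rfracP; exists den1; rewrite !val_denE; ring.
Qed.

Lemma loc_add0 : left_id (rfrac 0 den1) loc_add.
Proof.
move=> x; rewrite [x]rfrac_num !loc_addE.
by apply/rfracP; exists den1; rewrite !val_denE; ring.
Qed.

Lemma loc_addN : left_inverse (rfrac 0 den1) loc_opp loc_add.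
Proof.
move=> x; rewrite [x]rfrac_num loc_oppE !loc_addE.
by apply/rfracP; exists den1; rewrite !val_denE; ring.
Qed.

HB.instance Definition _ :=
  GRing.isZmodule.Build loc_ring loc_addA loc_addC loc_add0 loc_addN.

Lemma loc_mulA : associative loc_mul.
Proof.
move=> x y z; rewrite [x]rfrac_num [y]rfrac_num [z]rfrac_num !loc_mulE.
by apply/rfracP; exists den1; rewrite !val_denE; ring.
Qed.

Lemma loc_mulC : commutative loc_mul.
Proof.
move=> x y; rewrite [x]rfrac_num [y]rfrac_num !loc_mulE.
by apply/rfracP; exists den1; rewrite !val_denE; ring.
Qed.

Lemma loc_mul1 : left_id (rfrac 1 den1) loc_mul.
Proof.
move=> x; rewrite [x]rfrac_num !loc_mulE.
by apply/rfracP; exists den1; rewrite !val_denE; ring.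
Qed.

Lemma loc_mulD : left_distributive loc_mul +%R.
Proof.
have addE : +%R = loc_add by [].
move=> x y z; rewrite addE [x]rfrac_num [y]rfrac_num [z]rfrac_num.
by rewrite loc_addE !loc_mulE loc_addE; apply/rfracP; exists den1;
  rewrite !val_denE; ring.
Qed.

HB.instance Definition _ := GRing.Zmodule_isComPzRing.Build loc_ring
  loc_mulA loc_mulC loc_mul1 loc_mulD.

Definition to_loc (a : A) : loc_ring := rfrac a den1.
Definition inv_loc (s : den S) : loc_ring := rfrac 1 s.

Lemma inv_locK s : inv_loc s * to_loc (val s) = 1.
Proof.
rewrite [LHS]loc_mulE [RHS](_ : _ = rfrac 1 den1) //.
by apply/rfracP; exists den1; rewrite !val_denE; ring.
Qed.

End Localization.

(* Tensor product over k of a k-algebra B, given by f : k -> B, and a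
   k-module V, as a set: formal sums modulo bilinearity. *)

Section Tensor.
Context (k B : comPzRingType) (f : k -> B) (V : lmodType k).

Inductive tens_eq : seq (B * V) -> seq (B * V) -> Prop :=
| tens_refl x : tens_eq x x
| tens_sym x y : tens_eq x y -> tens_eq y x
| tens_trans x y z : tens_eq x y -> tens_eq y z -> tens_eq x z
| tens_cat x x' y y' :
    tens_eq x x' -> tens_eq y y' -> tens_eq (x ++ y) (x' ++ y')
| tens_swap x y : tens_eq (x ++ y) (y ++ x)
| tens_addl b b' v : tens_eq [:: (b + b', v)] [:: (b, v); (b', v)]
| tens_addr b v v' : tens_eq [:: (b, v + v')] [:: (b, v); (b, v')]
| tens_scale b q v : tens_eq [:: (b * f q, v)] [:: (b, q *: v)]
| tens_zero v : tens_eq [:: (0, v)] [::].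

Definition tens_rel x y : bool := `[< tens_eq x y >].

Lemma tens_rel_refl : reflexive tens_rel.
Proof. by move=> x; apply/asboolP; exact: tens_refl. Qed.

Lemma tens_rel_sym : symmetric tens_rel.
Proof. by move=> x y; apply: asbool_equiv_eq; split; exact: tens_sym. Qed.

Lemma tens_rel_trans : transitive tens_rel.
Proof.
move=> y x z /asboolP xy /asboolP yz; apply/asboolP; exact: tens_trans yz.
Qed.

Canonical tens_equiv :=
  EquivRel tens_rel tens_rel_refl tens_rel_sym tens_rel_trans.

Definition tensor := {eq_quot tens_equiv}.
HB.instance Definition _ := Choice.on tensor.

End Tensor.

(* Gradings: [hcomp d x] is the homogeneous component of x of degree d. *)

Record grading (M : zmodType) := Grading {
  hcomp :> int -> M -> M;
  hcompD : forall d x y, hcomp d (x + y) = hcomp d x + hcomp d y;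
  hcompK : forall d e x, hcomp d (hcomp e x) = if d == e then hcomp e x else 0;
  hcomp_sum : forall x, exists2 D : seq int, uniq D &
    x = \sum_(d <- D) hcomp d x }.

Definition homog (M : zmodType) (g : grading M) (d : int) (x : M) : Prop :=
  g d x = x.

Record gradedRing := GradedRing {
  gr_sort :> comAlgType rat;
  gr_grading : grading gr_sort;
  gr_homog1 : homog gr_grading 0 1;
  gr_homogM : forall d e x y, homog gr_grading d x -> homog gr_grading e y ->
    homog gr_grading (d + e) (x * y) }.

Lemma hcomp0 (M : zmodType) (g : grading M) d : g d 0 = 0.
Proof. by apply: (addrI (g d 0)); rewrite -hcompD !addr0. Qed.

Lemma hcompN (M : zmodType) (g : grading M) d x : g d (- x) = - g d x.
Proof. by apply: (addrI (g d x)); rewrite -hcompD !subrr hcomp0. Qed.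

Lemma hcomp_bigsum (M : zmodType) (g : grading M) d (I : Type) (r : seq I)
  (F : I -> M) : g d (\sum_(i <- r) F i) = \sum_(i <- r) g d (F i).
Proof.
elim: r => [|i r IHr]; first by rewrite !big_nil hcomp0.
by rewrite !big_cons hcompD IHr.
Qed.

Lemma hcomp_supp (M : zmodType) (g : grading M) (D : seq int) x : uniq D ->
  (forall d, d \notin D -> g d x = 0) -> x = \sum_(d <- D) g d x.
Proof.
move=> uD D0; have [E uE xE] := hcomp_sum g x; rewrite {1}xE.
rewrite (bigID (mem D)) /= [X in _ + X]big1 ?addr0 => [|d /D0 //].
rewrite [RHS](bigID (mem E)) /= [X in _ = _ + X]big1 => [|d dE]; last first.
  rewrite xE hcomp_bigsum big1_seq // => e /andP[_ eE]; rewrite hcompK.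
  by case: eqP => // de; rewrite de eE in dE.
rewrite addr0 -big_filter -[RHS]big_filter; apply: perm_big.
apply: uniq_perm; rewrite ?filter_uniq // => d.
by rewrite !mem_filter andbC.
Qed.

(* The product over K of copies of a graded ring, formed in graded rings: the
   degree d part is the product of the degree d parts, so that an element is a
   family whose components all lie in a common finite set of degrees. If the
   ring is concentrated in degree 0 this is the full product. *)

Section Product.
Context (K : choiceType) (R : gradedRing).

Definition bounded_family : {pred K -> R} := fun f =>
  `[< exists D : seq int, forall F d, d \notin D -> gr_grading R d (f F) = 0 >].

Lemma bounded_subring : subring_closed bounded_family.
Proof.
have bP f : reflect (exists2 D : seq int, uniq D &
    forall F d, d \notin D -> gr_grading R d (f F) = 0) (f \in bounded_family).
  apply: (iffP (asboolP _)) => [[D DP]|[D _ DP]]; last by exists D.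
  by exists (undup D); rewrite ?undup_uniq // => F d; rewrite mem_undup; exact: DP.
split.
- apply/asboolP; exists [:: 0] => F d; rewrite inE => d0.
  by rewrite -[(1 : K -> R) F]/(1 : R) -(gr_homog1 R) hcompK (negbTE d0).
- move=> f g /asboolP[D DP] /asboolP[E EP]; apply/asboolP.
  exists (D ++ E) => F d; rewrite mem_cat negb_or => /andP[/DP fd /EP gd].
  by rewrite -[(f - g) F]/(f F - g F) hcompD hcompN fd gd subr0.
- move=> f g /bP[D uD DP] /bP[E uE EP]; apply/asboolP.
  exists [seq d + e | d <- D, e <- E] => F n nDE.
  rewrite -[(f * g) F]/(f F * g F) (hcomp_supp uD (DP F)) (hcomp_supp uE (EP F)).
  rewrite mulr_suml hcomp_bigsum big1_seq // => d /andP[_ dD].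
  rewrite mulr_sumr hcomp_bigsum big1_seq // => e /andP[_ eE].
  rewrite -(@gr_homogM R d e); try by rewrite /homog hcompK eqxx.
  rewrite hcompK; case: eqP => // nde; case/negP: nDE; rewrite nde.
  by apply/allpairsP; exists (d, e).
Qed.

Record prodR := ProdR {
  prod_val :> K -> R;
  prod_bounded : prod_val \in bounded_family }.

HB.instance Definition _ := [isSub for prod_val].
HB.instance Definition _ := [Choice of prodR by <:].
HB.instance Definition _ :=
  GRing.SubChoice_isSubComPzRing.Build (K -> R) bounded_family prodR
    bounded_subring.

Lemma prodR_mulE (a b : prodR) F : (a * b) F = a F * b F.
Proof. by []. Qed.

Lemma prodR_1E F : (1 : prodR) F = 1.
Proof. by []. Qed.

Lemma at_subproof (F : K) (r : R) :
  (fun F' => if F' == F then r else 0) \in bounded_family.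
Proof.
have [D uD rD] := hcomp_sum (gr_grading R) r.
apply/asboolP; exists D => F' d dD; case: eqP => _; last exact: hcomp0.
rewrite rD hcomp_bigsum big1_seq // => e /andP[_ eD].
by rewrite hcompK; case: eqP => // de; rewrite de eD in dD.
Qed.

Definition at_ (F : K) (r : R) : prodR := ProdR (at_subproof F r).

Definition idem (F : K) : prodR := at_ F 1.

Lemma const_subproof (q : rat) : (fun=> q%:A) \in bounded_family.
Proof.
have [D uD rD] := hcomp_sum (gr_grading R) q%:A.
apply/asboolP; exists D => F' d dD; rewrite rD hcomp_bigsum big1_seq // => e.
by move=> /andP[_ eD]; rewrite hcompK; case: eqP => // de; rewrite de eD in dD.
Qed.

Definition const (q : rat) : prodR := ProdR (const_subproof q).

Definition prod_homog (d : int) (a : prodR) : Prop :=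
  forall F, homog (gr_grading R) d (a F).

(* The grading of S^{-1}O: a fraction a/s, where every s(F) is homogeneous, has
   degree d if deg a(F) = d + deg s(F) for all F. The degree of s(F) may depend
   on F. *)
Definition loc_homog (S : mulset prodR) (d : int) (x : loc_ring S) : Prop :=
  exists (a : prodR) (s : den S) (e : K -> int),
    [/\ x = rfrac a s,
        forall F, homog (gr_grading R) (e F) ((val s : prodR) F) &
        forall F, homog (gr_grading R) (d + e F) (a F)].

End Product.

Arguments at_ {K R}.
Arguments idem {K R}.
Arguments const {K R}.

Record sheaf (K : choiceType) := Sheaf {
  stalk : gradedRing;
  mset : mulset (prodR K stalk) }.

Definition OK (K : choiceType) (X : sheaf K) : comPzRingType :=
  prodR K (stalk X).
Definition SOK (K : choiceType) (X : sheaf K) : comPzRingType :=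
  loc_ring (mset X).

Section Type0.
Context (K : choiceType).

Definition hcomp_triv (d : int) (q : rat^o) : rat^o := if d == 0 then q else 0.

Lemma hcomp_trivD d x y :
  hcomp_triv d (x + y) = hcomp_triv d x + hcomp_triv d y.
Proof. by rewrite /hcomp_triv; case: ifP; rewrite ?addr0. Qed.

Lemma hcomp_trivK d e x : hcomp_triv d (hcomp_triv e x) =
  if d == e then hcomp_triv e x else 0.
Proof.
rewrite /hcomp_triv; have [->|de] := eqVneq d e; first by case: (e == 0).
have [d0|//] := eqVneq d 0; case: eqP => // e0.
by rewrite d0 e0 eqxx in de.
Qed.

Lemma hcomp_triv_sum x : exists2 D : seq int, uniq D &
  x = \sum_(d <- D) hcomp_triv d x.
Proof. by exists [:: 0] => //; rewrite big_seq1 /hcomp_triv eqxx. Qed.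

Definition grading_triv : grading rat^o :=
  Grading hcomp_trivD hcomp_trivK hcomp_triv_sum.

Lemma triv_homog1 : homog grading_triv 0 1. Proof. by []. Qed.

Lemma triv_homogM d e (x y : rat^o) : homog grading_triv d x ->
  homog grading_triv e y -> homog grading_triv (d + e) (x * y).
Proof.
rewrite /homog /= /hcomp_triv; have [->|_] := eqVneq d 0.
  by rewrite add0r => _; case: ifP => // _ <-; rewrite mulr0.
by move=> <- _; rewrite mul0r if_same.
Qed.

Definition gr_rat : gradedRing := GradedRing triv_homog1 triv_homogM.

Definition mset0 : set (prodR K gr_rat) := [set s |
  (forall F, s F = 0 \/ s F = 1) /\ finite_set [set F | s F <> 1]].

Lemma mset0_1 : mset0 1.
Proof.
split=> [F|]; first by right.
apply: (@sub_finite_set _ _ classical_sets.set0) => // F /=; exact.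
Qed.

Lemma mset0_M s t : mset0 s -> mset0 t -> mset0 (s * t).
Proof.
move=> [s01 fs] [t01 ft]; split=> [F|].
  rewrite prodR_mulE; case: (s01 F) => ->; first by rewrite mul0r; left.
  by rewrite mul1r; exact: t01.
apply: (@sub_finite_set _ _ ([set F | s F <> 1] `|` [set F | t F <> 1])).
  move=> F st1; have [s1|] := pselect (s F = 1); last by left.
  by right=> t1; case: st1; rewrite prodR_mulE s1 t1 mulr1.
by rewrite finite_setU.
Qed.

Definition type0 : sheaf K := Sheaf (Mulset mset0_1 mset0_M).

End Type0.

Section Type1.
Context (K : choiceType).

(* c = 'X has degree -2 *)
Definition hcomp_pol (d : int) (p : {poly rat}) : {poly rat} :=
  \poly_(k < size p) (if - (k.*2)%:Z == d then p`_k else 0).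

Lemma coef_hcomp_pol d p k :
  (hcomp_pol d p)`_k = if - (k.*2)%:Z == d then p`_k else 0.
Proof.
rewrite coef_poly; case: ltnP => // kp.
by rewrite [p`_k]nth_default // if_same.
Qed.

Lemma hcomp_polD d x y : hcomp_pol d (x + y) = hcomp_pol d x + hcomp_pol d y.
Proof.
apply/polyP => k; rewrite coefD !coef_hcomp_pol coefD.
by case: ifP; rewrite ?addr0.
Qed.

Lemma hcomp_polK d e x : hcomp_pol d (hcomp_pol e x) =
  if d == e then hcomp_pol e x else 0.
Proof.
apply/polyP => k; rewrite !coef_hcomp_pol; have [->|de] := eqVneq d e.
  by rewrite coef_hcomp_pol; case: (_ == e).
rewrite coef0; have [kd|//] := eqVneq (- (k.*2)%:Z) d.
by case: eqP => // ke; rewrite -kd ke eqxx in de.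
Qed.

Lemma hcomp_pol_sum x : exists2 D : seq int, uniq D &
  x = \sum_(d <- D) hcomp_pol d x.
Proof.
exists [seq - (k.*2)%:Z | k <- iota 0 (size x)].
  rewrite map_inj_uniq ?iota_uniq // => i j /oppr_inj [].
  exact: double_inj.
apply/polyP => k; rewrite coef_sum big_map.
under eq_bigr do rewrite coef_hcomp_pol eqr_opp eqz_nat (inj_eq double_inj).
have [kx|kx] := ltnP k (size x); last first.
  by rewrite [LHS]nth_default // big1 // => i _; rewrite nth_default // if_same.
rewrite (bigD1_seq k) ?iota_uniq ?mem_iota //= eqxx big1 ?addr0 // => i.
by rewrite eq_sym => /negbTE ->.
Qed.

Definition grading_pol : grading {poly rat} :=
  Grading hcomp_polD hcomp_polK hcomp_pol_sum.

Lemma homog_polP d p : homog grading_pol d p <->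
  forall k, p`_k != 0 -> - (k.*2)%:Z = d.
Proof.
split=> [h k|h]; last first.
  apply/polyP => k; rewrite coef_hcomp_pol; case: eqP => // kd.
  by case: (eqVneq p`_k 0) => [//|/h].
move=> pk; apply/eqP; move: pk; rewrite -h coef_hcomp_pol.
by case: (_ == d) => //; rewrite eqxx.
Qed.

Lemma pol_homog1 : homog grading_pol 0 1.
Proof. by apply/homog_polP => k; rewrite coef1; case: k => //=; rewrite eqxx. Qed.

Lemma pol_homogM d e x y : homog grading_pol d x ->
  homog grading_pol e y -> homog grading_pol (d + e) (x * y).
Proof.
move=> /homog_polP xd /homog_polP ye; apply/homog_polP => k; rewrite coefM.
have [i /andP[xi yi]|no] :=
  pickP (fun i : 'I_k.+1 => (x`_i != 0) && (y`_(k - i) != 0)).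
  by rewrite -(xd i) // -(ye (k - i)%N) //= -opprD -PoszD -doubleD subnKC // -ltnS.
rewrite big1 ?eqxx // => i _; apply/eqP; rewrite mulf_eq0.
by have /negbT := no i; rewrite negb_and !negbK.
Qed.

Definition gr_pol : gradedRing := GradedRing pol_homog1 pol_homogM.

Definition mset1 : set (prodR K gr_pol) := [set s |
  exists eps : K -> nat,
    finite_set [set F | eps F <> 0%N] /\ forall F, s F = 'X^(eps F)].

Lemma mset1_1 : mset1 1.
Proof.
exists (fun=> 0%N); split=> [|F]; last by rewrite expr0.
apply: (@sub_finite_set _ _ classical_sets.set0) => // F /=; exact.
Qed.

Lemma mset1_M s t : mset1 s -> mset1 t -> mset1 (s * t).
Proof.
move=> [e [fe se]] [h [fh th]]; exists (fun F => e F + h F)%N; split=> [|F].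
  apply: (@sub_finite_set _ _ ([set F | e F <> 0%N] `|` [set F | h F <> 0%N])).
    move=> F /= eh; case: (eqVneq (e F) 0%N) => [e0|/eqP]; last by left.
    by right=> h0; apply: eh; rewrite e0 h0.
  by rewrite finite_setU.
by rewrite prodR_mulE se th exprD.
Qed.

Definition type1 : sheaf K := Sheaf (Mulset mset1_1 mset1_M).

End Type1.

Definition group_act (gT : finGroupType) (T : Type) (f : gT -> T -> T) :=
  (forall x, f 1%g x = x) /\ (forall g h x, f (g * h)%g x = f g (f h x)).

Record compstr (K : choiceType) (X : sheaf K) := CompStr {
  WF : K -> finGroupType;
  WK : finGroupType;
  (* [None] where there is no homomorphism *)
  Whom : forall F, option {morphism [set: WF F] >-> WK};
  Whom_cofinite : finite_set [set F | Whom F = None];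
  WF_act : forall F, WF F -> {rmorphism stalk X -> stalk X};
  WF_actP : forall F, group_act (fun w : WF F => WF_act w : stalk X -> stalk X);
  WF_act_hcomp : forall F (w : WF F) d r,
    WF_act w (gr_grading (stalk X) d r) = gr_grading (stalk X) d (WF_act w r);
  WK_act : WK -> {rmorphism rat -> rat};
  WK_actP : group_act (fun w => WK_act w : rat -> rat);
  W_unit_equiv : forall F phi, Whom F = Some phi ->
    forall (w : WF F) (q : rat), WF_act w q%:A = (WK_act (phi w) q)%:A;
  W_mset_inv : forall s, mulset_set (mset X) s ->
    forall F (w : WF F), WF_act w (s F) = s F }.

Definition semilinear (A B : pzRingType) (f : A -> B)
    (M : lmodType A) (N : lmodType B) (a : M -> N) : Prop :=
  forall r x y, a (r *: x + y) = f r *: a x + a y.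

Lemma semilinear0 (A B : pzRingType) (f : A -> B) (M : lmodType A)
  (N : lmodType B) (a : M -> N) : f 1 = 1 -> semilinear f a -> a 0 = 0.
Proof.
move=> f1 af; have := af 1 0 0; rewrite f1 !scale1r addr0 => a0.
by apply: (addrI (a 0)); rewrite addr0 -a0.
Qed.

Lemma semilinearZ (A B : pzRingType) (f : A -> B) (M : lmodType A)
    (N : lmodType B) (a : M -> N) : f 1 = 1 -> semilinear f a ->
  forall r x, a (r *: x) = f r *: a x.
Proof.
by move=> f1 af r x; have := af r x 0; rewrite (semilinear0 f1 af) !addr0.
Qed.

Lemma semilinearD (A B : pzRingType) (f : A -> B) (M : lmodType A)
    (N : lmodType B) (a : M -> N) : f 1 = 1 -> semilinear f a ->
  forall x y, a (x + y) = a x + a y.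
Proof. by move=> f1 af x y; have := af 1 x y; rewrite f1 !scale1r. Qed.

Section StandardModel.
Context (K : choiceType) (X : sheaf K) (W : compstr X).

Definition to_SOK (a : OK X) : SOK X := to_loc (mset X) a.
Definition unitSOK (q : rat) : SOK X := to_SOK (const q).

Lemma to_SOK1 : to_SOK 1 = 1. Proof. by []. Qed.

Lemma unitSOK1 : unitSOK 1 = 1.
Proof.
rewrite -to_SOK1; congr to_SOK.
by apply: val_inj; apply/funext => F /=; rewrite scale1r.
Qed.

Definition ind_loc (N : lmodType (OK X)) (P : lmodType (SOK X)) (a : N -> P)
    (x : loc (mset X) N) : P :=
  (inv_loc (qrepr x).2 : SOK X) *: a (qrepr x).1.

Lemma ind_loc_frac (N : lmodType (OK X)) (P : lmodType (SOK X)) (a : N -> P) :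
  semilinear to_SOK a ->
  forall n (s : den (mset X)),
    ind_loc a (frac n s) = (inv_loc s : SOK X) *: a n.
Proof.
move=> aL n s; rewrite /ind_loc; have := frac_repr (frac n s).
move: (qrepr _) => -[m t] /= /fracP[u /(congr1 a)].
rewrite !(semilinearZ to_SOK1 aL) => eq_nm.
pose iU := inv_loc u : SOK X; pose iS := inv_loc s : SOK X.
pose iT := inv_loc t : SOK X; pose toS (r : den (mset X)) := to_SOK (val r).
have iUK : iU * toS u = 1 := inv_locK u.
have iSK : iS * toS s = 1 := inv_locK s.
have iTK : iT * toS t = 1 := inv_locK t.
transitivity ((iT * iU * iS) *: (toS u *: (toS s *: a m))).
  rewrite !scalerA; congr (_ *: _); rewrite -/iT.
  transitivity (iT * (iU * toS u) * (iS * toS s)); last by ring.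
  by rewrite iUK iSK; ring.
rewrite -[toS u *: _]eq_nm !scalerA; congr (_ *: _); rewrite -/iS.
transitivity (iS * (iU * toS u) * (iT * toS t)); first by rewrite /toS; ring.
by rewrite iUK iTK; ring.
Qed.

Definition ind_tens (P : lmodType (SOK X)) (V : lmodType rat) (b : V -> P)
    (x : tensor unitSOK V) : P :=
  \sum_(p <- qrepr x) p.1 *: b p.2.

Lemma ind_tens_pi (P : lmodType (SOK X)) (V : lmodType rat) (b : V -> P) :
  semilinear unitSOK b ->
  forall x : seq (SOK X * V),
    ind_tens b (\pi_(tensor unitSOK V) x) = \sum_(p <- x) p.1 *: b p.2.
Proof.
move=> bL x; rewrite /ind_tens.
suff eqS y z : tens_eq unitSOK y z ->
    \sum_(p <- y) p.1 *: b p.2 = \sum_(p <- z) p.1 *: b p.2.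
  have : \pi_(tensor unitSOK V) (qrepr (\pi_(tensor unitSOK V) x)) =
         \pi_(tensor unitSOK V) x by exact: reprK.
  by move/eqmodP/asboolP; exact: eqS.
elim=> {x y z} //.
- by move=> x y z _ xy _ yz; rewrite xy.
- by move=> x x' y y' _ xx' _ yy'; rewrite !big_cat /= xx' yy'.
- by move=> x y; rewrite !big_cat /= addrC.
- by move=> c c' v; rewrite !big_cons !big_nil /= !addr0 scalerDl.
- move=> c v v'; rewrite !big_cons !big_nil /= !addr0.
  by rewrite (semilinearD unitSOK1 bL) scalerDr.
- move=> c q v; rewrite !big_cons !big_nil /= !addr0.
  by rewrite (semilinearZ unitSOK1 bL) scalerA.
- by move=> v; rewrite !big_cons !big_nil /= scale0r addr0.
Qed.

Record smdiag := SMDiag {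
  sN : lmodType (OK X);
  sP : lmodType (SOK X);
  sV : lmodType rat;
  gN : grading sN;
  gP : grading sP;
  gV : grading sV;
  gN_mod : forall d e (a : OK X) n, prod_homog d a -> homog gN e n ->
    homog gN (d + e) (a *: n);
  gP_mod : forall d e (x : SOK X) p, loc_homog d x -> homog gP e p ->
    homog gP (d + e) (x *: p);
  gV_mod : forall e (q : rat) v, homog gV e v -> homog gV e (q *: v);
  sNP : sN -> sP;
  sVP : sV -> sP;
  sNP_lin : semilinear to_SOK sNP;
  sVP_lin : semilinear unitSOK sVP;
  sNP_deg : forall d n, sNP (gN d n) = gP d (sNP n);
  sVP_deg : forall d v, sVP (gV d v) = gP d (sVP v);
  sNP_iso : bijective (@ind_loc sN sP sNP);
  sVP_iso : bijective (@ind_tens sP sV sVP) }.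

(* The action of W_F on e_F N is encoded as the map (w, n) |-> w (e_F n) on the
   whole of N; thus the identity of W_F acts as e_F. *)
Definition is_actN (D : smdiag) (act : forall F, WF W F -> sN D -> sN D) :=
  forall F,
  [/\ forall n, act F 1%g n = (idem F : OK X) *: n,
      forall g h n, act F (g * h)%g n = act F g (act F h n),
      forall g (a : OK X) n m, act F g (a *: n + m) =
        (at_ F (WF_act g ((a : prodR K (stalk X)) F)) : OK X) *: act F g n
        + act F g m &
      forall g d n, act F g (gN D d n) = gN D d (act F g n)].

Definition is_actV (D : smdiag) (act : WK W -> sV D -> sV D) :=
  [/\ group_act act,
      forall g, semilinear (WK_act g) (act g) &
      forall g d v, act g (gV D d v) = gV D d (act g v)].

(* Let n/s and n'/s' be the images of v and g v under V -> P = S^{-1}N. For w in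
   W_F over g, equivariance of V -> S^{-1}N -> S^{-1}e_F N says that
   w (e_F n)/s = (e_F n')/s', i.e. that the two sides agree after
   multiplication by some u in S. The u is required to be common to all F (and
   w), so that this is equivariance as germs: in S^{-1} prod_F e_F N, and not
   only in each S^{-1}e_F N, which would be vacuous for [type0], where
   S^{-1}e_F N = 0. *)
Definition equivariantVN (D : smdiag) (actN : forall F, WF W F -> sN D -> sN D)
    (actV : WK W -> sV D -> sV D) :=
  forall (g : WK W) (v : sV D) (n n' : sN D) (s s' : den (mset X)),
  ind_loc (@sNP D) (frac n s) = sVP v ->
  ind_loc (@sNP D) (frac n' s') = sVP (actV g v) ->
  exists u : den (mset X),
    forall F phi, Whom W F = Some phi -> forall w : WF W F, phi w = g ->
      (val u : OK X) *: ((val s' : OK X) *: actN F w n) =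
      (val u : OK X) *: ((val s : OK X) *: ((idem F : OK X) *: n')).

Record smobj := SMObj {
  sdiag :> smdiag;
  actN : forall F, WF W F -> sN sdiag -> sN sdiag;
  actV : WK W -> sV sdiag -> sV sdiag;
  actNP : is_actN actN;
  actVP : is_actV actV;
  act_equiv : equivariantVN actN actV }.

Definition is_smhom (D E : smobj)
    (fN : sN D -> sN E) (fP : sP D -> sP E) (fV : sV D -> sV E) : Prop :=
  [/\ semilinear id fN, semilinear id fP & semilinear id fV] /\
  [/\ forall d n, fN (gN D d n) = gN E d (fN n),
      forall d p, fP (gP D d p) = gP E d (fP p) &
      forall d v, fV (gV D d v) = gV E d (fV v)] /\
  [/\ forall n, fP (sNP n) = sNP (fN n),
      forall v, fP (sVP v) = sVP (fV v),
      forall F (w : WF W F) n, fN (actN w n) = actN w (fN n) &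
      forall w v, fV (actV w v) = actV w (fV v)].

Record smhom (D E : smobj) := SMHom {
  hN : sN D -> sN E;
  hP : sP D -> sP E;
  hV : sV D -> sV E;
  smhomP : is_smhom hN hP hV }.

Lemma smhom_eq (D E : smobj) (f g : smhom D E) :
  hN f =1 hN g -> hP f =1 hP g -> hV f =1 hV g -> f = g.
Proof.
case: f g => [fN fP fV pf] [gN gP gV pg] /= /funext eN /funext eP /funext eV.
by subst; congr SMHom; exact: Prop_irrelevance.
Qed.

Lemma smid_subproof (D : smobj) : @is_smhom D D id id id.
Proof. by do !split. Qed.
Definition smid D : smhom D D := SMHom (smid_subproof D).

Lemma smcomp_subproof (D E G : smobj) (g : smhom E G) (f : smhom D E) :
  is_smhom (hN g \o hN f) (hP g \o hP f) (hV g \o hV f).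
Proof.
case: f => fN fP fV [[a1 a2 a3] [[b1 b2 b3] [c1 c2 c3 c4]]].
case: g => gN gP gV [[a1' a2' a3'] [[b1' b2' b3'] [c1' c2' c3' c4']]] /=.
split; [|split]; split.
- by move=> r x y /=; rewrite a1 a1'.
- by move=> r x y /=; rewrite a2 a2'.
- by move=> r x y /=; rewrite a3 a3'.
- by move=> * /=; rewrite b1 b1'.
- by move=> * /=; rewrite b2 b2'.
- by move=> * /=; rewrite b3 b3'.
- by move=> * /=; rewrite c1 c1'.
- by move=> * /=; rewrite c2 c2'.
- by move=> * /=; rewrite c3 c3'.
- by move=> * /=; rewrite c4 c4'.
Qed.
Definition smcomp D E G (g : smhom E G) (f : smhom D E) : smhom D G :=
  SMHom (smcomp_subproof g f).

Lemma smzero_subproof (D E : smobj) :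
  @is_smhom D E (fun=> 0) (fun=> 0) (fun=> 0).
Proof.
have NP0 : sNP (0 : sN E) = 0 := semilinear0 to_SOK1 (@sNP_lin E).
have VP0 : sVP (0 : sV E) = 0 := semilinear0 unitSOK1 (@sVP_lin E).
have actN0 F (w : WF W F) : actN w (0 : sN E) = 0.
  have [act1 actM lin _] := actNP E F; rewrite -[w]mul1g actM act1.
  have := lin w 1 0 0; rewrite scaler0 addr0 prodR_1E rmorph1 => h.
  by apply: (addIr (actN w 0)); rewrite add0r -h.
have actV0 w : actV w (0 : sV E) = 0.
  by have [_ lin _] := actVP E; apply: semilinear0 (lin w); exact: rmorph1.
split; [|split]; split; try by move=> r x y; rewrite scaler0 addr0.
all: by move=> *; rewrite ?hcomp0.
Qed.
Definition smzero D E : smhom D E := SMHom (smzero_subproof D E).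

Lemma smcompm0 D E G (f : smhom E G) : smcomp f (smzero D E) = smzero D G.
Proof.
case: f => fN fP fV [[a1 a2 a3] fH].
by apply: smhom_eq => x /=; [exact: semilinear0 a1 | exact: semilinear0 a2 |
  exact: semilinear0 a3].
Qed.

Lemma smcompA D E G H (h : smhom G H) (g : smhom E G) (f : smhom D E) :
  smcomp h (smcomp g f) = smcomp (smcomp h g) f.
Proof. exact: smhom_eq. Qed.

Lemma smcomp1m D E (f : smhom D E) : smcomp (smid E) f = f.
Proof. exact: smhom_eq. Qed.

Lemma smcompm1 D E (f : smhom D E) : smcomp f (smid D) = f.
Proof. exact: smhom_eq. Qed.

Lemma smcomp0m D E G (f : smhom D E) : smcomp (smzero E G) f = smzero D G.
Proof. exact: smhom_eq. Qed.

Definition standard_model : category :=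
  Category smcompA smcomp1m smcompm1 smcomp0m smcompm0.

End StandardModel.

(* Main.v *)
(* Off finitely many [F], an object is determined by [V]: its torsion
   [T = ker (N -> P)] is the direct sum of the [e_F T], and an element of [N] is,
   up to finitely many coordinates, an [O]-linear combination of lifts of
   elements of [V]. Since the groups are finite and everything is rational,
   equivariance is obtained by averaging, and every representation of [W_K] is
   injective.

   For Type 1, a torsion object [D -> 0 <- 0] is injective as soon as [D] is
   divisible: one extends over a complement of [V] by 0 on suitable lifts, and
   then, at finitely many [F] for each element, by Baer's criterion over [Q[c]].
   With [D] a divisible torsion module containing [T], the object
   [P (+) D -> P <- V] is injective and contains [N -> P <- V]. The quotient is
   [J -> 0 <- 0] where [J = (P (+) D) / N] is again torsion and divisible.

   For Type 0, objects are sheaves on the one-point compactification of [K], and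
   [N -> P <- V] embeds into the product of the skyscraper of [V] at infinity and
   of those of the [e_F N] at the [F]. The stalk at infinity of the latter
   product is a space of germs of families, coinduced to [W_K], and the cokernel
   is the skyscraper of these germs, which is injective.

   Dimension 0 is excluded by [Q[c]/(c)] at one [F], which is not divisible, and
   by the direct sum of the [e_F O], which is not a retract of [O]. *)

Require Import Defs.
From HB Require Import structures.
From mathcomp Require Import all_boot all_order all_algebra all_fingroup.
From mathcomp Require Import ring.
From mathcomp Require Import boolp classical_sets functions cardinality.

Set Implicit Arguments.
Unset Strict Implicit.
Unset Printing Implicit Defensive.

Import GRing.Theory.
Local Open Scope classical_set_scope.
Local Open Scope ring_scope.
Local Open Scope quotient_scope.

(* [semilinear] and [frac] are shadowed by [ssralg] and [fraction]. *)
Local Notation semilinear := Defs.semilinear.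
Local Notation frac := Defs.frac.

(** Both kinds of injective objects are values of right adjoints, so extending a morphism into them
    splits into extending a map of representations of [W_K] and extending an equivariant map of
    [O]-modules. The second problem separates the types. If [n] lifts a vector at infinity, the
    torsion multiples [a n] constrain the value at [n]. In Type 1 the map [O -> S^{-1}O] is
    injective, so for a suitable lift of a new vector these multiples are zero and the lift may be
    sent to 0; this keeps the values in a torsion module, whose elements have finitely many non-zero
    coordinates. In Type 0 every [e_F] becomes 0 in [S^{-1}O], so all [e_F n] are torsion and their
    prescribed values can be non-zero at infinitely many [F]. Torsion targets then fail and the
    values must lie in a product of the [e_F N], where coordinates are chosen independently because
    [R(F)] is a field. Such a product also needs a stalk at infinity carrying an action of all of
    [W_K], although the [W_F] induce only partial maps on germs; this is the reason for
    coinduction. *)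

(** * Submodules and quotient modules *)

Record submod (A : pzRingType) (M : lmodType A) := Submod {
  submod_set :> M -> Prop;
  submod0 : submod_set 0;
  submodZD : forall a x y,
    submod_set x -> submod_set y -> submod_set (a *: x + y) }.

Section Submodule.
Context (A : pzRingType) (M : lmodType A) (S : submod M).

Lemma submodD x y : S x -> S y -> S (x + y).
Proof. by move=> Sx Sy; rewrite -[x]scale1r; apply: submodZD. Qed.

Lemma submodZ a x : S x -> S (a *: x).
Proof. by move=> Sx; rewrite -[_ *: _]addr0; apply: submodZD; last exact: submod0. Qed.

Lemma submodN x : S x -> S (- x).
Proof. by move=> Sx; rewrite -scaleN1r; apply: submodZ. Qed.

Lemma submodB x y : S x -> S y -> S (x - y).
Proof. by move=> Sx Sy; apply: submodD => //; apply: submodN. Qed.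

Lemma submod_sum (I : eqType) (r : seq I) (F : I -> M) :
  (forall i, i \in r -> S (F i)) -> S (\sum_(i <- r) F i).
Proof.
move=> SF; rewrite big_seq; apply: big_ind => //; first exact: submod0.
exact: submodD.
Qed.

Definition submod_pred : {pred M} := fun x => `[< S x >].

Lemma submod_predP x : reflect (S x) (x \in submod_pred).
Proof. exact: asboolP. Qed.

Lemma submod_pred_closed : submod_closed submod_pred.
Proof.
split=> [|a x y /submod_predP Sx /submod_predP Sy]; apply/submod_predP.
  exact: submod0.
exact: submodZD.
Qed.

HB.instance Definition _ :=
  GRing.isSubmodClosed.Build A M submod_pred submod_pred_closed.

Record subm := Subm { submval :> M; submvalP : submval \in submod_pred }.
HB.instance Definition _ := [isSub for submval].
HB.instance Definition _ := [Choice of subm by <:].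
HB.instance Definition _ := [SubChoice_isSubLmodule of subm by <:].

End Submodule.

Section Linear.
Context (A : pzRingType) (M N : lmodType A) (f : M -> N) (fL : semilinear id f).

Lemma lin0 : f 0 = 0. Proof. exact: semilinear0 fL. Qed.
Lemma linD x y : f (x + y) = f x + f y. Proof. exact: (semilinearD (f := id)). Qed.
Lemma linZ a x : f (a *: x) = a *: f x. Proof. exact: (semilinearZ (f := id)). Qed.

End Linear.

Section QuotientModule.
Context (A : pzRingType) (M : lmodType A) (S : submod M).

(** [Quotient.quot] supplies the additive group only; the scalar action is defined on it below
    through representatives. *)
Definition quotmod : Type := Quotient.quot (submod_pred S).
HB.instance Definition _ := GRing.Zmodule.on quotmod.

Definition qproj (x : M) : quotmod := \pi_(Quotient.quot (submod_pred S)) x.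

Lemma qprojD x y : qproj (x + y) = qproj x + qproj y.
Proof. by rewrite /qproj !piE. Qed.

Lemma qproj_surj y : exists x, y = qproj x.
Proof. by exists (generic_quotient.repr y); rewrite /qproj reprK. Qed.

Lemma qprojP x y : qproj x = qproj y <-> S (x - y).
Proof.
split=> [/eqP|Sxy]; first by rewrite -Quotient.idealrBE => /submod_predP.
by apply/eqP; rewrite -Quotient.idealrBE; apply/submod_predP.
Qed.

Lemma qproj_eq0 x : qproj x = 0 <-> S x.
Proof.
have -> : (0 : quotmod) = qproj 0 by rewrite /qproj piE.
by rewrite qprojP subr0.
Qed.

Definition qscale (a : A) (x : quotmod) : quotmod :=
  qproj (a *: generic_quotient.repr x).

Lemma qscale_pi a x : qscale a (qproj x) = qproj (a *: x).
Proof.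
rewrite /qscale; apply/qprojP; rewrite -scalerBr; apply: submodZ; apply/qprojP.
exact: reprK.
Qed.

Lemma qscaleA a b x : qscale a (qscale b x) = qscale (a * b) x.
Proof. by have [y ->] := qproj_surj x; rewrite !qscale_pi scalerA. Qed.

Lemma qscale1 : left_id 1 qscale.
Proof. by move=> x; have [y ->] := qproj_surj x; rewrite qscale_pi scale1r. Qed.

Lemma qscaleDr : right_distributive qscale +%R.
Proof.
move=> a x y; have [u ->] := qproj_surj x; have [v ->] := qproj_surj y.
by rewrite -qprojD !qscale_pi scalerDr qprojD.
Qed.

Lemma qscaleDl x : {morph qscale^~ x : a b / a + b}.
Proof.
by move=> a b /=; have [y ->] := qproj_surj x; rewrite !qscale_pi scalerDl qprojD.
Qed.

HB.instance Definition _ := GRing.Zmodule_isLmodule.Build A quotmod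
  qscaleA qscale1 qscaleDr qscaleDl.

Lemma qprojZ a x : qproj (a *: x) = a *: qproj x.
Proof. exact/esym/qscale_pi. Qed.

End QuotientModule.

Arguments qproj {A M}.

(** * Gradings *)

Section Grading.
Context (M : zmodType) (g : grading M).

Lemma homog_hcomp d x : homog g d (g d x).
Proof. by rewrite /homog hcompK eqxx. Qed.

Lemma homog0 d : homog g d 0.
Proof. exact: hcomp0. Qed.

Lemma hcomp_homog d e x : homog g e x -> g d x = if d == e then x else 0.
Proof. by move=> ex; rewrite -{1}ex hcompK ex. Qed.

Lemma homogD d x y : homog g d x -> homog g d y -> homog g d (x + y).
Proof. by rewrite /homog hcompD => -> ->. Qed.

Lemma hcompB d x y : g d (x - y) = g d x - g d y.
Proof. by rewrite hcompD hcompN. Qed.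

Lemma homog_ind (P : M -> Prop) :
  P 0 -> (forall x y, P x -> P y -> P (x + y)) ->
  (forall d x, homog g d x -> P x) -> forall x, P x.
Proof.
move=> P0 PD Ph x; have [D _ ->] := hcomp_sum g x.
by apply: big_ind => // d _; apply: Ph (homog_hcomp _ _).
Qed.

Lemma hcomp_inj x y : (forall d, g d x = g d y) -> x = y.
Proof.
move=> xy; apply/eqP; rewrite -subr_eq0; apply/eqP.
have [D _ ->] := hcomp_sum g (x - y).
by rewrite big1 // => d _; rewrite hcompB xy subrr.
Qed.

Lemma hcomp_fin x : exists D : seq int, forall d, d \notin D -> g d x = 0.
Proof.
have [D uD xD] := hcomp_sum g x; exists D => d dD.
rewrite xD hcomp_bigsum big1_seq // => e /andP[_ eD].
by rewrite hcompK; case: eqP => // de; rewrite de eD in dD.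
Qed.

End Grading.

(** The difference between an element and the sum of its finitely many components has all components
    zero, hence vanishes by the third hypothesis. This trades the decomposition axiom for conditions
    that can be checked componentwise. *)
Lemma grading_of_fin (M : zmodType) (h : int -> M -> M) :
  (forall d x y, h d (x + y) = h d x + h d y) ->
  (forall d e x, h d (h e x) = if d == e then h e x else 0) ->
  (forall x, (forall d, h d x = 0) -> x = 0) ->
  (forall x, exists D : seq int, forall d, d \notin D -> h d x = 0) ->
  exists g : grading M, hcomp g = h.
Proof.
move=> hD hK h0 hfin.
have h00 d : h d 0 = 0 by apply: (addrI (h d 0)); rewrite -hD !addr0.
have hN d x : h d (- x) = - h d x.
  by apply: (addrI (h d x)); rewrite -hD !subrr.
have hS x : exists2 D : seq int, uniq D & x = \sum_(d <- D) h d x.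
  have [D DP] := hfin x; exists (undup D); rewrite ?undup_uniq //.
  apply/eqP; rewrite -subr_eq0; apply/eqP/h0 => d; rewrite hD hN.
  have -> : h d (\sum_(e <- undup D) h e x) = \sum_(e <- undup D) h d (h e x).
    elim: (undup D) => [|e s IH]; first by rewrite !big_nil.
    by rewrite !big_cons hD IH.
  have [dD|dD] := boolP (d \in undup D).
    rewrite (bigD1_seq d) ?undup_uniq //= hK eqxx big1 ?addr0 ?subrr // => e ed.
    by rewrite hK eq_sym (negbTE ed).
  rewrite DP; last by rewrite -mem_undup.
  rewrite big1_seq ?subrr // => e /andP[_ eD].
  by rewrite hK; case: eqP => // de; rewrite de eD in dD.
by exists (Grading hD hK hS).
Qed.

Section GradedModule.
Context (A : pzRingType) (hA : int -> A -> Prop) (M : lmodType A).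

(** The degree of a scalar is a relation [hA] and not a grading, because [S^{-1}O] comes with
    [loc_homog] only. *)
Definition graded_mod (g : grading M) := forall d e a x,
  hA d a -> homog g e x -> homog g (d + e) (a *: x).

Lemma hcompZ (g : grading M) : graded_mod g ->
  forall k a d x, hA k a -> g d (a *: x) = a *: g (d - k) x.
Proof.
move=> gM k a d x ka; elim/(homog_ind (g := g)): x => [|x y IHx IHy|e x ex].
- by rewrite scaler0 !hcomp0 scaler0.
- by rewrite scalerDr !hcompD IHx IHy scalerDr.
- rewrite (hcomp_homog _ (gM _ _ _ _ ka ex)) (hcomp_homog _ ex).
  by rewrite subr_eq addrC; case: ifP; rewrite ?scaler0.
Qed.

Lemma hcomp_graded (g : grading M) (gA : grading A) : graded_mod g ->
  (forall d a, homog gA d a -> hA d a) ->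
  forall d e a x, homog g e x -> g d (a *: x) = gA (d - e) a *: x.
Proof.
move=> gM gAh d e a x ex; elim/(homog_ind (g := gA)): a => [|a b IHa IHb|k a ka].
- by rewrite hcomp0 !scale0r hcomp0.
- by rewrite scalerDl !hcompD IHa IHb scalerDl.
- rewrite (hcompZ gM _ _ (gAh _ _ ka)) (hcomp_homog _ ka) (hcomp_homog _ ex).
  rewrite [d - e == k]subr_eq [d - k == e]subr_eq addrC.
  by case: ifP; rewrite ?scaler0 ?scale0r.
Qed.

Section Sub.
Context (g : grading M) (S : submod M) (gS : forall d x, S x -> S (g d x)).

Definition sub_hcomp d (x : subm S) : subm S :=
  Subm (introT (submod_predP S _) (gS d (elimT (submod_predP S _) (submvalP x)))).

Lemma sub_grading_subproof : exists h : grading (subm S), hcomp h = sub_hcomp.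
Proof.
apply: grading_of_fin => [d x y|d e x|x x0|x].
- by apply: val_inj; rewrite /= hcompD.
- by apply: val_inj; rewrite /= hcompK; case: eqP.
- apply: val_inj; apply: (hcomp_inj (g := g)) => d.
  by rewrite hcomp0 -[RHS]/(val (0 : subm S)) -(x0 d).
- have [D DP] := hcomp_fin g (val x); exists D => d dD.
  by apply: val_inj; apply: DP.
Qed.

(** [grading_of_fin] gives mere existence, so the grading is chosen and afterwards known only
    through its defining equation. Most gradings below are obtained in this way. *)
Definition sub_grading := sval (cid sub_grading_subproof).

Lemma sub_gradingE d x : submval (sub_grading d x) = g d (submval x).
Proof. by rewrite /sub_grading (svalP (cid sub_grading_subproof)). Qed.

Lemma sub_graded : graded_mod g ->
  forall d e a x, hA d a -> homog sub_grading e x ->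
    homog sub_grading (d + e) (a *: x).
Proof.
move=> gM d e a x ad ex; apply: val_inj; rewrite /= sub_gradingE.
by apply: gM => //; rewrite /homog -sub_gradingE ex.
Qed.

Definition quot_hcomp d (x : quotmod S) : quotmod S :=
  qproj S (g d (generic_quotient.repr x)).

Lemma quot_hcomp_pi d x : quot_hcomp d (qproj S x) = qproj S (g d x).
Proof. by apply/qprojP; rewrite -hcompB; apply: gS; apply/qprojP; apply: reprK. Qed.

Lemma quot_grading_subproof : exists h : grading (quotmod S), hcomp h = quot_hcomp.
Proof.
have fin x : exists D : seq int, forall d, d \notin D -> quot_hcomp d x = 0.
  have [y ->] := qproj_surj x; have [D DP] := hcomp_fin g y; exists D => d /DP gy.
  by rewrite quot_hcomp_pi gy; apply/qproj_eq0; apply: submod0.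
apply: grading_of_fin => // [d x y|d e x|x].
- have [u ->] := qproj_surj x; have [v ->] := qproj_surj y.
  by rewrite -qprojD !quot_hcomp_pi hcompD qprojD.
- have [u ->] := qproj_surj x; rewrite !quot_hcomp_pi hcompK.
  by case: eqP => // _; apply/qproj_eq0; apply: submod0.
- have [u ->] := qproj_surj x => u0; apply/qproj_eq0.
  have [D _ ->] := hcomp_sum g u; apply: submod_sum => d _.
  by apply/qproj_eq0; rewrite -quot_hcomp_pi.
Qed.

Definition quot_grading := sval (cid quot_grading_subproof).

Lemma quot_gradingE d x : quot_grading d (qproj S x) = qproj S (g d x).
Proof.
rewrite /quot_grading (svalP (cid quot_grading_subproof)).
exact: quot_hcomp_pi.
Qed.

Lemma quot_homog e x : homog quot_grading e x ->
  exists2 y, homog g e y & x = qproj S y.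
Proof.
have [y ->] := qproj_surj x => <-; exists (g e y); first exact: homog_hcomp.
by rewrite quot_gradingE.
Qed.

Lemma quot_graded : graded_mod g ->
  forall d e a x, hA d a -> homog quot_grading e x ->
    homog quot_grading (d + e) (a *: x).
Proof.
move=> gM d e a x ad /quot_homog[y ey ->].
by rewrite /homog -qprojZ quot_gradingE; congr qproj; apply: gM.
Qed.

End Sub.
End GradedModule.

Lemma pairZZ (A : pzRingType) (M N : lmodType A) (a b : A) (m : M) (n : N) :
  a *: (b *: m, n) = ((a * b) *: m, a *: n) :> M * N.
Proof. by congr pair; rewrite /= scalerA. Qed.

Section PairGrading.
Context (M N : zmodType) (g : grading M) (h : grading N).

Definition pair_hcomp d (x : M * N) : M * N := (g d x.1, h d x.2).

Lemma pair_grading_subproof : exists k : grading (M * N)%type, hcomp k = pair_hcomp.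
Proof.
apply: grading_of_fin => [d x y|d e x|[x y] xy0|[x y]].
- by rewrite /pair_hcomp !hcompD.
- by rewrite /pair_hcomp !hcompK; case: eqP.
- by congr pair; [apply: (hcomp_inj (g := g)) => d | apply: (hcomp_inj (g := h)) => d];
    rewrite hcomp0; case: (xy0 d).
- have [D DP] := hcomp_fin g x; have [E EP] := hcomp_fin h y.
  exists (D ++ E) => d; rewrite mem_cat negb_or => /andP[/DP x0 /EP y0].
  by rewrite /pair_hcomp x0 y0.
Qed.

Definition pair_grading := sval (cid pair_grading_subproof).

Lemma pair_gradingE d x : pair_grading d x = (g d x.1, h d x.2).
Proof. by rewrite /pair_grading (svalP (cid pair_grading_subproof)). Qed.

End PairGrading.

Lemma pair_graded (A : pzRingType) (hA : int -> A -> Prop) (M N : lmodType A)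
    (g : grading M) (h : grading N) :
  graded_mod hA g -> graded_mod hA h -> graded_mod hA (pair_grading g h).
Proof.
move=> gM hN d e a [x y] ad; rewrite /homog !pair_gradingE /= => -[ex ey].
by congr pair; [apply: gM | apply: hN].
Qed.

(** * Extension of partial graded linear maps *)

Section Zorn.
Context (A : pzRingType) (gA : grading A) (N T : lmodType A).
Context (gN : grading N) (gT : grading T).
Context (gN_mod : graded_mod (homog gA) gN) (gT_mod : graded_mod (homog gA) gT).
Implicit Types (G : submod (N * T)%type).

(** A linear map of degree 0 on a graded submodule of [N], given by its graph; the second clause is
    single-valuedness. With graphs, unions of chains are immediate. *)
Definition partial_map G :=
  (forall d z, G z -> G (gN d z.1, gT d z.2)) /\ (forall t, G (0, t) -> t = 0).

Lemma partial_map_eq G x t u : partial_map G -> G (x, t) -> G (x, u) -> t = u.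
Proof.
move=> [_ G0] xt xu; apply/eqP; rewrite -subr_eq0; apply/eqP/G0.
by rewrite -(subrr x); apply: (submodB xt xu).
Qed.

Definition extend_set G y t : set (N * T) :=
  [set z | exists a, G (z - a *: (y, t))].

Lemma extend_set0 G y t : extend_set G y t 0.
Proof. by exists 0; rewrite scale0r subr0; apply: submod0. Qed.

Lemma extend_setZD G y t a x z :
  extend_set G y t x -> extend_set G y t z -> extend_set G y t (a *: x + z).
Proof.
move=> [b Gb] [c Gc]; exists (a * b + c).
rewrite scalerDl opprD addrACA -scalerA -scalerBr.
by apply: submodZD.
Qed.

Definition extend G y t : submod (N * T)%type :=
  Submod (extend_set0 G y t) (@extend_setZD G y t).

Lemma extendS G y t z : G z -> extend G y t z.
Proof. by move=> Gz; exists 0; rewrite scale0r subr0. Qed.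

Lemma extend_new G y t : extend G y t (y, t).
Proof. by exists 1; rewrite scale1r subrr; apply: submod0. Qed.

(** Consistency on the multiples of [y] already in the domain keeps the sum of [G] and the module
    generated by [(y, t)] single-valued. It stays graded because [y] and [t] have the same degree:
    components of a multiple of [(y, t)] are multiples by components of the scalar. *)
Lemma extend_partial G e y t : partial_map G -> homog gN e y -> homog gT e t ->
  (forall a x, G (a *: y, x) -> x = a *: t) -> partial_map (extend G y t).
Proof.
move=> [Ggr G0] ey yt Gyt; split=> [d [x u] [a /= Ga]|u [a]].
  exists (gA (d - e) a); have /= := Ggr d _ Ga.
  by rewrite !hcompB (hcomp_graded gN_mod (gA := gA) _ _ _ ey) // (hcomp_graded gT_mod (gA := gA) _ _ _ yt).
rewrite /= -[(a *: (y, t))]/(a *: y, a *: t) => /submodN.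
rewrite -[- _]/(- (0 - a *: y), - (u - a *: t)) sub0r opprK => /Gyt /eqP.
by rewrite opprB -subr_eq0 addrAC subrr sub0r oppr_eq0 => /eqP.
Qed.

(** [Q] is a side condition on graphs, preserved by unions of non-empty chains, and the maximum is
    taken among the graphs that satisfy it. Maximality is put in the form of its later use, by
    adjoining one homogeneous pair. *)
Lemma maximal_partial_map (Q : set (N * T) -> Prop) G0 :
  (forall C : set (set (N * T)), C !=set0 -> (forall X, C X -> Q X) ->
     total_on C subset -> Q (\bigcup_(X in C) X)) ->
  partial_map G0 -> Q (G0 : _ -> Prop) ->
  exists G, [/\ forall z, G0 z -> G z, partial_map G, Q (G : _ -> Prop) &
    forall e y t, homog gN e y -> homog gT e t ->
      (forall a x, G (a *: y, x) -> x = a *: t) ->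
      Q (extend G y t : _ -> Prop) -> G (y, t)].
Proof.
move=> Qchain pG0 QG0.
pose P (Y : set (N * T)) := Y = set0 \/ exists G,
  [/\ Y = (G : _ -> Prop), forall z, G0 z -> G z, partial_map G & Q Y].
have [|Y [PY Ymax]] := @Zorn_bigcup _ P.
  move=> C CP Ctot.
  have [[Y0 CY0 [z0 Yz0]]|C0] := pselect (exists2 Y, C Y & Y !=set0); last first.
    left; apply/seteqP; split=> // z [Y CY Yz]; apply: C0; exists Y => //.
    by exists z.
  right; pose C' := C `&` [set Y | Y !=set0].
  have C'P Y : C' Y -> exists G,
      [/\ Y = (G : _ -> Prop), forall z, G0 z -> G z, partial_map G & Q Y].
    by case=> CY [z Yz]; case: (CP _ CY) => [Y0'|//]; rewrite Y0' in Yz.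
  have UE : \bigcup_(Y in C) Y = \bigcup_(Y in C') Y.
    apply/seteqP; split=> z [Y CY Yz]; last by exists Y => //; case: CY.
    by exists Y => //; split=> //; exists z.
  have C'Y0 : C' Y0 by split=> //; exists z0.
  have two x y : (\bigcup_(Y in C') Y) x -> (\bigcup_(Y in C') Y) y ->
      exists Y, [/\ C' Y, Y x & Y y].
    move=> [Y C'Y Yx] [Z C'Z Zy].
    by case: (Ctot Y Z (proj1 C'Y) (proj1 C'Z)) => YZ;
      [exists Z | exists Y]; split=> //; apply: YZ.
  have U0 : (\bigcup_(Y in C') Y) 0.
    have [G [GE _ _ _]] := C'P _ C'Y0; exists Y0 => //.
    by rewrite GE; apply: submod0.
  have UZD a x y : (\bigcup_(Y in C') Y) x -> (\bigcup_(Y in C') Y) y ->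
      (\bigcup_(Y in C') Y) (a *: x + y).
    move=> Ux Uy; have [Y [C'Y]] := two x y Ux Uy; have [G [GE _ _ _]] := C'P _ C'Y.
    by move=> Yx Yy; exists Y => //; move: Yx Yy; rewrite GE; apply: submodZD.
  exists (Submod U0 UZD); rewrite UE; split=> //=.
  - move=> z Gz; exists Y0 => //; have [G [-> GG _ _]] := C'P _ C'Y0; exact: GG.
  - split=> [d z [Y C'Y Yz]|t [Y C'Y Yt]].
      exists Y => //; have [G [GE _ [Ggr _] _]] := C'P _ C'Y.
      by move: Yz; rewrite GE; apply: Ggr.
    by have [G [GE _ [_ G0'] _]] := C'P _ C'Y; apply: G0'; rewrite GE in Yt.
  - apply: Qchain; first by exists Y0.
      by move=> Y /C'P[G []].
    by move=> Y Z [CY _] [CZ _]; apply: Ctot.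
have [Y0|[G [GE GG pG QG]]] := PY.
  exfalso; apply: (Ymax (G0 : _ -> Prop)); last by right; exists G0.
  rewrite Y0; split=> [z //|/(_ 0)].
  by apply; apply: submod0.
rewrite GE in QG; exists G; split=> // e y t ey et yt Qe.
apply: contrapT => Gyt; apply: (Ymax (extend G y t : _ -> Prop)).
  rewrite GE; split=> [z|]; first exact: extendS.
  by move=> /(_ (y, t)) h; apply: Gyt; apply: h; apply: extend_new.
right; exists (extend G y t); split=> //; last exact: extend_partial ey et _.
by move=> z /GG; apply: extendS.
Qed.

Lemma partial_map_total G : partial_map G ->
  (forall e y, homog gN e y -> exists t, G (y, t)) ->
  exists f : N -> T, [/\ semilinear id f, forall d x, f (gN d x) = gT d (f x) &
    forall x t, G (x, t) <-> t = f x].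
Proof.
move=> pG tot.
have {}tot y : exists t, G (y, t).
  elim/(homog_ind (g := gN)): y => [|x y [t xt] [u yu]|]; last exact: tot.
    by exists 0; apply: submod0.
  by exists (t + u); apply: (submodD xt yu).
have [f fG] := choice tot.
have fE x t : G (x, t) <-> t = f x.
  by split=> [xt|->]; [exact: partial_map_eq pG xt (fG x) | exact: fG].
exists f; split=> // [a x y|d x]; apply/esym/fE.
  exact: (submodZD a (fG x) (fG y)).
exact: ((proj1 pG) d _ (fG x)).
Qed.

End Zorn.

Section GraphAlong.
Context (A : pzRingType) (L N T : lmodType A) (i : L -> N) (f : L -> T).
Context (iL : semilinear id i) (fL : semilinear id f).

(** The relation [f] after the inverse of [i]. It is also used for an [i] with a kernel on which [f]
    vanishes. *)
Definition graph_along_set : set (N * T) := [set z | exists x, z = (i x, f x)].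

Lemma graph_along0 : graph_along_set 0.
Proof.
by exists 0; rewrite (lin0 iL) (lin0 fL).
Qed.

Lemma graph_alongZD a y z :
  graph_along_set y -> graph_along_set z -> graph_along_set (a *: y + z).
Proof. by move=> [u ->] [v ->]; exists (a *: u + v); rewrite iL fL. Qed.

Definition graph_along := Submod graph_along0 graph_alongZD.

Lemma graph_along_partial (gL : grading L) (gN : grading N) (gT : grading T) :
  injective i -> (forall d x, i (gL d x) = gN d (i x)) ->
  (forall d x, f (gL d x) = gT d (f x)) -> partial_map gN gT graph_along.
Proof.
move=> inj_i gi gf; split=> [d _ [x ->] /=|t [x [ix ->]]].
  by exists (gL d x); rewrite gi gf.
rewrite (_ : x = 0) ?(lin0 fL) //.
by apply: inj_i; rewrite -ix (lin0 iL).
Qed.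

End GraphAlong.

(** * Graded linear maps over Q *)

(** Clearing the denominator of [q] reduces the claim to integers. It makes components of gradings
    and ring endomorphisms Q-linear without a separate condition. *)
Lemma additive_rat (U V : lmodType rat) (f : U -> V) :
  (forall x y, f (x + y) = f x + f y) -> forall q x, f (q *: x) = q *: f x.
Proof.
move=> fD q x.
have f0 : f 0 = 0 by apply: (addrI (f 0)); rewrite -fD !addr0.
have fN y : f (- y) = - f y by apply: (addrI (f y)); rewrite -fD !subrr.
have fn n y : f (y *+ n) = f y *+ n.
  by elim: n => [|n IH]; rewrite ?mulr0n // !mulrS fD IH.
have fz (m : int) y : f (m%:~R *: y) = m%:~R *: f y.
  case: m => n; rewrite ?NegzE ?mulrNz ?scaleNr ?fN -!pmulrn !scaler_nat fn //.
have d0 : (denq q)%:~R != 0 :> rat by rewrite intr_eq0 denq_eq0.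
by apply: (scalerI d0); rewrite -fz !scalerA mulrC -numqE fz.
Qed.

Lemma graded_rat_triv (V : lmodType rat) (g : grading V) (d e : int)
    (q : rat) (v : V) :
  homog (grading_triv : grading rat) d q -> homog g e v ->
  homog g (d + e) (q *: v).
Proof.
rewrite /homog /= /hcomp_triv; have [->|_ <-] := eqVneq d 0; last first.
  by rewrite scale0r hcomp0.
by rewrite add0r (additive_rat (hcompD g e)) => _ ->.
Qed.

Section RatExtension.
Context (V T : lmodType rat) (gV : grading V) (gT : grading T).

Lemma rat_extension G0 : partial_map gV gT G0 ->
  exists f : V -> T, [/\ semilinear id f, forall d x, f (gV d x) = gT d (f x) &
    forall x t, G0 (x, t) -> f x = t].
Proof.
move=> pG0; pose gA : grading rat := grading_triv.
have [] := maximal_partial_map (gA := gA) (@graded_rat_triv V gV)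
  (@graded_rat_triv T gT) (Q := fun=> True) _ pG0 => // G [GG pG _ Gmax].
have [e y ey|f [fL gf fG]] := partial_map_total pG; last first.
  by exists f; split=> // x t /GG /fG.
have [//|ny] := pselect (exists t, G (y, t)).
(* Over a field only the zero multiple of a vector outside the domain can lie in the domain, so the
   value 0 is consistent. *)
exists 0; apply: (Gmax e) => //; first exact: homog0.
move=> a x Gx; rewrite scaler0; have [a0|a0] := eqVneq a 0.
  by apply: (proj2 pG); rewrite a0 scale0r in Gx.
case: ny; exists (a^-1 *: x); have := submodZ a^-1 Gx.
by rewrite pairZZ mulVf // scale1r.
Qed.

Lemma rat_extension_along (L : lmodType rat) (gL : grading L) (i : L -> V)
    (f : L -> T) : semilinear id i -> semilinear id f -> injective i ->
  (forall d x, i (gL d x) = gV d (i x)) ->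
  (forall d x, f (gL d x) = gT d (f x)) ->
  exists h : V -> T, [/\ semilinear id h, forall d x, h (gV d x) = gT d (h x) &
    forall x, h (i x) = f x].
Proof.
move=> iL fL inj_i gi gf.
have [h [hL gh hE]] := rat_extension (graph_along_partial iL fL inj_i gi gf).
by exists h; split=> // x; apply: hE; exists x.
Qed.

End RatExtension.

Section ConcentratedGrading.
Context (M : zmodType).

Definition conc_hcomp (d : int) (x : M) : M := if d == 0 then x else 0.

Lemma conc_grading_subproof : exists g : grading M, hcomp g = conc_hcomp.
Proof.
rewrite /conc_hcomp; apply: grading_of_fin => [d x y|d e x|x /(_ 0) //|x].
- by case: ifP; rewrite ?addr0.
- have [->|de] := eqVneq d e; first by case: (e == 0).
  case: eqP => // d0; case: eqP => // e0.
  by rewrite d0 e0 eqxx in de.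
- by exists [:: 0] => d; rewrite inE => /negbTE ->.
Qed.

(** Lets graded statements be applied where degrees are to be ignored. *)
Definition conc_grading := sval (cid conc_grading_subproof).

Lemma conc_gradingE d x : conc_grading d x = if d == 0 then x else 0.
Proof. by rewrite /conc_grading (svalP (cid conc_grading_subproof)). Qed.

End ConcentratedGrading.

(** * The ring [O] and its idempotents *)

Section ProductRing.
Context (K : choiceType) (R : gradedRing).
Local Notation O := (prodR K R).
Implicit Types (a b : O) (F : K) (A : seq K).

Lemma prodR_eq a b : (forall F, a F = b F) -> a = b.
Proof. by move=> ab; apply: val_inj; apply/funext. Qed.

Lemma prodR_addE a b F : (a + b) F = a F + b F. Proof. by []. Qed.
Lemma prodR_oppE a F : (- a) F = - a F. Proof. by []. Qed.

Lemma prodR_sumE (I : Type) (r : seq I) (G : I -> O) F :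
  (\sum_(i <- r) G i) F = \sum_(i <- r) (G i) F.
Proof. by elim: r => [|i r IH]; rewrite ?big_nil // !big_cons -IH. Qed.

Lemma at_E F (r : R) F' : (at_ F r : O) F' = if F' == F then r else 0.
Proof. by []. Qed.

Lemma idemE F F' : (idem F : O) F' = if F' == F then 1 else 0.
Proof. by []. Qed.

Lemma idem_mul F a : idem F * a = at_ F (a F).
Proof.
by apply: prodR_eq => F'; rewrite prodR_mulE idemE at_E; case: eqP => [->|_];
  rewrite ?mul1r ?mul0r.
Qed.

Lemma at_mul F (r r' : R) : at_ F (r * r') = at_ F r * at_ F r' :> O.
Proof.
by apply: prodR_eq => F'; rewrite prodR_mulE !at_E; case: eqP; rewrite ?mul0r.
Qed.

Lemma idem_idem F : idem F * idem F = idem F :> O.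
Proof. by rewrite -at_mul mulr1. Qed.

Lemma idem_neq F F' : F != F' -> idem F * idem F' = 0 :> O.
Proof.
move=> FF'; rewrite idem_mul idemE (negbTE FF').
by apply: prodR_eq => F2; rewrite at_E if_same.
Qed.

Lemma bounded_homog0 (f : K -> R) : (forall F, homog (gr_grading R) 0 (f F)) ->
  f \in @bounded_family K R.
Proof.
move=> f0; apply/asboolP; exists [:: 0] => F d; rewrite inE => d0.
by rewrite (hcomp_homog _ (f0 F)) (negbTE d0).
Qed.

Lemma ifin_subproof A :
  (fun F => if F \in A then 0 else 1 : R) \in @bounded_family K R.
Proof.
apply: bounded_homog0 => F; case: ifP => _; [exact: homog0|exact: gr_homog1].
Qed.

(** The idempotent of the complement of the finite set [A]: a statement off [A] becomes an equation
    multiplied by it. *)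
Definition coidem A : O := ProdR (ifin_subproof A).

Lemma coidemE A F : coidem A F = if F \in A then 0 else 1. Proof. by []. Qed.

Lemma coidemM A B : coidem A * coidem B = coidem (A ++ B).
Proof.
apply: prodR_eq => F; rewrite prodR_mulE !coidemE mem_cat.
by case: (F \in A); rewrite ?mul0r ?mul1r.
Qed.

Lemma coidem_sub A B : {subset A <= B} -> coidem B * coidem A = coidem B.
Proof.
move=> AB; apply: prodR_eq => F; rewrite prodR_mulE !coidemE.
case: ifPn => FB; first by rewrite mul0r.
by case: ifPn => FA; [rewrite (AB _ FA) in FB | rewrite mulr1].
Qed.

Lemma coidem_idem A F : coidem A * idem F = if F \in A then 0 else idem F.
Proof.
apply: prodR_eq => F'; rewrite prodR_mulE coidemE idemE.
have [->|FF'] := eqVneq F' F; first by case: ifP; rewrite ?mul0r ?mul1r // idemE eqxx.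
by rewrite mulr0; case: ifP; rewrite // idemE (negbTE FF').
Qed.

Lemma coidem_split A : uniq A -> 1 = coidem A + \sum_(F <- A) idem F.
Proof.
move=> uA; apply: prodR_eq => F; rewrite prodR_addE prodR_sumE coidemE prodR_1E.
under eq_bigr do rewrite idemE.
case: ifPn => FA.
  rewrite (bigD1_seq F) //= eqxx big1 ?addr0 ?add0r // => F' F'F.
  by rewrite eq_sym (negbTE F'F).
rewrite big1_seq ?addr0 // => F' /andP[_ F'A].
by case: eqP => // FF'; rewrite FF' F'A in FA.
Qed.

Lemma coidem_homog A : prod_homog 0 (coidem A).
Proof.
by move=> F; rewrite coidemE; case: ifP => _; [exact: homog0|exact: gr_homog1].
Qed.

Lemma at_homog d F (r : R) : homog (gr_grading R) d r ->
  prod_homog d (at_ F r : O).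
Proof. by move=> rd F'; rewrite at_E; case: ifP => // _; exact: homog0. Qed.

Lemma idem_homog F : prod_homog 0 (idem F : O).
Proof. by apply: at_homog; apply: gr_homog1. Qed.

Lemma prod_hcomp_subproof d a :
  (fun F => gr_grading R d (a F)) \in @bounded_family K R.
Proof.
have /asboolP[D DP] := prod_bounded a; apply/asboolP; exists D => F e /DP ae.
by rewrite hcompK; case: eqP => // <-.
Qed.

Definition prod_hcomp d a : O := ProdR (prod_hcomp_subproof d a).

(** The degree bound common to all coordinates of an element of [prodR] is what leaves only finitely
    many components. *)
Lemma prod_grading_subproof : exists g : grading O, hcomp g = prod_hcomp.
Proof.
apply: grading_of_fin => [d a b|d e a|a a0|a].
- by apply: prodR_eq => F; rewrite /= hcompD.
- by apply: prodR_eq => F; rewrite /= hcompK; case: eqP.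
- apply: prodR_eq => F; apply: (hcomp_inj (g := gr_grading R)) => d.
  by rewrite hcomp0 -[RHS]/((0 : O) F) -(a0 d).
- have /asboolP[D DP] := prod_bounded a; exists D => d dD.
  by apply: prodR_eq => F; apply: DP.
Qed.

Definition prod_grading := sval (cid prod_grading_subproof).

Lemma prod_gradingE d a F : prod_grading d a F = gr_grading R d (a F).
Proof. by rewrite /prod_grading (svalP (cid prod_grading_subproof)). Qed.

Lemma prod_homogP d a : homog prod_grading d a -> prod_homog d a.
Proof. by move=> ad F; rewrite /homog -prod_gradingE ad. Qed.

Lemma prod_homogM d e a b : prod_homog d a -> prod_homog e b ->
  prod_homog (d + e) (a * b).
Proof. by move=> ad be F; rewrite prodR_mulE; apply: gr_homogM. Qed.

Lemma scalar_homog (q : rat) : homog (gr_grading R) 0 (q%:A : R).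
Proof.
rewrite /homog (additive_rat (hcompD (gr_grading R) 0)).
by rewrite (gr_homog1 R).
Qed.

Lemma const_homog q : prod_homog 0 (const q : O).
Proof. by move=> F; apply: scalar_homog. Qed.

Lemma constM p q : const (p * q) = const p * const q :> O.
Proof.
by apply: prodR_eq => F; rewrite prodR_mulE /= -scalerAl mul1r scalerA.
Qed.

Lemma const1 : const 1 = 1 :> O.
Proof. by apply: prodR_eq => F /=; rewrite scale1r. Qed.

Lemma constD p q : const (p + q) = const p + const q :> O.
Proof. by apply: prodR_eq => F; rewrite prodR_addE /= scalerDl. Qed.

Lemma const_nat n : const n%:R = n%:R :> O.
Proof.
elim: n => [|n IH]; last by rewrite !mulrS constD IH const1.
by apply: prodR_eq => F /=; rewrite scale0r.
Qed.

End ProductRing.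

Lemma inj_surj_bijective (S T : Type) (f : S -> T) :
  injective f -> (forall y, exists x, y = f x) -> bijective f.
Proof.
move=> inj_f surj_f; have [h hE] := choice surj_f.
by exists h => x; rewrite -?hE //; apply: inj_f; rewrite -hE.
Qed.

(** A ring endomorphism is additive, hence Q-linear. So the actions of [W_K], semilinear by
    definition, are linear. *)
Lemma rat_rmorph_id (f : {rmorphism rat -> rat}) q : f q = q.
Proof.
have /= := @additive_rat rat^o rat^o f (rmorphD f) q 1.
by rewrite rmorph1 /GRing.scale /= !mulr1.
Qed.

(** * Modules over [S^{-1}O]: localization and extension of scalars *)

Section LocalizedRing.
Context (K : choiceType) (X : sheaf K).
Implicit Types (a b : OK X) (s : den (mset X)).

Lemma to_SOKD a b : to_SOK (a + b) = to_SOK a + to_SOK b.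
Proof.
rewrite [RHS](loc_addE (S := mset X)); apply/rfracP; exists (den1 _).
by rewrite !val_denE !mul1r.
Qed.

Lemma to_SOKM a b : to_SOK (a * b) = to_SOK a * to_SOK b.
Proof.
rewrite [RHS](loc_mulE (S := mset X)); apply/rfracP; exists (den1 _).
by rewrite !val_denE !mul1r.
Qed.

Lemma to_SOK0 : to_SOK (0 : OK X) = 0.
Proof. by apply: (addrI (to_SOK (0 : OK X))); rewrite -to_SOKD !addr0. Qed.

Lemma to_SOKN a : to_SOK (- a) = - to_SOK a.
Proof. by apply: (addrI (to_SOK a)); rewrite -to_SOKD !subrr to_SOK0. Qed.

Definition isok s : SOK X := inv_loc s.
Definition tsok s : SOK X := to_SOK (val s : OK X).

Lemma isokK s : isok s * tsok s = 1.
Proof. exact: inv_locK. Qed.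

Lemma tsokK s : tsok s * isok s = 1.
Proof. by rewrite mulrC isokK. Qed.

Lemma tsokM s t : tsok (denM s t) = tsok s * tsok t.
Proof. by rewrite -to_SOKM. Qed.

Lemma tsok1 : tsok (den1 _) = 1. Proof. by []. Qed.

Lemma SOK_frac (x : SOK X) : exists a s, x = isok s * to_SOK a.
Proof.
exists (num x), (dnm x); rewrite {1}[x]rfrac_num.
rewrite [RHS](loc_mulE (S := mset X)); apply/rfracP; exists (den1 _).
by rewrite !val_denE !mul1r mulr1.
Qed.

Lemma rfracE a s : rfrac a s = isok s * to_SOK a.
Proof.
rewrite [RHS](loc_mulE (S := mset X)); apply/rfracP; exists (den1 _).
by rewrite !val_denE !mul1r mulr1.
Qed.

Lemma to_SOK_homog d a : prod_homog d a -> loc_homog d (to_SOK a).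
Proof.
move=> ad; exists a, (den1 _), (fun=> 0); split=> // F; first exact: gr_homog1.
by rewrite addr0.
Qed.

Section Module.
Context (P : lmodType (SOK X)).

Lemma tsokI s (p q : P) : tsok s *: p = tsok s *: q -> p = q.
Proof.
by move=> /(congr1 ( *:%R (isok s))); rewrite !scalerA isokK !scale1r.
Qed.

(** Restriction of scalars along [O -> S^{-1}O], on a copy of the type since [P] keeps its other
    module structure. *)
Definition resP : Type := P.
HB.instance Definition _ := GRing.Zmodule.on resP.

Definition res_scale a (p : resP) : resP := to_SOK a *: (p : P).

Lemma res_scaleA a b p : res_scale a (res_scale b p) = res_scale (a * b) p.
Proof. by rewrite /res_scale scalerA to_SOKM. Qed.

Lemma res_scale1 : left_id 1 res_scale.
Proof. by move=> p; rewrite /res_scale scale1r. Qed.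

Lemma res_scaleDr : right_distributive res_scale +%R.
Proof. by move=> a p q; rewrite /res_scale scalerDr. Qed.

Lemma res_scaleDl p : {morph res_scale^~ p : a b / a + b}.
Proof. by move=> a b; rewrite /res_scale to_SOKD scalerDl. Qed.

HB.instance Definition _ := GRing.Zmodule_isLmodule.Build (OK X) resP
  res_scaleA res_scale1 res_scaleDr res_scaleDl.

Lemma res_scaleE a (p : resP) : a *: p = to_SOK a *: (p : P) :> P.
Proof. by []. Qed.

End Module.

Section LocIso.
Context (N : lmodType (OK X)) (P : lmodType (SOK X)) (f : N -> P).
Context (fL : semilinear (@to_SOK K X) f).

Lemma loc_lin0 : f 0 = 0. Proof. exact: semilinear0 fL. Qed.
Lemma loc_linZ a n : f (a *: n) = to_SOK a *: f n.
Proof. exact: (semilinearZ (f := @to_SOK K X) _ fL). Qed.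
Lemma loc_linD n m : f (n + m) = f n + f m.
Proof. exact: (semilinearD (f := @to_SOK K X) _ fL). Qed.
Lemma loc_linN n : f (- n) = - f n.
Proof. by apply: (addrI (f n)); rewrite -loc_linD !subrr loc_lin0. Qed.
Lemma loc_linB n m : f (n - m) = f n - f m.
Proof. by rewrite loc_linD loc_linN. Qed.

Lemma ind_loc_bij :
  (forall n, f n = 0 -> exists s, (val s : OK X) *: n = 0) ->
  (forall p, exists n s, tsok s *: p = f n) -> bijective (@ind_loc K X N P f).
Proof.
move=> f0 fs; apply: inj_surj_bijective => [x y|p]; last first.
  have [n [s pn]] := fs p; exists (frac n s).
  by rewrite (ind_loc_frac fL) -pn scalerA isokK scale1r.
rewrite [x](frac_repr x) [y](frac_repr y).
move: (generic_quotient.repr x) (generic_quotient.repr y) => [n s] [m t] /=.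
rewrite !(ind_loc_frac fL) => nm; apply/fracP.
have /f0[u u0] : f ((val t : OK X) *: n - (val s : OK X) *: m) = 0.
  rewrite loc_linB !loc_linZ -/(tsok s) -/(tsok t); apply/eqP; rewrite subr_eq0.
  apply/eqP; transitivity ((tsok t * tsok s) *: (isok s *: f n)).
    by rewrite scalerA -mulrA tsokK mulr1.
  by rewrite -/(isok s) in nm *; rewrite nm scalerA mulrAC tsokK mul1r.
by exists u; apply/eqP; rewrite -subr_eq0 -scalerBr u0.
Qed.

Context (f_iso : bijective (@ind_loc K X N P f)).

Lemma loc_eq0 n : f n = 0 -> exists s, (val s : OK X) *: n = 0.
Proof.
move=> n0; have : @ind_loc K X N P f (frac n (den1 _)) = @ind_loc K X N P f (frac 0 (den1 _)).
  by rewrite !(ind_loc_frac fL) n0 loc_lin0.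
move/(bij_inj f_iso)/fracP => [u]; rewrite !val_denE !scale1r scaler0 => un.
by exists u.
Qed.

Lemma loc_surj p : exists n s, tsok s *: p = f n.
Proof.
have [h _ hK] := f_iso; rewrite -(hK p) (frac_repr (h p)).
move: (generic_quotient.repr _) => [n s] /=; exists n, s.
by rewrite (ind_loc_frac fL) scalerA tsokK scale1r.
Qed.

End LocIso.

Section TensIso.
Context (P : lmodType (SOK X)) (V : lmodType rat) (f : V -> P).
Context (fL : semilinear (@unitSOK K X) f).

Lemma unit_lin0 : f 0 = 0. Proof. exact: (semilinear0 (unitSOK1 X) fL). Qed.
Lemma unit_linZ q v : f (q *: v) = unitSOK X q *: f v.
Proof. exact: (semilinearZ (unitSOK1 X) fL). Qed.
Lemma unit_linD u v : f (u + v) = f u + f v.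
Proof. exact: (semilinearD (unitSOK1 X) fL). Qed.

Definition spanned := forall p, exists r : seq (SOK X * V),
  p = \sum_(z <- r) z.1 *: f z.2.

Lemma ind_tens_bij : spanned ->
  (forall r t : seq (SOK X * V),
     \sum_(z <- r) z.1 *: f z.2 = \sum_(z <- t) z.1 *: f z.2 ->
     tens_eq (@unitSOK K X) r t) -> bijective (@ind_tens K X P V f).
Proof.
move=> fs finj; apply: inj_surj_bijective => [x y|p]; last first.
  have [r ->] := fs p; exists (\pi_(tensor (@unitSOK K X) V) r).
  by rewrite (ind_tens_pi fL).
rewrite -[x]reprK -[y]reprK !(ind_tens_pi fL) => /finj xy.
by apply/eqmodP/asboolP.
Qed.

Context (f_iso : bijective (@ind_tens K X P V f)).

Lemma tens_spanned : spanned.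
Proof.
move=> p; have [h _ hK] := f_iso; exists (generic_quotient.repr (h p)).
by rewrite -(ind_tens_pi fL) reprK hK.
Qed.

Lemma tens_inj (r t : seq (SOK X * V)) :
  \sum_(z <- r) z.1 *: f z.2 = \sum_(z <- t) z.1 *: f z.2 ->
  tens_eq (@unitSOK K X) r t.
Proof.
rewrite -!(ind_tens_pi fL) => /(bij_inj f_iso) /eqmodP /asboolP; exact.
Qed.

(** The map is read off a formal sum representing the preimage of [p], and by [ind_tens_pi] it does
    not depend on that sum. The [P]-components of morphisms into injective objects arise in this way
    from [V]-components. *)
Lemma tens_univ (Q : lmodType (SOK X)) (h : V -> Q) :
  semilinear (@unitSOK K X) h ->
  exists k : P -> Q, semilinear id k /\ forall v, k (f v) = h v.
Proof.
move=> hL; have [g gK Kg] := f_iso.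
exists (fun p => ind_tens h (g p)).
have kE r : ind_tens h (g (\sum_(z <- r) z.1 *: f z.2)) =
    \sum_(z <- r) z.1 *: h z.2.
  by rewrite -(ind_tens_pi fL) gK (ind_tens_pi hL).
split=> [x p q|v]; last first.
  by have := kE [:: (1, v)]; rewrite !big_seq1 /= !scale1r.
have [r ->] := tens_spanned p; have [t ->] := tens_spanned q.
rewrite (_ : x *: _ + _ =
    \sum_(z <- [seq (x * y.1, y.2) | y <- r] ++ t) z.1 *: f z.2).
  rewrite !kE big_cat big_map /= scaler_sumr; congr (_ + _).
  by apply: eq_bigr => z _; rewrite scalerA.
rewrite big_cat big_map /= scaler_sumr; congr (_ + _).
by apply: eq_bigr => z _; rewrite scalerA.
Qed.

End TensIso.

Lemma spanned_ind (P : lmodType (SOK X)) (V : lmodType rat) (f : V -> P)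
    (Q : P -> Prop) :
  spanned f -> Q 0 -> (forall p q, Q p -> Q q -> Q (p + q)) ->
  (forall x v, Q (x *: f v)) -> forall p, Q p.
Proof.
move=> fs Q0 QD Qf p; have [r ->] := fs p; apply: big_ind => //.
Qed.

Lemma linear_eq_spanned (P Q : lmodType (SOK X)) (V : lmodType rat) (f : V -> P)
    (h k : P -> Q) : spanned f -> semilinear id h -> semilinear id k ->
  (forall v, h (f v) = k (f v)) -> forall p, h p = k p.
Proof.
move=> fs hL kL hk; apply: (spanned_ind fs).
- by rewrite (lin0 hL) (lin0 kL).
- move=> p q hp hq.
  by rewrite (linD hL) (linD kL) hp hq.
- move=> x v.
  by rewrite (linZ hL) (linZ kL) hk.
Qed.

End LocalizedRing.

(** * The standard model *)

(* What the two types of structure sheaf have in common. [W_F] acts trivially on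
   [R(F)] because it fixes [Q] and, for [type1], also [c], which occurs in [S]. *)
Record tame (K : choiceType) (X : sheaf K) (W : compstr X) : Prop := Tame {
  tame_one : forall s, mulset_set (mset X) s ->
    exists A : seq K, forall F, F \notin A -> s F = 1;
  tame_homog : forall s, mulset_set (mset X) s ->
    exists (e : K -> int) (E : seq int), forall F,
      e F \in E /\ homog (gr_grading (stalk X)) (e F) (s F);
  tame_act : forall F (w : WF W F) r, WF_act w r = r;
  tame_hom : forall F, Whom W F = None -> to_SOK (idem F : OK X) = 0 }.

Section Standard.
Context (K : choiceType) (X : sheaf K) (W : compstr X) (tm : tame W).
Local Notation O := (OK X).
Local Notation B := (SOK X).
Local Notation idm F := (idem F : O).
Local Notation coid A := (coidem (stalk X) A : O).
Local Notation vden s := (val (s : den (mset X)) : O).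

Lemma den_set (s : den (mset X)) : mulset_set (mset X) (val s).
Proof. by have := valP s; rewrite inE. Qed.

Lemma den_one (s : den (mset X)) : exists A, coid A * vden s = coid A.
Proof.
have [A AP] := tame_one tm (den_set s); exists A; apply: prodR_eq => F.
rewrite prodR_mulE !coidemE; case: ifPn => FA; first by rewrite mul0r.
by rewrite AP // mulr1.
Qed.

(** In other words, the homogeneous elements span [S^{-1}O]. A fraction [a/s] splits because the
    degrees [e(F)] of the [s(F)] form a finite set: [a] is cut into the parts of degree [d + e(F)]
    at [F], and only finitely many [d] occur. *)
Lemma loc_homog_ind (Q : B -> Prop) :
  Q 0 -> (forall x y, Q x -> Q y -> Q (x + y)) ->
  (forall d x, loc_homog d x -> Q x) -> forall x, Q x.
Proof.
move=> Q0 QD Qh x; have [a [s xE]] := SOK_frac x.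
have [e [E eE]] := tame_homog tm (den_set s).
have /asboolP[D DP] := prod_bounded (a : prodR K (stalk X)).
pose gr := gr_grading (stalk X).
have bd d : (fun F => gr (d + e F) ((a : prodR _ _) F)) \in
    @bounded_family K (stalk X).
  apply/asboolP; exists D => F k /DP ak.
  by rewrite hcompK; case: eqP => // <-.
pose ad d : O := ProdR (bd d).
pose L := undup [seq d - k | d <- D, k <- E].
have aE : a = \sum_(d <- L) ad d.
  apply: prodR_eq => F; rewrite prodR_sumE /=.
  have [eF _] := eE F.
  have uM : uniq [seq d + e F | d <- L].
    by rewrite map_inj_uniq ?undup_uniq //; apply: addIr.
  rewrite {1}(hcomp_supp uM (g := gr) (x := (a : prodR _ _) F)); first by rewrite big_map.
  move=> k kM; apply: DP; apply: contraNN kM => kD.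
  apply/mapP; exists (k - e F); last by rewrite subrK.
  by rewrite mem_undup; apply/allpairsP; exists (k, e F).
have toS_sum r : to_SOK (\sum_(d <- r) ad d) = \sum_(d <- r) to_SOK (ad d).
  by elim: r => [|d r IH]; rewrite ?big_nil ?to_SOK0 // !big_cons to_SOKD IH.
rewrite xE aE toS_sum mulr_sumr; apply: big_ind => // d _; apply: (Qh d).
exists (ad d), s, e; split=> [|F|F]; first by rewrite rfracE.
  by case: (eE F).
exact: homog_hcomp.
Qed.

(* As in [is_actN], the action of [W_F] on [e_F N] is extended by 0 to [N]. *)
Record emod := Emod {
  em_mod :> lmodType O;
  em_gr : grading em_mod;
  em_graded : graded_mod (@prod_homog K (stalk X)) em_gr;
  em_act : forall F, WF W F -> em_mod -> em_mod;
  em_act1 : forall F n, em_act (1%g : WF W F) n = idm F *: n;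
  em_actM : forall F (g h : WF W F) n, em_act (g * h)%g n = em_act g (em_act h n);
  em_act_lin : forall F (g : WF W F), semilinear id (em_act g);
  em_act_gr : forall F (g : WF W F) d n, em_act g (em_gr d n) = em_gr d (em_act g n) }.

Record vrep := Vrep {
  vr_mod :> lmodType rat;
  vr_gr : grading vr_mod;
  vr_act : WK W -> vr_mod -> vr_mod;
  vr_act1 : forall v, vr_act 1%g v = v;
  vr_actM : forall g h v, vr_act (g * h)%g v = vr_act g (vr_act h v);
  vr_act_lin : forall g, semilinear id (vr_act g);
  vr_act_gr : forall g d v, vr_act g (vr_gr d v) = vr_gr d (vr_act g v) }.

Record pmod := Pmod {
  pm_mod :> lmodType B;
  pm_gr : grading pm_mod;
  pm_graded : graded_mod (@loc_homog K (stalk X) (mset X)) pm_gr }.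

Section Emod.
Context (N : emod).

Lemma em_actZ F (g : WF W F) a n : em_act g (a *: n) = a *: em_act g n :> N.
Proof. exact: (linZ (em_act_lin _)). Qed.

Lemma em_actD F (g : WF W F) m n : em_act g (m + n) = em_act g m + em_act g n :> N.
Proof. exact: (linD (em_act_lin _)). Qed.

Lemma em_act0 F (g : WF W F) : em_act g 0 = 0 :> N.
Proof. exact: (lin0 (em_act_lin _)). Qed.

Lemma em_act_idem F (g : WF W F) n : idm F *: em_act g n = em_act g n :> N.
Proof. by rewrite -em_act1 -em_actM mul1g. Qed.

Lemma em_hcomp0 d a (n : N) : prod_homog 0 a ->
  em_gr N d (a *: n) = a *: em_gr N d n.
Proof. by move=> a0; rewrite (hcompZ (@em_graded N) _ _ a0) subr0. Qed.

End Emod.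

Definition is_emhom (M N : emod) (f : M -> N) := [/\ semilinear id f,
  forall d n, f (em_gr M d n) = em_gr N d (f n) &
  forall F (w : WF W F) n, f (em_act w n) = em_act w (f n)].

Definition is_vhom (U V : vrep) (f : U -> V) := [/\ semilinear id f,
  forall d n, f (vr_gr U d n) = vr_gr V d (f n) &
  forall w n, f (vr_act w n) = vr_act w (f n)].

Section Builder.
Context (N : emod) (P : pmod) (V : vrep) (a : N -> P) (b : V -> P).
Context (aL : semilinear (@to_SOK K X) a) (bL : semilinear (@unitSOK K X) b).
Context (a_deg : forall d n, a (em_gr N d n) = pm_gr P d (a n)).
Context (b_deg : forall d v, b (vr_gr V d v) = pm_gr P d (b v)).
Context (a_iso : bijective (@ind_loc K X N P a)).
Context (b_iso : bijective (@ind_tens K X P V b)).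
Context (equiv : forall g v n n' (s s' : den (mset X)),
  a n = tsok s *: b v -> a n' = tsok s' *: b (vr_act g v) ->
  exists u : den (mset X), forall F phi, Whom W F = Some phi ->
    forall w : WF W F, phi w = g ->
      vden u *: (vden s' *: em_act w n) = vden u *: (vden s *: (idm F *: n'))).

Lemma mk_vgraded e (q : rat) v : homog (vr_gr V) e v -> homog (vr_gr V) e (q *: v).
Proof. by rewrite /homog (additive_rat (hcompD (vr_gr V) e)) => ->. Qed.

Definition mk_diag := SMDiag (@em_graded N) (@pm_graded P) mk_vgraded aL bL
  a_deg b_deg a_iso b_iso.

Lemma mk_actN : is_actN (D := mk_diag) (@em_act N).
Proof.
move=> F; split=> [n|g h n|g c n m|g d n].
- exact: em_act1.
- exact: em_actM.
- rewrite em_act_lin -{1}em_act_idem scalerA mulrC; congr (_ *: _ + _).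
  by rewrite idem_mul (tame_act tm).
- exact: em_act_gr.
Qed.

Lemma mk_actV : is_actV (D := mk_diag) (@vr_act V).
Proof.
split=> [|g q u v|g d v].
- by split=> [v|g h v]; [exact: vr_act1|exact: vr_actM].
- by rewrite rat_rmorph_id; apply: vr_act_lin.
- exact: vr_act_gr.
Qed.

Lemma mk_equiv : equivariantVN (D := mk_diag) (@em_act N) (@vr_act V).
Proof.
move=> g v n n' s s'; rewrite !(ind_loc_frac aL) /= => nv n'v.
apply: (equiv (v := v) (g := g)).
  by rewrite -nv scalerA tsokK scale1r.
by rewrite -n'v scalerA tsokK scale1r.
Qed.

(** Builds an object from linear data, with equivariance tested on exact lifts of [s v]. The
    semilinear and fractional conditions of the model are recovered by tameness and by clearing
    denominators. *)
Definition mk_obj : smobj W := SMObj mk_actN mk_actV mk_equiv.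

End Builder.

Section Object.
Context (Y : smobj W).

(** Tameness removes the twist of the coefficient, and the idempotent in it is absorbed since the
    action has values in [e_F N]. *)
Lemma obj_act_lin F (g : WF W F) : semilinear id (@actN _ _ _ Y F g).
Proof.
have [a1 aM aL _] := actNP Y F => a n m; rewrite aL (tame_act tm).
rewrite -idem_mul mulrC -scalerA -a1 -aM mul1g //.
Qed.

Definition emod_of := @Emod (sN Y) (gN Y) (@gN_mod _ _ Y) (@actN _ _ _ Y)
  (fun F => let: And4 h _ _ _ := actNP Y F in h)
  (fun F => let: And4 _ h _ _ := actNP Y F in h)
  obj_act_lin
  (fun F => let: And4 _ _ _ h := actNP Y F in h).

Lemma obj_actV_lin g : semilinear id (@actV _ _ _ Y g).
Proof.
by have [_ aL _] := actVP Y => q u v; rewrite aL rat_rmorph_id.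
Qed.

Definition vrep_of := @Vrep (sV Y) (gV Y) (@actV _ _ _ Y)
  (let: And3 h _ _ := actVP Y in proj1 h) (let: And3 h _ _ := actVP Y in proj2 h)
  obj_actV_lin (let: And3 _ _ h := actVP Y in h).

Definition pmod_of := Pmod (@gP_mod _ _ Y).

Lemma obj_equiv g (v : sV Y) (n n' : sN Y) s s' :
  sNP n = tsok s *: sVP v -> sNP n' = tsok s' *: sVP (actV g v) ->
  exists u : den (mset X), forall F phi, Whom W F = Some phi ->
    forall w : WF W F, phi w = g ->
      vden u *: (vden s' *: actN w n) = vden u *: (vden s *: (idm F *: n')).
Proof.
move=> nv n'v; apply: (@act_equiv _ _ _ Y g v).
  by rewrite (ind_loc_frac (@sNP_lin _ _ Y)) nv scalerA isokK scale1r.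
by rewrite (ind_loc_frac (@sNP_lin _ _ Y)) n'v scalerA isokK scale1r.
Qed.

Lemma sNP0 : sNP (0 : sN Y) = 0. Proof. exact: loc_lin0 (@sNP_lin _ _ Y). Qed.
Lemma sNPD (m n : sN Y) : sNP (m + n) = sNP m + sNP n.
Proof. exact: (loc_linD (@sNP_lin _ _ Y)). Qed.
Lemma sNPB (m n : sN Y) : sNP (m - n) = sNP m - sNP n.
Proof. exact: (loc_linB (@sNP_lin _ _ Y)). Qed.
Lemma sNPZ a (n : sN Y) : sNP (a *: n) = to_SOK a *: sNP n.
Proof. exact: (loc_linZ (@sNP_lin _ _ Y)). Qed.

Lemma sNP_eq0 (n : sN Y) : sNP n = 0 -> exists s : den (mset X), vden s *: n = 0.
Proof. exact: (loc_eq0 (@sNP_lin _ _ Y) (@sNP_iso _ _ Y)). Qed.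

Lemma sNP_surj (p : sP Y) : exists n s, tsok s *: p = sNP n.
Proof. exact: (loc_surj (@sNP_lin _ _ Y) (@sNP_iso _ _ Y)). Qed.

Lemma sVP_spanned : spanned (@sVP _ _ Y).
Proof. exact: (tens_spanned (@sVP_lin _ _ Y) (@sVP_iso _ _ Y)). Qed.

End Object.

Definition vobj_univ (Y : smobj W) (Q : lmodType B) (h : sV Y -> Q) :=
  tens_univ (@sVP_lin _ _ Y) (@sVP_iso _ _ Y) (h := h).

(** By [loc_homog_ind], [P] is spanned by homogeneous multiples of vectors of [V], so the degree
    condition on [P]-components follows from the one on [V]-components. *)
Lemma spanned_graded (P Q : pmod) (U V : vrep) (b : U -> P) (c : V -> Q)
    (f : U -> V) (h : P -> Q) : spanned b ->
  (forall d v, b (vr_gr U d v) = pm_gr P d (b v)) ->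
  (forall d v, c (vr_gr V d v) = pm_gr Q d (c v)) ->
  (forall d v, f (vr_gr U d v) = vr_gr V d (f v)) ->
  semilinear id h -> (forall v, h (b v) = c (f v)) ->
  forall d p, h (pm_gr P d p) = pm_gr Q d (h p).
Proof.
move=> bs bg cg fg hL hb d; apply: (spanned_ind bs).
- by rewrite hcomp0 (lin0 hL) hcomp0.
- move=> p q hp hq.
  by rewrite hcompD !(linD hL) hp hq hcompD.
- move=> x v; elim/loc_homog_ind: x => [|x y IHx IHy|k x kx].
  + by rewrite scale0r hcomp0 (lin0 hL) hcomp0.
  + by rewrite scalerDl hcompD !(linD hL) IHx IHy hcompD.
  + rewrite (hcompZ (@pm_graded P) _ _ kx) !(linZ hL) -bg !hb.
    by rewrite fg cg (hcompZ (@pm_graded Q) _ _ kx).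
Qed.

Lemma build_hom (Y Z : smobj W) (fN : sN Y -> sN Z) (fP : sP Y -> sP Z)
    (fV : sV Y -> sV Z) :
  is_emhom (M := emod_of Y) (N := emod_of Z) fN -> semilinear id fP ->
  is_vhom (U := vrep_of Y) (V := vrep_of Z) fV ->
  (forall n, fP (sNP n) = sNP (fN n)) -> (forall v, fP (sVP v) = sVP (fV v)) ->
  is_smhom fN fP fV.
Proof.
move=> [NL Ng Na] PL [VL Vg Va] PN PV; split; first by split.
split; last by split.
split=> // d p.
exact: (@spanned_graded (pmod_of Y) (pmod_of Z) (vrep_of Y) (vrep_of Z) _ _ fV
  fP (@sVP_spanned Y) (@sVP_deg _ _ Y) (@sVP_deg _ _ Z) Vg PL PV).
Qed.

Section Hom.
Context (Y Z : smobj W) (f : smhom Y Z).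

Lemma hom_em : is_emhom (M := emod_of Y) (N := emod_of Z) (hN f).
Proof. by have [[? _ _] [[? _ _] [_ _ ? _]]] := smhomP f. Qed.
Lemma hom_v : is_vhom (U := vrep_of Y) (V := vrep_of Z) (hV f).
Proof. by have [[_ _ ?] [[_ _ ?] [_ _ _ ?]]] := smhomP f. Qed.
Lemma homP_lin : semilinear id (hP f).
Proof. by have [[_ ? _] _] := smhomP f. Qed.
Lemma homP_deg d p : hP f (gP Y d p) = gP Z d (hP f p).
Proof. by have [_ [[_ ? _] _]] := smhomP f. Qed.
Lemma hom_NP n : hP f (sNP n) = sNP (hN f n).
Proof. by have [_ [_ [? _ _ _]]] := smhomP f. Qed.
Lemma hom_VP v : hP f (sVP v) = sVP (hV f v).
Proof. by have [_ [_ [_ ? _ _]]] := smhomP f. Qed.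
Lemma homN_lin : semilinear id (hN f). Proof. by case: hom_em. Qed.
Lemma homV_lin : semilinear id (hV f). Proof. by case: hom_v. Qed.

Definition homN0 := lin0 homN_lin.
Definition homND := linD homN_lin.
Definition homNZ := linZ homN_lin.
Definition homP0 := lin0 homP_lin.
Definition homPD := linD homP_lin.
Definition homPZ := linZ homP_lin.
Definition homV0 := lin0 homV_lin.
Definition homVD := linD homV_lin.

Lemma homNB m n : hN f (m - n) = hN f m - hN f n.
Proof. by rewrite homND -scaleN1r homNZ scaleN1r. Qed.
Lemma homVB u v : hV f (u - v) = hV f u - hV f v.
Proof. by rewrite homVD -scaleN1r (linZ homV_lin) scaleN1r. Qed.

End Hom.

Lemma hom_eq (Y Z : smobj W) (f g : smhom Y Z) :
  hN f =1 hN g -> hV f =1 hV g -> f = g.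
Proof.
move=> eN eV; apply: smhom_eq => // p.
apply: (linear_eq_spanned (@sVP_spanned Y) (homP_lin f) (homP_lin g)) => v.
by rewrite !hom_VP eV.
Qed.

End Standard.

Section SubIn.
Context (A : pzRingType) (M : lmodType A) (S : submod M).

Definition sub_in x (Sx : S x) : subm S := Subm (introT (submod_predP S x) Sx).

Lemma submP (x : subm S) : S (submval x).
Proof. exact/submod_predP/submvalP. Qed.

Lemma subm_eq (x y : subm S) : submval x = submval y -> x = y.
Proof. exact: val_inj. Qed.

End SubIn.

Lemma tens_eq_map (k B : comPzRingType) (f : k -> B) (U V : lmodType k)
    (h : U -> V) (r t : seq (B * U)) : semilinear id h -> tens_eq f r t ->
  tens_eq f [seq (z.1, h z.2) | z <- r] [seq (z.1, h z.2) | z <- t].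
Proof.
move=> hL; elim=> {r t} /=.
- by move=> x; apply: tens_refl.
- by move=> x y _ IH; apply: tens_sym.
- by move=> x y z _ IH _; apply: tens_trans IH.
- by move=> x x' y y' _ IH _ IH'; rewrite !map_cat; apply: tens_cat.
- by move=> x y; rewrite !map_cat; apply: tens_swap.
- by move=> b b' v; apply: tens_addl.
- by move=> b u v; rewrite (linD hL); apply: tens_addr.
- by move=> b q v; rewrite (linZ hL); apply: tens_scale.
- by move=> v; apply: tens_zero.
Qed.

(** * Kernel objects and monomorphisms *)

Section Kernels.
Context (K : choiceType) (X : sheaf K) (W : compstr X) (tm : tame W).
Local Notation O := (OK X).
Local Notation B := (SOK X).
Local Notation idm F := (idem F : O).
Local Notation vden s := (val (s : den (mset X)) : O).

Section SubEmod.
Context (N : emod W) (S : submod N).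
Context (gS : forall d n, S n -> S (em_gr N d n)).
Context (aS : forall F (w : WF W F) n, S n -> S (em_act w n)).

Definition sub_act F (w : WF W F) (x : subm S) : subm S :=
  sub_in (aS w (submP x)).

Definition sub_emod : emod W.
Proof.
apply: (@Emod _ _ _ (subm S) (sub_grading gS) (sub_graded (@em_graded _ _ _ N))
  sub_act).
- by move=> F x; apply: subm_eq; apply: em_act1.
- by move=> F g h x; apply: subm_eq; apply: em_actM.
- by move=> F g a x y; apply: subm_eq; apply: em_act_lin.
- by move=> F g d x; apply: subm_eq; rewrite /= !sub_gradingE em_act_gr.
Defined.

End SubEmod.

Section SubVrep.
Context (V : vrep W) (S : submod V).
Context (gS : forall d n, S n -> S (vr_gr V d n)).
Context (aS : forall w n, S n -> S (vr_act w n)).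

Definition sub_vact w (x : subm S) : subm S := sub_in (aS w (submP x)).

Definition sub_vrep : vrep W.
Proof.
apply: (@Vrep _ _ _ (subm S) (sub_grading gS) sub_vact).
- by move=> x; apply: subm_eq; apply: vr_act1.
- by move=> g h x; apply: subm_eq; apply: vr_actM.
- by move=> g a x y; apply: subm_eq; apply: vr_act_lin.
- by move=> g d x; apply: subm_eq; rewrite /= !sub_gradingE vr_act_gr.
Defined.

End SubVrep.

Definition sub_pmod (P : pmod X) (S : submod P)
    (gS : forall d n, S n -> S (pm_gr P d n)) : pmod X :=
  Pmod (sub_graded (S := S) (gS := gS) (@pm_graded _ _ P)).

Section KernelSubmod.
Context (A : pzRingType) (M N : lmodType A) (f : M -> N) (fL : semilinear id f).

Definition ker_submod : submod M.
Proof.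
apply: (@Submod _ _ (fun x => f x = 0)); first exact: semilinear0 fL.
by move=> a x y x0 y0; rewrite fL x0 y0 scaler0 addr0.
Defined.

End KernelSubmod.

Section KernelObject.
Context (Y Z : smobj W) (f : smhom Y Z).

Definition kerN := ker_submod (homN_lin tm f).
Definition kerP := ker_submod (homP_lin f).
Definition kerV := ker_submod (homV_lin f).

Lemma kerN_gr d n : kerN n -> kerN (gN Y d n).
Proof.
by move=> /= n0; have [_ -> _] := hom_em tm f; rewrite n0 hcomp0.
Qed.

Lemma kerN_act F (w : WF W F) (n : sN Y) : kerN n -> kerN (actN w n).
Proof.
move=> /= n0; have [_ _ ->] := hom_em tm f.
by rewrite n0; apply: em_act0 (emod_of tm Z) _ _.
Qed.

Lemma kerP_gr d p : kerP p -> kerP (gP Y d p).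
Proof. by move=> /= p0; rewrite homP_deg p0 hcomp0. Qed.

Lemma kerV_gr d v : kerV v -> kerV (gV Y d v).
Proof. by move=> /= v0; have [_ -> _] := hom_v f; rewrite v0 hcomp0. Qed.

Lemma kerV_act w (v : sV Y) : kerV v -> kerV (actV w v).
Proof.
move=> /= v0; have [_ _ ->] := hom_v f; rewrite v0.
exact: lin0 (obj_actV_lin w).
Qed.

Definition ker_emod := sub_emod (N := emod_of tm Y) kerN_gr kerN_act.
Definition ker_pmod := sub_pmod (P := pmod_of Y) kerP_gr.
Definition ker_vrep := sub_vrep (V := vrep_of Y) kerV_gr kerV_act.

Lemma kerNP_subproof (n : subm kerN) : kerP (sNP (submval n)).
Proof. by rewrite /= (hom_NP f) (submP n : hN f _ = 0) sNP0. Qed.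

Definition kerNP (n : ker_emod) : ker_pmod := sub_in (kerNP_subproof n).

Lemma kerVP_subproof (v : subm kerV) : kerP (sVP (submval v)).
Proof.
rewrite /= (hom_VP f) (submP v : hV f _ = 0).
exact: unit_lin0 (@sVP_lin _ _ Z).
Qed.

Definition kerVP (v : ker_vrep) : ker_pmod := sub_in (kerVP_subproof v).

Lemma kerNP_lin : semilinear (@to_SOK K X) kerNP.
Proof. by move=> a x y; apply: subm_eq; apply: sNP_lin. Qed.

Lemma kerVP_lin : semilinear (@unitSOK K X) kerVP.
Proof. by move=> a x y; apply: subm_eq; apply: sVP_lin. Qed.

Lemma kerNP_iso : bijective (@ind_loc K X ker_emod ker_pmod kerNP).
Proof.
apply: (ind_loc_bij kerNP_lin) => [n /(congr1 (@submval _ _ _)) /= n0|p].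
  have [s sn] := sNP_eq0 n0; exists s; exact: subm_eq.
have [n [s pn]] := sNP_surj (submval p).
have : sNP (hN f n) = 0.
  by rewrite -hom_NP -pn homPZ (submP p : hP f _ = 0) scaler0.
move=> /sNP_eq0[t tn].
have tn0 : kerN (vden t *: n) by rewrite /= homNZ.
exists (sub_in tn0), (denM t s); apply: subm_eq => /=.
by rewrite tsokM -scalerA pn sNPZ.
Qed.

(** Left exactness of extension of scalars from Q. There are a retraction [r] onto the kernel of
    [hV f] and a map [t] with [t (hV f v) = v - r v]. Applying the extension [k] of [t] to
    [hP f p = 0] shows that [p] does not change when every vector [v] of a representing sum is
    replaced by [r v]. *)
Lemma kerVP_iso : bijective (@ind_tens K X ker_pmod ker_vrep kerVP).
Proof.
have inj_val : injective (@submval _ _ kerV) by move=> x y; apply: subm_eq.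
have [r [rL _ rE]] := @rat_extension_along (sV Y) (subm kerV)
  (conc_grading _) (conc_grading _) (subm kerV) (conc_grading _)
  (@submval _ _ kerV) id (fun _ _ _ => erefl) (fun _ _ _ => erefl) inj_val
  (fun d x => ltac:(by rewrite !conc_gradingE; case: eqP))
  (fun d x => erefl).
have c0 v : hV f v = 0 -> v - submval (r v) = 0.
  by move=> v0; have := rE (sub_in (v0 : kerV v)) => /= ->; rewrite subrr.
have cL : semilinear id (fun v => v - submval (r v)).
  by move=> q u v /=; rewrite rL /= opprD scalerBr addrACA.
have pmap : partial_map (conc_grading _) (conc_grading _)
    (graph_along (homV_lin f) cL).
  split=> [d _ [v ->] /=|u [v [/esym v0 ->]]]; last exact: c0.
  rewrite !conc_gradingE; case: eqP => _; first by exists v.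
  exists 0; congr pair; first by rewrite homV0.
  by rewrite (lin0 cL).
have [t [tL _ tE]] := rat_extension pmap.
have stL : semilinear (@unitSOK K X) (fun w => sVP (t w) : sP Y).
  by move=> q u v; rewrite tL; apply: (@sVP_lin _ _ Y).
have [k [kL kE]] := vobj_univ stL.
apply: (ind_tens_bij kerVP_lin) => [p|l m lm].
  have [l pl] := sVP_spanned (submval p).
  exists [seq (z.1, r z.2) | z <- l]; apply: subm_eq; rewrite big_map.
  have -> (s : seq (B * sV Y)) : submval (\sum_(z <- s) z.1 *: kerVP (r z.2)) =
      \sum_(z <- s) z.1 *: sVP (submval (r z.2)).
    by elim: s => [|z s IH]; rewrite ?big_nil // !big_cons /= IH.
  apply/eqP; rewrite -subr_eq0 pl -sumrB.
  under eq_bigr => z _.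
    rewrite -scalerBr -scaleN1r.
    rewrite -[_ *: sVP (submval _)](_ : sVP (- submval (r z.2)) = _); last first.
      by rewrite -scaleN1r (unit_linZ (@sVP_lin _ _ Y)) -[-1]mulN1r; congr (_ *: _);
        rewrite /unitSOK -to_SOK1 -to_SOKN; congr to_SOK; apply: prodR_eq => F;
        rewrite /= scaleN1r.
    rewrite -(unit_linD (@sVP_lin _ _ Y)) -(tE (hV f z.2) _ (ex_intro _ z.2 erefl)).
    over.
  under eq_bigr do rewrite -kE -hom_VP -(linZ kL)
    -(homPZ f).
  have k0 : k 0 = 0 := lin0 kL.
  have kD := linD kL.
  have -> (s : seq (B * sV Y)) : \sum_(z <- s) k (hP f (z.1 *: sVP z.2)) =
      k (hP f (\sum_(z <- s) z.1 *: sVP z.2)).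
    elim: s => [|z s IH]; first by rewrite !big_nil homP0 k0.
    by rewrite !big_cons homPD kD IH.
  by rewrite -pl (submP p : hP f _ = 0) k0.
have valsum (s : seq (B * subm kerV)) : submval (\sum_(z <- s) z.1 *: kerVP z.2) =
    \sum_(z <- [seq (z.1, submval z.2) | z <- s]) z.1 *: sVP z.2.
  by rewrite big_map; elim: s => [|z s IH]; rewrite ?big_nil // !big_cons /= IH.
have /(tens_inj (@sVP_lin _ _ Y) (@sVP_iso _ _ Y)) /(tens_eq_map rL) :
    \sum_(z <- [seq (z.1, submval z.2) | z <- l]) z.1 *: (sVP z.2 : sP Y) =
    \sum_(z <- [seq (z.1, submval z.2) | z <- m]) z.1 *: sVP z.2.
  by rewrite -!valsum lm.
rewrite -!map_comp.
have mid (s : seq (B * subm kerV)) :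
    [seq ((z.1, submval z.2).1, r (z.1, submval z.2).2) | z <- s] = s.
  by rewrite -[RHS]map_id; apply: eq_map => -[x y] /=; rewrite rE.
by rewrite !mid.
Qed.

Lemma ker_equiv g (v : ker_vrep) (n n' : ker_emod) (s s' : den (mset X)) :
  kerNP n = tsok s *: kerVP v -> kerNP n' = tsok s' *: kerVP (vr_act g v) ->
  exists u : den (mset X), forall F phi, Whom W F = Some phi ->
    forall w : WF W F, phi w = g ->
      vden u *: (vden s' *: em_act w n) = vden u *: (vden s *: (idm F *: n')).
Proof.
move=> /(congr1 (@submval _ _ _)) nv /(congr1 (@submval _ _ _)) n'v.
have [u uP] := @obj_equiv _ _ _ Y g _ _ _ _ _ nv n'v; exists u => F phi Fphi w wg.
by apply: subm_eq; apply: uP Fphi w wg.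
Qed.

Definition ker_obj : smobj W := mk_obj tm kerNP_lin kerVP_lin
  (fun d n => ltac:(by apply: subm_eq; rewrite /= !sub_gradingE sNP_deg))
  (fun d n => ltac:(by apply: subm_eq; rewrite /= !sub_gradingE sVP_deg))
  kerNP_iso kerVP_iso ker_equiv.

Lemma ker_incl_subproof : @is_smhom _ _ _ ker_obj Y
  (@submval _ _ kerN) (@submval _ _ kerP) (@submval _ _ kerV).
Proof. by do !split; move=> * //=; rewrite !sub_gradingE. Qed.

Definition ker_incl : smhom ker_obj Y := SMHom ker_incl_subproof.

End KernelObject.

(** The inclusion of the kernel object and the zero morphism have the same composite with [f]. This
    leads from the categorical notion to elements. *)
Lemma injective_of_mono (Y Z : smobj W) (f : smhom Y Z) :
  mono (C := standard_model W) f -> injective (hN f) /\ injective (hV f).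
Proof.
move=> mf; have f0 : ker_incl f = smzero _ Y.
  apply: (mf (ker_obj f) (ker_incl f) (smzero _ Y)); apply: hom_eq => n /=.
    by rewrite (submP n : hN f _ = 0) homN0.
  by rewrite (submP n : hV f _ = 0) homV0.
split=> x y xy; apply/eqP; rewrite -subr_eq0; apply/eqP.
  have x0 : kerN f (x - y) by rewrite /= (homNB tm) xy subrr.
  exact: (congr1 (fun h : smhom (ker_obj f) Y => hN h (sub_in x0)) f0).
have x0 : kerV f (x - y) by rewrite /= homVB xy subrr.
exact: (congr1 (fun h : smhom (ker_obj f) Y => hV h (sub_in x0)) f0).
Qed.

Lemma mono_of_injective (Y Z : smobj W) (f : smhom Y Z) :
  injective (hN f) -> injective (hV f) -> mono (C := standard_model W) f.
Proof.
move=> iN iV T g h gh; apply: hom_eq => x; [apply: iN|apply: iV].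
  exact: (congr1 (fun h : smhom T Z => hN h x) gh).
exact: (congr1 (fun h : smhom T Z => hV h x) gh).
Qed.

End Kernels.

(** * Germs off finite sets, and lifts of vectors to [N] *)

Section Germs.
Context (K : choiceType) (X : sheaf K) (W : compstr X) (tm : tame W).
Local Notation O := (OK X).
Local Notation idm F := (idem F : O).
Local Notation coid A := (coidem (stalk X) A : O).
Local Notation vden s := (val (s : den (mset X)) : O).

(** Multiplication by one cofinite idempotent is in general stronger than equality of the
    coordinates at almost all [F], because an element of [N] need not be determined by its
    coordinates. *)
Definition germ_eq (N : lmodType O) (m n : N) :=
  exists A, coid A *: m = coid A *: n.

Section GermEq.
Context (N : lmodType O).
Implicit Types (m n : N).

Lemma coid_catl A A' m n : coid A *: m = coid A *: n ->
  coid (A ++ A') *: m = coid (A ++ A') *: n.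
Proof. by rewrite -coidemM mulrC -!scalerA => ->. Qed.

Lemma coid_catr A A' m n : coid A' *: m = coid A' *: n ->
  coid (A ++ A') *: m = coid (A ++ A') *: n.
Proof. by rewrite -coidemM -!scalerA => ->. Qed.

Lemma germ_refl n : germ_eq n n. Proof. by exists [::]. Qed.

Lemma germ_sym m n : germ_eq m n -> germ_eq n m.
Proof. by move=> [A An]; exists A. Qed.

Lemma germ_trans m n l : germ_eq m n -> germ_eq n l -> germ_eq m l.
Proof.
move=> [A An] [A' A'n]; exists (A ++ A').
by rewrite (coid_catl _ An) (coid_catr _ A'n).
Qed.

Lemma germ_add m n m' n' : germ_eq m n -> germ_eq m' n' ->
  germ_eq (m + m') (n + n').
Proof.
move=> [A An] [A' A'n]; exists (A ++ A').
by rewrite !scalerDr (coid_catl _ An) (coid_catr _ A'n).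
Qed.

Lemma germ_eqZ a m n : germ_eq m n -> germ_eq (a *: m) (a *: n).
Proof.
by move=> [A An]; exists A; rewrite !scalerA mulrC -!scalerA An.
Qed.

Lemma germ_at m n : germ_eq m n ->
  exists A : seq K, forall F, F \notin A -> idm F *: m = idm F *: n.
Proof.
move=> [A An]; exists A => F FA.
have e : idm F = idm F * coid A by rewrite mulrC coidem_idem (negbTE FA).
by rewrite e -!scalerA An.
Qed.

(** Elements of [S] are 1 off a finite set. *)
Lemma germ_den s m : germ_eq (vden s *: m) m.
Proof.
have [A As] := den_one tm s; exists A; by rewrite scalerA As.
Qed.

End GermEq.

Lemma tors_germ0 (N : lmodType O) (n : N) (s : den (mset X)) :
  vden s *: n = 0 -> germ_eq n 0.
Proof. by move=> n0; apply: germ_trans (germ_sym (germ_den s n)) _; rewrite n0; apply: germ_refl. Qed.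

Section ObjectActions.
Context (Y : smobj W) (F : K) (w : WF W F).
Implicit Types (m n : sN Y).

Lemma actNZ a n : actN w (a *: n) = a *: actN w n.
Proof. exact: (em_actZ (N := emod_of tm Y)). Qed.

Lemma actND m n : actN w (m + n) = actN w m + actN w n.
Proof. exact: (em_actD (N := emod_of tm Y)). Qed.

Lemma actN0 : actN w (0 : sN Y) = 0.
Proof. exact: (@em_act0 _ _ _ (emod_of tm Y)). Qed.

Lemma actN_idem n : idm F *: actN w n = actN w n.
Proof. exact: (em_act_idem (N := emod_of tm Y)). Qed.

End ObjectActions.

Lemma actV1 (Y : smobj W) (v : sV Y) : actV 1%g v = v.
Proof. exact: (@vr_act1 _ _ _ (vrep_of Y)). Qed.

Lemma actVM (Y : smobj W) g h (v : sV Y) : actV (g * h)%g v = actV g (actV h v).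
Proof. exact: (@vr_actM _ _ _ (vrep_of Y)). Qed.

Section ObjectGerms.
Context (Y : smobj W).

(** Only germs are compared, since in general it is a multiple of [v] by an element of [S] that
    comes from [N]. *)
Definition lifts (v : sV Y) (n : sN Y) :=
  germ_eq (sNP n : resP (sP Y)) (sVP v).

Lemma lifts_exact n s v : sNP n = tsok s *: (sVP v : sP Y) -> lifts v n.
Proof. by rewrite /lifts => ->; apply: (germ_den s (sVP v : resP _)). Qed.

Lemma lift_exists v : exists n, lifts v n.
Proof.
have [n [s sv]] := sNP_surj (sVP v : sP Y).
by exists n; apply: lifts_exact (esym sv).
Qed.

Lemma sNP_germ0 n : germ_eq (sNP n : resP (sP Y)) 0 -> germ_eq n 0.
Proof.
move=> [A]; rewrite scaler0 -[_ *: _]sNPZ => /sNP_eq0[s /tors_germ0[A' An]].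
exists (A' ++ A); move: An; rewrite !scaler0 scalerA coidemM //.
Qed.

Lemma sNP_germ m n : germ_eq (sNP m : resP (sP Y)) (sNP n) -> germ_eq m n.
Proof.
move=> [A An]; have [|A' A'n] := @sNP_germ0 (m - n).
  exists A; rewrite sNPB scaler0 scalerBr; apply/eqP.
  by rewrite subr_eq0; apply/eqP.
by exists A'; apply/eqP; rewrite -subr_eq0 -scalerBr A'n scaler0.
Qed.

Lemma lifts_uniq v n n' : lifts v n -> lifts v n' -> germ_eq n n'.
Proof.
by move=> nv n'v; apply: sNP_germ; apply: germ_trans nv (germ_sym n'v).
Qed.

Lemma liftsZD q u v m n : lifts u m -> lifts v n ->
  lifts (q *: u + v) ((const q : O) *: m + n).
Proof.
move=> um vn; rewrite /lifts sNPD sNPZ (@sVP_lin _ _ Y); apply: germ_add => //.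
exact: (germ_eqZ (const q : O) um).
Qed.

(** A lift agrees with [v] off a finite set [A]. Cutting it down by the idempotent of the
    complement, which has degree 0, and taking the component of degree [d] gives an exact
    formula. *)
Lemma lift_homog d v : homog (gV Y) d v ->
  exists A n, [/\ homog (gN Y) d n, coid A *: n = n &
    sNP n = to_SOK (coid A) *: (sVP v : sP Y)].
Proof.
move=> vd; have [n [A An]] := lift_exists v; exists A, (gN Y d (coid A *: n)).
split; first exact: homog_hcomp.
  rewrite -(em_hcomp0 (N := emod_of tm Y)) ?scalerA; last exact: coidem_homog.
  rewrite coidemM; congr (gN Y d (_ *: n)); apply: prodR_eq => F.
  by rewrite !coidemE mem_cat orbb.
rewrite sNP_deg sNPZ [_ *: sNP n]An.
rewrite (hcompZ (@pm_graded _ _ (pmod_of Y)) _ _ (to_SOK_homog (@coidem_homog _ _ A))).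
by rewrite subr0 /= -sVP_deg vd.
Qed.

(* Up to finitely many coordinates, an element of [N] is an [O]-linear
   combination of lifts. *)
Lemma lift_ind (Q : sN Y -> Prop) :
  (forall m n, germ_eq m n -> Q m -> Q n) ->
  (forall m n, Q m -> Q n -> Q (m + n)) ->
  (forall a v n, lifts v n -> Q (a *: n)) -> forall n, Q n.
Proof.
move=> Qg QD Qz n.
suff /(_ (sNP n)) [m [Qm mn]] : forall p : sP Y,
    exists m, Q m /\ germ_eq (sNP m : resP _) p.
  exact: Qg (sNP_germ mn) Qm.
apply: (spanned_ind (@sVP_spanned _ _ _ Y)) => [|p q [m [Qm mp]] [l [Ql lq]]|x v].
- exists 0; split; last by rewrite sNP0; apply: germ_refl.
  have [l lv] := lift_exists 0; by rewrite -(scale0r l); apply: Qz lv.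
- exists (m + l); split; first exact: QD.
  by rewrite sNPD; apply: germ_add.
- have [a [s ->]] := SOK_frac x; have [m mv] := lift_exists v.
  exists (a *: m); split; first exact: Qz mv.
  rewrite sNPZ; apply: germ_trans (germ_eqZ a mv) _.
  apply: germ_trans _ (germ_den s ((isok s * to_SOK a) *: sVP v : resP (sP Y))).
  rewrite !res_scaleE scalerA mulrA -/(tsok s) tsokK mul1r; exact: germ_refl.
Qed.

(** Equivariance is given for exact numerators of [v] and [g v]. Lifts agree with these off a finite
    set, and off a finite set the denominators are 1. The exceptional set depends on [g] but not on
    [F] or [w]. *)
Lemma lifts_act g v n n' : lifts v n -> lifts (actV g v) n' ->
  exists A : seq K, forall F, F \notin A -> forall phi, Whom W F = Some phi ->
    forall w : WF W F, phi w = g -> actN w n = idm F *: n'.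
Proof.
move=> nv n'v.
have [m [s sm]] := sNP_surj (sVP v : sP Y).
have [m' [s' sm']] := sNP_surj (sVP (actV g v) : sP Y).
have [u uP] := obj_equiv (esym sm) (esym sm').
have [A1 A1P] := germ_at (lifts_uniq nv (lifts_exact (esym sm))).
have [A2 A2P] := germ_at (lifts_uniq n'v (lifts_exact (esym sm'))).
have [A3 A3P] := den_one tm u; have [A4 A4P] := den_one tm s.
have [A5 A5P] := den_one tm s'.
have e_at A s0 F : coid A * vden s0 = coid A -> F \notin A ->
    forall l : sN Y, idm F *: (vden s0 *: l) = idm F *: l.
  move=> As0 FA l; have e : idm F = idm F * coid A.
    by rewrite mulrC coidem_idem (negbTE FA).
  by rewrite e -!scalerA [coid A *: (vden s0 *: l)]scalerA As0.
exists (A1 ++ A2 ++ A3 ++ A4 ++ A5) => F; rewrite !mem_cat !negb_or.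
move=> /and5P[F1 F2 F3 F4 F5] phi Fphi w wg.
have /(congr1 (fun l => idm F *: l)) := uP _ _ Fphi w wg.
rewrite !(e_at _ _ _ A3P F3) (e_at _ _ _ A5P F5) (e_at _ _ _ A4P F4).
rewrite scalerA idem_idem -A2P // => <-.
have act_e (l : sN Y) : actN w l = actN w (idm F *: l).
  by rewrite actNZ actN_idem.
by rewrite act_e A1P // -act_e actN_idem.
Qed.

Lemma pact_subproof (g : WK W) : exists k : sP Y -> sP Y,
  semilinear id k /\ forall v, k (sVP v) = sVP (actV g v).
Proof.
apply: vobj_univ => q u v; rewrite (obj_actV_lin g); exact: (@sVP_lin _ _ Y).
Qed.

(** [W_K] acting on [P = S^{-1}O (x) V] through the second factor. *)
Definition pact g : sP Y -> sP Y := sval (cid (pact_subproof g)).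

Lemma pact_lin g : semilinear id (pact g).
Proof. by rewrite /pact; case: (svalP (cid (pact_subproof g))). Qed.

Lemma pactE g v : pact g (sVP v) = sVP (actV g v).
Proof. by rewrite /pact; case: (svalP (cid (pact_subproof g))). Qed.

Definition pactD g := linD (pact_lin g).
Definition pactZ g := linZ (pact_lin g).

Lemma pact1 p : pact 1%g p = p.
Proof.
apply: (linear_eq_spanned (@sVP_spanned _ _ _ Y) (pact_lin _) (k := id)) => // v.
by rewrite pactE actV1.
Qed.

Lemma pactM g h p : pact (g * h)%g p = pact g (pact h p).
Proof.
apply: (linear_eq_spanned (@sVP_spanned _ _ _ Y) (pact_lin _)
  (k := pact g \o pact h)) => [a x y /=|v /=].
  by rewrite (pact_lin h) (pact_lin g).
by rewrite !pactE actVM.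
Qed.

Lemma pact_gr g d p : pact g (gP Y d p) = gP Y d (pact g p).
Proof.
exact: (@spanned_graded _ _ _ tm (pmod_of Y) (pmod_of Y) (vrep_of Y) (vrep_of Y)
  _ _ (actV g) _ (@sVP_spanned _ _ _ Y) (@sVP_deg _ _ Y) (@sVP_deg _ _ Y)
  (@vr_act_gr _ _ _ (vrep_of Y) g) (pact_lin g) (pactE g)).
Qed.

(** The value 1 is a default where no homomorphism is given; there [tame_hom] makes [e_F P] zero. *)
Definition whom F (w : WF W F) : WK W :=
  if Whom W F is Some phi then phi w else 1%g.

Lemma whom1 F : whom (1%g : WF W F) = 1%g.
Proof. by rewrite /whom; case: (Whom W F) => // phi; rewrite morph1. Qed.

Lemma whomM F (g h : WF W F) : whom (g * h)%g = (whom g * whom h)%g.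
Proof.
by rewrite /whom; case: (Whom W F) => [phi|]; rewrite ?mulg1 // morphM ?inE.
Qed.

(** Both sides are [O]-linear in [n] and [S] acts invertibly on [P], so it is enough to check
    numerators of the spanning elements [x v], where the formula is the equivariance of the object.
    Thus the action of [W_K] on [V] dictates that of [W_F] on [e_F P]. *)
Lemma sNP_act F (w : WF W F) (n : sN Y) :
  sNP (actN w n) = to_SOK (idm F) *: pact (whom w) (sNP n).
Proof.
have [Fphi|Fnone] := pselect (Whom W F <> None); last first.
  rewrite (tame_hom tm) ?scale0r; last exact: contrapT Fnone.
  rewrite -actN_idem sNPZ.
  by rewrite (tame_hom tm) ?scale0r //; apply: contrapT Fnone.
pose good (m : sN Y) := sNP (actN w m) = to_SOK (idm F) *: pact (whom w) (sNP m).
have goodZ a m : good m -> good (a *: m).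
  rewrite /good actNZ !sNPZ => ->.
  by rewrite pactZ !scalerA mulrC.
have goodD m l : good m -> good l -> good (m + l).
  rewrite /good actND !sNPD => -> ->.
  by rewrite pactD scalerDr.
suff /(_ (sNP n)) [m [s [mn gm]]] : forall p : sP Y,
    exists m s, sNP m = tsok s *: p /\ good m.
  have : sNP (vden s *: n - m) = 0 by rewrite sNPB sNPZ mn subrr.
  move=> /sNP_eq0[u un]; apply: (tsokI (s := u)); apply: (tsokI (s := s)).
  have eq1 : vden s *: (vden u *: n) = vden u *: m.
    apply/eqP; rewrite scalerA mulrC -scalerA -subr_eq0 -scalerBr.
    by rewrite un.
  rewrite -!sNPZ -!actNZ eq1 goodZ // -eq1 !sNPZ.
  by rewrite !pactZ !scalerA -!mulrA -/(tsok u) -/(tsok s); congr (_ *: _); ring.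
apply: (spanned_ind (@sVP_spanned _ _ _ Y)) =>
    [|p q [m [s [mp gm]]] [l [t [lq gl]]]|x v].
- exists 0, (den1 _); rewrite sNP0 scaler0; split=> //.
  rewrite /good actN0 sNP0.
  by rewrite (lin0 (pact_lin _)) scaler0.
- exists (vden t *: m + vden s *: l), (denM s t); split; last first.
    by apply: goodD; apply: goodZ.
  rewrite sNPD !sNPZ mp lq tsokM scalerDr !scalerA -/(tsok t) -/(tsok s).
  by rewrite [tsok t * _]mulrC.
- have [m [s sm]] := sNP_surj (sVP v : sP Y).
  have [a [t ->]] := SOK_frac x; exists (a *: m), (denM s t); split.
    rewrite sNPZ -sm !scalerA tsokM; congr (_ *: _).
    transitivity (to_SOK a * tsok s * (tsok t * isok t)); last by ring.
    by rewrite tsokK mulr1.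
  apply: goodZ; have [m' [s' sm']] := sNP_surj (sVP (actV (whom w) v) : sP Y).
  have [u uP] := obj_equiv (esym sm) (esym sm').
  move: Fphi uP sm'; rewrite /good /whom.
  case Fw : (Whom W F) => [phi|] // _ /(_ F phi Fw w erefl) /(congr1 (@sNP _ _ Y)).
  rewrite !sNPZ => /(tsokI (s := u)) h sm'; apply: (tsokI (s := s')).
  rewrite {}h -sm -sm' !pactZ pactE !scalerA /tsok; congr (_ *: _); ring.
Qed.

End ObjectGerms.

(** Maschke's argument: a graded linear extension is averaged over conjugation by [W_K]. This does
    not change it on the image of [i], where it is already equivariant. *)
Lemma vrep_extension (L V U : vrep W) (i : L -> V) (f : L -> U) :
  is_vhom i -> is_vhom f -> injective i ->
  exists2 h : V -> U, is_vhom h & forall x, h (i x) = f x.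
Proof.
move=> [iL ig ia] [fL fg fa] inj_i.
have [h [hL hg hE]] := rat_extension_along iL fL inj_i ig fg.
pose k v := #|WK W|%:R^-1 *: \sum_(g : WK W) vr_act g^-1%g (h (vr_act g v)).
have n0 : #|WK W|%:R != 0 :> rat.
  by rewrite Num.Theory.pnatr_eq0 -lt0n; apply/card_gt0P; exists 1%g.
exists k; first split.
- move=> q u v; rewrite /k scalerA mulrC -scalerA -scalerDr; congr (_ *: _).
  rewrite scaler_sumr -big_split; apply: eq_bigr => g _ /=.
  by rewrite (@vr_act_lin _ _ _ V g) hL (@vr_act_lin _ _ _ U).
- move=> d v; rewrite /k (additive_rat (hcompD (vr_gr U) d)); congr (_ *: _).
  rewrite hcomp_bigsum; apply: eq_bigr => g _.
  by rewrite vr_act_gr hg vr_act_gr.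
- move=> w v; rewrite /k.
  rewrite (linZ (@vr_act_lin _ _ _ U w)); congr (_ *: _).
  rewrite [RHS](big_morph _ (linD (@vr_act_lin _ _ _ U w))
    (lin0 (@vr_act_lin _ _ _ U w))).
  rewrite (reindex_inj (mulIg w^-1%g)); apply: eq_bigr => g _.
  by rewrite -!vr_actM invMg invgK mulgKV.
- move=> x; rewrite /k (eq_bigr (fun=> f x)) => [|g _].
    by rewrite sumr_const -scaler_nat scalerA mulVf // scale1r.
  by rewrite -ia hE fa -vr_actM mulVg vr_act1.
Qed.

(** Localization carries exactness from the [N]-components to the [P]-components, so only [N] and
    [V] are to be checked. *)
Lemma short_exact_crit (Y Z T : smobj W) (i : smhom Y Z) (p : smhom Z T) :
  injective (hN i) -> injective (hV i) ->
  (forall n, hN p (hN i n) = 0) -> (forall v, hV p (hV i v) = 0) ->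
  (forall n, hN p n = 0 -> exists m, n = hN i m) ->
  (forall v, hV p v = 0 -> exists u, v = hV i u) ->
  (forall n, exists m, n = hN p m) -> (forall v, exists u, v = hV p u) ->
  short_exact (C := standard_model W) i p.
Proof.
move=> iN iV piN piV exN exV pN pV.
have pi0 : smcomp p i = smzero Y T by apply: hom_eq => x /=.
have piP q : hP p (hP i q) = 0 := congr1 (fun h : smhom Y T => hP h q) pi0.
have iP q : hP i q = 0 -> q = 0.
  have [n [s qn]] := sNP_surj q => q0.
  have : sNP (hN i n) = 0 by rewrite -hom_NP -qn homPZ q0 scaler0.
  move=> /sNP_eq0[u]; rewrite -(homNZ tm i) -(homN0 tm i) => /iN un.
  apply: (tsokI (s := s)); apply: (tsokI (s := u)).
  by rewrite qn -sNPZ un sNP0 !scaler0.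
have exP q : hP p q = 0 -> exists r, q = hP i r.
  have [n [s qn]] := sNP_surj q => q0.
  have : sNP (hN p n) = 0 by rewrite -hom_NP -qn homPZ q0 scaler0.
  move=> /sNP_eq0[u]; rewrite -(homNZ tm p) => /exN[m mE].
  exists (isok s *: (isok u *: sNP m)); rewrite !homPZ hom_NP -mE sNPZ -qn.
  by rewrite [isok u *: _]scalerA isokK scale1r scalerA isokK scale1r.
have pP q : exists r, q = hP p r.
  have [n [s qn]] := sNP_surj q; have [m nm] := pN n.
  exists (isok s *: sNP m).
  by rewrite homPZ hom_NP -nm -qn scalerA isokK scale1r.
have iPI q r : hP i q = hP i r -> q = r.
  move=> qr; apply/eqP; rewrite -subr_eq0; apply/eqP/iP.
  by rewrite homPD -scaleN1r homPZ scaleN1r qr subrr.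
split; split=> //= S f.
  move=> pf0.
  have fN n : hN p (hN f n) = 0 := congr1 (fun h : smhom S T => hN h n) pf0.
  have fP n : hP p (hP f n) = 0 := congr1 (fun h : smhom S T => hP h n) pf0.
  have fV n : hV p (hV f n) = 0 := congr1 (fun h : smhom S T => hV h n) pf0.
  have [gN' gNE] := choice (fun n => exN _ (fN n)).
  have [gP' gPE] := choice (fun n => exP _ (fP n)).
  have [gV' gVE] := choice (fun n => exV _ (fV n)).
  have [[iL1 iL2 iL3] [[ig1 ig2 ig3] [ic1 ic2 ic3 ic4]]] := smhomP i.
  have [[fL1 fL2 fL3] [[fg1 fg2 fg3] [fc1 fc2 fc3 fc4]]] := smhomP f.
  have gP0 : is_smhom gN' gP' gV'.
    split; first by split; [move=> r x y; apply: iN|move=> r x y; apply: iPI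
      |move=> r x y; apply: iV];
      rewrite ?iL1 ?iL2 ?iL3 -?gNE -?gPE -?gVE ?fL1 ?fL2 ?fL3.
    split; first by split; [move=> d x; apply: iN|move=> d x; apply: iPI
      |move=> d x; apply: iV];
      rewrite ?ig1 ?ig2 ?ig3 -?gNE -?gPE -?gVE ?fg1 ?fg2 ?fg3.
    split; [move=> n; apply: iPI|move=> v; apply: iPI|move=> F w n; apply: iN
      |move=> w v; apply: iV];
      rewrite ?ic1 ?ic2 ?ic3 ?ic4 -?gNE -?gPE -?gVE ?fc1 ?fc2 ?fc3 ?fc4 //.
  exists (SMHom gP0); split; first by apply: hom_eq => x /=; rewrite -?gNE -?gVE.
  move=> h hE; apply: hom_eq => x /=; [apply: iN|apply: iV].
    by rewrite -gNE -hE.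
  by rewrite -gVE -hE.
move=> fi0.
have fN n : hN f (hN i n) = 0 := congr1 (fun h : smhom Y S => hN h n) fi0.
have fP n : hP f (hP i n) = 0 := congr1 (fun h : smhom Y S => hP h n) fi0.
have fV n : hV f (hV i n) = 0 := congr1 (fun h : smhom Y S => hV h n) fi0.
have [gN' gNE] := choice pN; have [gP' gPE] := choice pP.
have [gV' gVE] := choice pV.
have kN n : hN f (gN' (hN p n)) = hN f n.
  have /exN[m /eqP] : hN p (gN' (hN p n) - n) = 0 by rewrite (homNB tm) -gNE subrr.
  by rewrite subr_eq => /eqP ->; rewrite (homND tm) fN add0r.
have kP n : hP f (gP' (hP p n)) = hP f n.
  have /exP[m /eqP] : hP p (gP' (hP p n) - n) = 0.
    by rewrite homPD -scaleN1r homPZ scaleN1r -gPE subrr.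
  by rewrite subr_eq => /eqP ->; rewrite homPD fP add0r.
have kV n : hV f (gV' (hV p n)) = hV f n.
  have /exV[m /eqP] : hV p (gV' (hV p n) - n) = 0 by rewrite homVB -gVE subrr.
  by rewrite subr_eq => /eqP ->; rewrite homVD fV add0r.
have [[pL1 pL2 pL3] [[pg1 pg2 pg3] [pc1 pc2 pc3 pc4]]] := smhomP p.
have [[fL1 fL2 fL3] [[fg1 fg2 fg3] [fc1 fc2 fc3 fc4]]] := smhomP f.
have gh : is_smhom (hN f \o gN') (hP f \o gP') (hV f \o gV').
  split; [split|split; split].
  - by move=> r x y /=; rewrite {1}(gNE x) {1}(gNE y) -pL1 kN fL1.
  - by move=> r x y /=; rewrite {1}(gPE x) {1}(gPE y) -pL2 kP fL2.
  - by move=> r x y /=; rewrite {1}(gVE x) {1}(gVE y) -pL3 kV fL3.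
  - by move=> d x /=; rewrite {1}(gNE x) -pg1 kN fg1.
  - by move=> d x /=; rewrite {1}(gPE x) -pg2 kP fg2.
  - by move=> d x /=; rewrite {1}(gVE x) -pg3 kV fg3.
  - by move=> x /=; rewrite {1}(gNE x) -pc1 kP fc1.
  - by move=> x /=; rewrite {1}(gVE x) -pc2 kP fc2.
  - by move=> F w x /=; rewrite {1}(gNE x) -pc3 kN fc3.
  - by move=> w x /=; rewrite {1}(gVE x) -pc4 kV fc4.
exists (SMHom gh); split; first by apply: hom_eq => x /=.
move=> h hE; apply: hom_eq => x /=.
  by rewrite [in RHS](gNE x) -hE.
by rewrite [in RHS](gVE x) -hE.
Qed.

End Germs.

(** * Objects with [N = P (+) D], and torsion objects *)

Section Half.
Context (K : choiceType) (X : sheaf K) (W : compstr X) (tm : tame W).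
Local Notation O := (OK X).
Local Notation B := (SOK X).
Local Notation idm F := (idem F : O).
Local Notation vden s := (val (s : den (mset X)) : O).

Definition torsion (N : lmodType O) :=
  forall n : N, exists s : den (mset X), vden s *: n = 0.

(* [P (+) D -> P <- V]: the sum of the injective object attached to [V] and of
   the torsion object [D -> 0 <- 0]. *)
Section HalfObject.
Context (Y : smobj W) (D : emod W) (Dt : torsion D).

Definition half_mod : lmodType O := (resP (sP Y) * D)%type.

Definition half_gr : grading half_mod := pair_grading (gP Y) (em_gr D).

(** On [P] this is the action forced by [sNP_act]. *)
Definition half_act F (w : WF W F) (n : half_mod) : half_mod :=
  (to_SOK (idm F) *: pact (whom w) n.1, em_act w n.2).

Definition half_emod : emod W.
Proof.
apply: (@Emod _ _ _ half_mod half_gr _ half_act).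
- apply: pair_graded; last exact: em_graded.
  move=> d e a p ad pe; apply: (@gP_mod _ _ Y d e) => //.
  exact: to_SOK_homog.
- by move=> F [p d]; rewrite /half_act whom1 pact1 em_act1.
- move=> F g h [p d]; rewrite /half_act /= whomM pactM em_actM pactZ scalerA.
  by rewrite -to_SOKM idem_idem.
- move=> F g a [p d] [q e]; congr pair; last exact: em_act_lin.
  rewrite /= (pact_lin (whom g) (to_SOK a)) scalerDr; congr (_ + _).
  by rewrite res_scaleE !scalerA mulrC.
- move=> F g d [p e]; rewrite /half_act !pair_gradingE /= em_act_gr.
  rewrite (pact_gr tm) (hcompZ (@gP_mod _ _ Y) _ _ (to_SOK_homog (@idem_homog _ _ F))).
  by rewrite subr0.
Defined.

Definition half_NP (n : half_emod) : pmod_of Y := (n : half_mod).1.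

Lemma half_NP_lin : semilinear (@to_SOK K X) half_NP.
Proof. by []. Qed.

Lemma half_NP_iso : bijective (@ind_loc K X half_emod (pmod_of Y) half_NP).
Proof.
apply: (ind_loc_bij half_NP_lin) => [[p d]|p].
  rewrite /half_NP /= => ->; have [s sd] := Dt d; exists s.
  by congr pair => //; apply: scaler0.
by exists ((p, 0) : half_mod), (den1 _); rewrite tsok1 scale1r.
Qed.

(** On [P] it is an identity between commuting scalars. On [D] both sides are killed by a
    denominator that kills [d] and [d'], and it serves all [F] and [w] at once. *)
Lemma half_equiv g (v : vrep_of Y) (n n' : half_emod) (s s' : den (mset X)) :
  half_NP n = tsok s *: sVP v -> half_NP n' = tsok s' *: sVP (vr_act g v) ->
  exists u : den (mset X), forall F phi, Whom W F = Some phi ->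
    forall w : WF W F, phi w = g ->
      vden u *: (vden s' *: em_act w n) = vden u *: (vden s *: (idm F *: n')).
Proof.
case: n n' => [p d] [p' d'] pE p'E.
have {pE}-> : p = tsok s *: sVP v := pE.
have {p'E}-> : p' = tsok s' *: sVP (actV g v) := p'E.
have [u ud] := Dt d; have [u' u'd'] := Dt d'.
have kills t (e : D) : vden u *: e = 0 \/ vden u' *: e = 0 ->
    vden (denM u u') *: (t *: e) = 0.
  rewrite val_denM !scalerA => -[] e0.
    by rewrite -mulrA mulrC -scalerA e0 scaler0.
  by rewrite mulrAC -scalerA e0 scaler0.
have swap4 (x y z t : B) (q : sP Y) :
    x *: (y *: (z *: (t *: q))) = x *: (t *: (z *: (y *: q))).
  by rewrite !scalerA; congr (_ *: _); ring.
exists (denM u u') => F phi Fphi w wg.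
have e1 : vden (denM u u') *: (vden s' *:
      (to_SOK (idm F) *: pact (whom w) (tsok s *: sVP v) : resP (sP Y))) =
    vden (denM u u') *: (vden s *:
      (idm F *: (tsok s' *: sVP (actV g v) : resP (sP Y)))).
  rewrite !res_scaleE /whom Fphi wg pactZ pactE; apply: swap4.
have e2 : vden (denM u u') *: (vden s' *: em_act w d) =
    vden (denM u u') *: (vden s *: (idm F *: d')).
  transitivity (0 : D); first by apply: kills; left; rewrite -em_actZ ud em_act0.
  by rewrite [vden s *: _]scalerA; symmetry; apply: kills; right.
exact: (f_equal2 pair e1 e2).
Qed.

Definition half_obj : smobj W := @mk_obj _ _ _ tm half_emod (pmod_of Y)
  (vrep_of Y) half_NP (@sVP _ _ Y) half_NP_lin (@sVP_lin _ _ Y)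
  (fun d n => congr1 fst (pair_gradingE (gP Y) (em_gr D) d n)) (@sVP_deg _ _ Y)
  half_NP_iso (@sVP_iso _ _ Y) half_equiv.

(** Existence half of an adjunction: the [P]-coordinate of the image of [n] can only be [k (sNP n)],
    with [k] the extension of [fV], while the coordinate in [D] is free. *)
Lemma half_hom (Z : smobj W) (fD : sN Z -> D) (fV : sV Z -> sV Y) :
  is_emhom (M := emod_of tm Z) fD ->
  is_vhom (U := vrep_of Z) (V := vrep_of Y) fV ->
  exists f : smhom Z half_obj,
    (forall n, (hN f n : half_mod).2 = fD n) /\ (forall v, hV f v = fV v).
Proof.
move=> [DL Dg Da] fVh; have [VL Vg Va] := fVh.
have sfL : semilinear (@unitSOK K X) (fun v : sV Z => sVP (fV v) : sP Y).
  by move=> q u v; have -> := VL q u v; apply: (@sVP_lin _ _ Y).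
have [k [kL kE]] := vobj_univ sfL.
have kg := @spanned_graded _ _ _ tm (pmod_of Z) (pmod_of Y) (vrep_of Z) (vrep_of Y)
  _ _ fV k (@sVP_spanned _ _ _ Z) (@sVP_deg _ _ Z) (@sVP_deg _ _ Y) Vg kL kE.
have kZ := linZ kL.
have kact g p : k (pact g p) = pact g (k p).
  apply: (linear_eq_spanned (@sVP_spanned _ _ _ Z)
    (h := k \o pact g) (k := pact g \o k)) => [a x y|a x y|v] /=.
  - by rewrite (pact_lin g) kL.
  - by rewrite kL (pact_lin g).
  - by rewrite pactE kE Va kE pactE.
pose fN (n : sN Z) : half_mod := (k (sNP n) : resP (sP Y), fD n).
have fh : @is_smhom _ _ _ Z half_obj fN k fV.
  apply: (@build_hom _ _ _ tm Z half_obj fN k fV) => //; split.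
  - by move=> a x y; congr pair; [rewrite (@sNP_lin _ _ Z) kL|rewrite DL].
  - move=> d n; rewrite /= /half_gr pair_gradingE /=; congr pair; last exact: Dg.
    by rewrite sNP_deg kg.
  - move=> F w n; congr pair; last exact: Da.
    by rewrite /= (sNP_act tm) kZ kact.
by exists (SMHom fh).
Qed.

Lemma half_hom_eq (Z : smobj W) (f g : smhom Z half_obj) :
  (forall n, (hN f n : half_mod).2 = (hN g n : half_mod).2) ->
  (forall v, hV f v = hV g v) -> f = g.
Proof.
move=> fg2 fgV; have fgP p : hP f p = hP g p.
  apply: (linear_eq_spanned (@sVP_spanned _ _ _ Z) (homP_lin f) (homP_lin g)) => v.
  by rewrite !hom_VP fgV.
apply: smhom_eq => // n; rewrite [LHS]surjective_pairing [RHS]surjective_pairing.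
congr pair => //; have := hom_NP f n; have := hom_NP g n.
by rewrite fgP => -> /=.
Qed.

Lemma half_hom2 (Z : smobj W) (f : smhom Z half_obj) :
  is_emhom (M := emod_of tm Z) (fun n => (hN f n : half_mod).2).
Proof.
have [L g a] := hom_em tm f; split.
- by move=> r x y; rewrite L.
- by move=> d n; rewrite g /= /half_gr pair_gradingE.
- by move=> F w n; rewrite a.
Qed.

(** Injectivity of [D] tested only on the [N]-parts of morphisms of the model, and not on arbitrary
    [O]-modules. *)
Definition extension_property := forall (Z T : smobj W) (i : smhom Z T),
  injective (hN i) -> injective (hV i) ->
  forall f : sN Z -> D, is_emhom (M := emod_of tm Z) f ->
  exists2 g : sN T -> D, is_emhom (M := emod_of tm T) g &
    forall n, g (hN i n) = f n.

Lemma half_injective : extension_property ->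
  injective_ob (C := standard_model W) half_obj.
Proof.
move=> ext Z T i f mi; have [iN iV] := injective_of_mono tm mi.
have [gD gDh gDE] := ext Z T i iN iV _ (half_hom2 f).
have [gV gVh gVE] := vrep_extension (hom_v i) (hom_v f) iV.
have [g [g2 gV2]] := half_hom gDh gVh; exists g.
apply: half_hom_eq => [n|v] /=; first by rewrite g2 gDE.
by rewrite gV2 gVE.
Qed.

End HalfObject.

(** [O] with trivial actions: in the encoding of actions every [w] in [W_F] then acts as [e_F]. *)
Definition unit_emod : emod W.
Proof.
apply: (@Emod _ _ _ (O^o : lmodType O) (prod_grading K (stalk X)) _
  (fun F (w : WF W F) (a : O) => idm F * a)).
- move=> d e a n ad /prod_homogP ne; apply: prodR_eq => F.
  by rewrite prod_gradingE; apply: prod_homogM.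
- by [].
- by move=> F g h n; rewrite mulrA idem_idem.
- by move=> F g a x y; rewrite mulrDr [a *: x]/(a * x) mulrCA.
- move=> F g d n; apply: prodR_eq => F'.
  rewrite prod_gradingE !prodR_mulE idemE; case: ifP => _.
    by rewrite !mul1r prod_gradingE.
  by rewrite !mul0r hcomp0.
Defined.

Section ZeroSubmod.
Context (A : pzRingType) (M : lmodType A).

Definition zero_submod : submod M.
Proof.
apply: (@Submod _ _ (fun x => x = 0)) => // a x y -> ->.
by rewrite scaler0 addr0.
Defined.

Lemma zero_subm (x y : subm zero_submod) : x = y.
Proof. by apply: subm_eq; rewrite (submP x : _ = 0) (submP y : _ = 0). Qed.

End ZeroSubmod.

Definition zero_emod (N : emod W) : emod W :=
  sub_emod (N := N) (S := zero_submod N)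
    (fun d n (n0 : n = 0) => ltac:(by rewrite n0 hcomp0))
    (fun F w n (n0 : n = 0) => ltac:(by rewrite n0; apply: em_act0)).

Lemma zero_torsion (N : emod W) : torsion (zero_emod N).
Proof. by move=> n; exists (den1 _); exact: (@zero_subm O N). Qed.

Lemma zero_extension (N : emod W) : extension_property (zero_emod N).
Proof.
move=> Z T i _ _ f _; exists (fun=> 0); last by move=> n; exact: (@zero_subm O N).
by split=> [a x y|d n|F w n]; exact: (@zero_subm O N).
Qed.

Definition zero_pmod : pmod X.
Proof.
apply: (@Pmod _ _ (subm (zero_submod (B^o : lmodType B))) (conc_grading _)).
by move=> *; apply: zero_subm.
Defined.

Definition zero_vrep : vrep W.
Proof.
apply: (@Vrep _ _ _ (subm (zero_submod (rat^o : lmodType rat))) (conc_grading _)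
  (fun _ v => v)) => //.
Defined.

Lemma zero_tens_iso : bijective (@ind_tens K X zero_pmod zero_vrep (fun=> 0)).
Proof.
have zL : semilinear (@unitSOK K X) (fun _ : zero_vrep => 0 : zero_pmod).
  by move=> *; apply: zero_subm.
apply: (ind_tens_bij zL) => [p|r t _].
  by exists [::]; apply: zero_subm.
suff nil s : tens_eq (@unitSOK K X) s ([::] : seq (B * zero_vrep)).
  exact: tens_trans (nil r) (tens_sym (nil t)).
elim: s => [|[b v] s IH]; first exact: tens_refl.
rewrite -cat1s -[[::]]cats0; apply: tens_cat IH.
rewrite (zero_subm v (0 *: v)).
apply: tens_trans (tens_sym (tens_scale _ b 0 v)) _.
rewrite (_ : unitSOK X 0 = 0) ?mulr0; first exact: tens_zero.
by rewrite -to_SOK0; congr to_SOK; apply: prodR_eq => F /=; rewrite scale0r.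
Qed.

Definition zero_obj : smobj W.
Proof.
apply: (@mk_obj _ _ _ tm (zero_emod unit_emod) zero_pmod zero_vrep
  (fun=> 0) (fun=> 0)); try by move=> *; apply: zero_subm.
- apply: ind_loc_bij; first by move=> *; apply: zero_subm.
    by move=> *; exists (den1 _); apply: zero_subm.
  by move=> p; exists 0, (den1 _); apply: zero_subm.
- exact: zero_tens_iso.
- by move=> *; exists (den1 _) => *; apply: zero_subm.
Defined.

Lemma zero_objV (u v : sV zero_obj) : u = v.
Proof. exact: (@zero_subm rat (rat^o)). Qed.

Lemma zero_objP (p q : sP zero_obj) : p = q.
Proof. exact: (@zero_subm B (B^o)). Qed.

Definition tors_obj (D : emod W) (Dt : torsion D) := half_obj zero_obj Dt.

End Half.

(** * Averaging over the groups [W_F] *)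

Section Average.
Context (K : choiceType) (X : sheaf K) (W : compstr X).
Local Notation O := (OK X).
Local Notation idm F := (idem F : O).

Definition separated (N : lmodType O) :=
  forall n : N, (forall F, idm F *: n = 0) -> n = 0.

Context (N D : emod W) (f : N -> D).
Context (fL : semilinear id f) (fg : forall d n, f (em_gr N d n) = em_gr D d (f n)).

Definition avg_at F (n : N) : D :=
  (const #|WF W F|%:R^-1 : O) *: \sum_(w : WF W F) em_act w (f (em_act w^-1%g n)).

Lemma avg_at_lin F : semilinear id (avg_at F).
Proof.
move=> a m n; rewrite /avg_at scalerA mulrC -scalerA -scalerDr; congr (_ *: _).
rewrite scaler_sumr -big_split; apply: eq_bigr => g _ /=.
by rewrite (@em_act_lin _ _ _ N) fL (@em_act_lin _ _ _ D).
Qed.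

Lemma avg_at_gr F d n : avg_at F (em_gr N d n) = em_gr D d (avg_at F n).
Proof.
rewrite /avg_at em_hcomp0; last exact: const_homog.
rewrite hcomp_bigsum; congr (_ *: _); apply: eq_bigr => w _.
by rewrite em_act_gr fg em_act_gr.
Qed.

Lemma avg_at_idem F n : idm F *: avg_at F n = avg_at F n.
Proof.
rewrite /avg_at scalerA mulrC -scalerA scaler_sumr; congr (_ *: _).
by apply: eq_bigr => w _; rewrite em_act_idem.
Qed.

Lemma avg_at_act F (w : WF W F) n : avg_at F (em_act w n) = em_act w (avg_at F n).
Proof.
rewrite /avg_at em_actZ; congr (_ *: _).
rewrite [RHS](big_morph _ (@em_actD _ _ _ D F w) (@em_act0 _ _ _ D F w)).
rewrite (reindex_inj (mulgI w)); apply: eq_bigr => g _.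
by rewrite -em_actM -em_actM invMg mulgKV.
Qed.

Lemma const_card F : (const #|WF W F|%:R^-1 : O) * #|WF W F|%:R = 1.
Proof.
have n0 : #|WF W F|%:R != 0 :> rat.
  by rewrite Num.Theory.pnatr_eq0 -lt0n; apply/card_gt0P; exists 1%g.
by rewrite -(const_nat K (stalk X)) -constM mulVf // const1.
Qed.

Lemma avg_at_fix F n : (forall w : WF W F, f (em_act w n) = em_act w (f n)) ->
  avg_at F n = idm F *: f n.
Proof.
move=> fn; rewrite /avg_at (eq_bigr (fun=> idm F *: f n)) => [|w _].
  by rewrite sumr_const -scaler_nat scalerA const_card scale1r.
by rewrite fn -em_actM mulgV em_act1.
Qed.

Lemma avg_at_neq F F' (w : WF W F) n : F' != F -> avg_at F' (em_act w n) = 0.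
Proof.
move=> FF'; rewrite /avg_at big1 ?scaler0 // => g _.
have -> : em_act g^-1%g (em_act w n) = 0.
  rewrite -(em_act_idem w n) em_actZ -(em_act_idem g^-1%g) scalerA.
  by rewrite idem_neq ?scale0r // eq_sym.
by rewrite (lin0 fL) em_act0.
Qed.

(** Elements of a separated module are determined by their coordinates, so linearity, degrees and
    equivariance of the glued map are checked at each [F]. An element with the averages as
    coordinates has to be supplied: a finite sum in a torsion module, a family in a product. *)
Lemma average : separated D ->
  (forall n, exists t, forall F, idm F *: t = avg_at F n) ->
  exists2 g : N -> D, is_emhom g & forall n F, idm F *: g n = avg_at F n.
Proof.
move=> sep ex; have [g gE] := choice ex.
have sepP (s t : D) : (forall F, idm F *: s = idm F *: t) -> s = t.
  move=> st; apply/eqP; rewrite -subr_eq0; apply/eqP/sep => F.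
  by rewrite scalerBr st subrr.
exists g => //; split.
- move=> a m n; apply: sepP => F; rewrite scalerDr scalerA mulrC -scalerA !gE.
  exact: avg_at_lin.
- move=> d n; apply: sepP => F; rewrite gE avg_at_gr -gE em_hcomp0 //.
  exact: idem_homog.
- move=> F w n; apply: sepP => F'; rewrite gE.
  have [->|F'F] := eqVneq F' F.
    by rewrite avg_at_act -gE em_actZ.
  by rewrite avg_at_neq // -(em_act_idem w (g n)) scalerA idem_neq // scale0r.
Qed.

End Average.

(** * Type 1 *)

Section Type1.
Context (K : choiceType) (W : compstr (type1 K)) (tm : tame W).
Context (hW : forall F, Whom W F <> None).
Local Notation X := (type1 K).
Local Notation O := (OK X).
Local Notation B := (SOK X).
Local Notation idm F := (idem F : O).
Local Notation coid A := (coidem (stalk X) A : O).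
Local Notation atp F p := (@at_ K (stalk X) F p : O).
Local Notation atX F k := (atp F ('X^k : {poly rat})).

(** A torsion element has zero germ, so it is the sum of finitely many of its coordinates. *)
Lemma torsion_separated (D : lmodType O) : torsion D -> separated D.
Proof.
move=> Dt n n0; have [s sn] := Dt n; have [A] := tors_germ0 tm sn.
rewrite scaler0 => An; rewrite -(scale1r n).
rewrite (coidem_split (stalk X) (undup_uniq A)) scalerDl.
have -> : coid (undup A) = coid (undup A) * coid A.
  by rewrite coidem_sub // => F; rewrite mem_undup.
rewrite -scalerA An scaler0 add0r scaler_suml big1 // => F _; rewrite n0.
Qed.

(** Powers of [c] are not zero divisors in [Q[c]], so [S] contains no zero divisors. *)
Lemma to_SOK_inj (a : O) : to_SOK a = 0 -> a = 0.
Proof.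
rewrite -to_SOK0 => /rfracP[u]; rewrite !val_denE !mul1r mulr0 => ua.
apply: prodR_eq => F; have [eps [_ uE]] := den_set u.
have /eqP := congr1 (fun x : O => (x : prodR _ _) F) ua.
rewrite prodR_mulE uE mulf_eq0 expf_eq0 polyX_eq0 andbF /= => /eqP; exact.
Qed.

Lemma grading_atp F (p : {poly rat}) j :
  prod_grading K (stalk X) (- (j.*2)%:Z) (atp F p) =
  const p`_j * atX F j.
Proof.
apply: prodR_eq => F'; rewrite prod_gradingE prodR_mulE !at_E.
case: ifP => _; last by rewrite mulr0 hcomp0.
apply/polyP => i; rewrite /= coef_hcomp_pol -scalerAl mul1r coefZ coefXn.
rewrite eqr_oppLR opprK eqz_nat (inj_eq double_inj) eq_sym.
by case: eqP => [->|]; rewrite ?mulr1 ?mulr0.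
Qed.

Lemma atp_homog F k : prod_homog (- (k.*2)%:Z) (atX F k).
Proof.
apply: at_homog; apply/homog_polP => i; rewrite coefXn.
by have [->|_] := eqVneq i k; rewrite ?eqxx.
Qed.

Definition divisible (D : lmodType O) :=
  forall F k (d : D), exists e, atX F k *: e = idm F *: d.

Section Extension.
Context (D : emod W) (Dt : torsion D) (Ddiv : divisible D) (Z : smobj W).
Local Notation NZ := (emod_of tm Z).
Implicit Types (G : submod (NZ * D)%type).

Local Notation pmap G := (partial_map (em_gr NZ) (em_gr D) G).

Definition covers (G : set (NZ * D)) (v : sV Z) :=
  exists A n t, G (n, t) /\ sNP n = to_SOK (coid A) *: (sVP v : sP Z).

(* Zorn's lemma is applied to the partial maps with this property, which says
   that the domain comes from a subspace of [V]. Since [O] is not noetherian, a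
   maximal partial map without it need not be total. *)
Definition covered (G : set (NZ * D)) := forall z, G z ->
  exists r : seq (B * sV Z), (forall y, y \in r -> covers G y.2) /\
    sNP z.1 = \sum_(y <- r) y.1 *: (sVP y.2 : sP Z).

Lemma covers_sub (G H : set (NZ * D)) v :
  (forall z, G z -> H z) -> covers G v -> covers H v.
Proof. by move=> GH [A [n [t [Gn nv]]]]; exists A, n, t; split=> //; apply: GH. Qed.

Lemma covers0 G : covers G 0.
Proof.
exists [::], 0, 0; split; first exact: submod0.
by rewrite sNP0 (unit_lin0 (@sVP_lin _ _ Z)) scaler0.
Qed.

Lemma coversZD G q u v : covers G u -> covers G v -> covers G (q *: u + v).
Proof.
move=> [A [m [s [Gm mu]]]] [A' [n [t [Gn nv]]]].
exists (A ++ A'), ((const q * coid A' : O) *: m + coid A *: n),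
  ((const q * coid A' : O) *: s + coid A *: t); split.
  exact: (submodD (submodZ (const q * coid A' : O) Gm) (submodZ (coid A) Gn)).
rewrite sNPD !sNPZ mu nv (@sVP_lin _ _ Z) scalerDr !scalerA -!to_SOKM.
by rewrite coidemM; congr (to_SOK _ *: _ + _); rewrite -coidemM; ring.
Qed.

Definition cover_submod G := Submod (covers0 G) (@coversZD G).

(** The covered vectors form a subspace; the functional is set to 0 on it and to 1 at [v], and is
    extended over Q. *)
Lemma covering_functional G v : ~ covers G v ->
  exists2 l : sV Z -> rat, semilinear id (l : sV Z -> rat^o) &
    (forall u, covers G u -> l u = 0) /\ l v = 1.
Proof.
move=> nv; pose C := cover_submod G.
have zL : semilinear id (fun _ : subm C => 0 : rat^o).
  by move=> q x y; rewrite scaler0 addr0.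
have iC : semilinear id (@submval _ _ C) by [].
have pC := @graph_along_partial _ _ _ _ _ _ iC zL (conc_grading _) (conc_grading _)
  (conc_grading _) (@subm_eq _ _ C).
have [|l [lL _ lE]] := @rat_extension (sV Z) rat^o (conc_grading _) (conc_grading _)
  (extend (graph_along iC zL) v 1).
- apply: (extend_partial (gA := grading_triv : grading rat)
    (@graded_rat_triv _ _) (@graded_rat_triv _ _) (e := 0)).
  + by apply: pC => d x; rewrite !conc_gradingE; case: eqP.
  + by rewrite /homog conc_gradingE eqxx.
  + by rewrite /homog conc_gradingE eqxx.
  move=> a x [u [vu ->]]; have [->|a0] := eqVneq a 0; first by rewrite scale0r.
  case: nv; rewrite -(scale1r v) -(mulVf a0) -scalerA vu.
  exact: (@submodZ _ _ C a^-1 _ (submP u)).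
exists l => //; split=> [u Cu|]; apply: lE; last exact: extend_new.
by apply: extendS; exists (sub_in (Cu : C u)).
Qed.

(** Let [n] be a homogeneous lift of an uncovered [v]. Extended to [P], the functional kills the
    image of the domain and sends [a *: n] to the image of [a * coid A]. If [a *: n] is in the
    domain, then [a * coid A = 0] and so [a *: n = 0]. The value 0 at [n] is therefore consistent,
    and maximality puts [n] in the domain. *)
Lemma cover_all G : pmap G -> covered (G : _ -> Prop) ->
  (forall e y t, homog (em_gr NZ) e y -> homog (em_gr D) e t ->
      (forall a x, G (a *: y, x) -> x = a *: t) ->
      covered (extend G y t : _ -> Prop) -> G (y, t)) ->
  forall v, covers G v.
Proof.
move=> pG cG Gmax.
elim/(homog_ind (g := gV Z)) => [|u v Gu Gv|d v dv]; first exact: covers0.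
  exact: (submodD (S := cover_submod G)).
apply: contrapT => nv; have [A [n [dn An nE]]] := lift_homog tm dv.
have [l lL [l0 l1]] := covering_functional nv; apply: nv; exists A, n, 0.
split=> //; apply: (Gmax d) => //; first exact: homog0.
  move=> a x Gx; rewrite scaler0; apply: (proj2 pG).
  suff an0 : a *: n = 0 by rewrite -an0.
  have ulL : semilinear (@unitSOK K X) (fun u : sV Z => unitSOK X (l u) : B^o).
    move=> q u w; rewrite lL.
    transitivity (unitSOK X q * unitSOK X (l u) + unitSOK X (l w)) => //.
    by rewrite /unitSOK -to_SOKM -to_SOKD -constM -constD.
  have [k [kL kE]] := vobj_univ ulL.
  have kZ := linZ kL; have kD := linD kL.
  have [r [rG rE]] := cG _ Gx.
  have : k (sNP (a *: n)) = 0.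
    rewrite rE (big_morph _ kD (lin0 kL)) big1_seq //.
    move=> y /andP[_ /rG /l0 y0]; rewrite kZ kE y0 /unitSOK.
    rewrite (_ : const 0 = 0 :> O) ?to_SOK0 ?scaler0 //.
    by apply: prodR_eq => F /=; rewrite scale0r.
  rewrite sNPZ nE scalerA -to_SOKM kZ kE l1 unitSOK1 [_ *: _]mulr1.
  by move=> /to_SOK_inj a0; rewrite -An scalerA a0 scale0r.
have extG z : G z -> extend G n 0 z := @extendS _ _ _ G n 0 z.
move=> z [b Gz]; have [r [rG rE]] := cG _ Gz.
exists ((to_SOK b * to_SOK (coid A), v) :: r); split.
  move=> y; rewrite inE => /orP[/eqP ->|/rG]; last exact: covers_sub.
  by exists A, n, 0; split=> //; apply: extend_new.
rewrite big_cons -rE /= -scalerA -nE -sNPZ -sNPD; congr sNP.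
by rewrite addrC subrK.
Qed.

Section Maximal.
Context (G : submod (NZ * D)%type) (pG : pmap G) (Gall : forall v, covers G v).

(** By [lift_ind]: the domain contains a lift of every vector, and two lifts agree off a finite
    set. *)
Lemma cofinite_domain n : exists A t, G (coid A *: n, t).
Proof.
elim/(lift_ind tm): n => [m n [A An] [A' [t mt]]|m n [A [t mt]] [A' [u nu]]|a v n vn].
- exists (A' ++ A), (coid A *: t); rewrite -coidemM mulrC -scalerA.
  rewrite scalerA mulrC -scalerA -An scalerA mulrC -scalerA.
  exact: (submodZ (coid A) mt).
- exists (A ++ A'), (coid A' *: t + coid A *: u); rewrite -coidemM scalerDr.
  rewrite {1}mulrC -!scalerA.
  exact: (submodD (submodZ (coid A') mt) (submodZ (coid A) nu)).
- have [A [m [t [Gm mE]]]] := Gall v.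
  have mv : lifts v m.
    exists A; rewrite mE; rewrite !res_scaleE scalerA -to_SOKM coidemM.
    congr (to_SOK _ *: _); apply: prodR_eq => F.
    by rewrite !coidemE mem_cat orbb.
  have [A' A'E] := lifts_uniq tm vn mv.
  exists A', (a *: (coid A' *: t)).
  rewrite scalerA mulrC -scalerA A'E.
  exact: (submodZ a (submodZ (coid A') Gm)).
Qed.

(* Baer's criterion at [F]: the [a(F)] with [a y] in the domain form a graded
   ideal of [Q[c]], which is [0] or generated by a power of [c]. *)
Lemma extend_at F e y : homog (em_gr NZ) e y ->
  exists t, [/\ homog (em_gr D) e t, idm F *: t = t &
    forall a x, G (a *: y, x) -> idm F *: x = a *: t].
Proof.
move=> ey; pose dom k := `[< exists x, G (atX F k *: y, x) >].
have domC a x k : G (a *: y, x) -> ((a : prodR _ _) F : {poly rat})`_k != 0 -> dom k.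
  move=> Gx ak; apply/asboolP.
  have := submodZ (idm F) Gx; rewrite pairZZ idem_mul.
  move=> /(proj1 pG (e - (k.*2)%:Z)) /=.
  rewrite (hcomp_graded (@gN_mod _ _ Z) (gA := prod_grading K (stalk X)) _ _ _ ey);
    last by move=> d b; apply: prod_homogP.
  rewrite addrAC subrr sub0r grading_atp => /(submodZ (const ((a F : {poly rat})`_k)^-1 : O)).
  rewrite pairZZ mulrA -constM mulVf // const1 mul1r.
  by eexists; eassumption.
have atF a x : G (a *: y, x) -> G (atp F ((a : prodR _ _) F) *: y, idm F *: x).
  by move=> /(submodZ (idm F)); rewrite pairZZ idem_mul.
have [ex|nex] := pselect (exists k, dom k); last first.
  exists 0; split; [exact: homog0|exact: scaler0|move=> a x Gx].
  rewrite scaler0; apply: (proj2 pG); have := atF _ _ Gx.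
  rewrite (_ : atp F _ = 0) ?scale0r //; apply: prodR_eq => F'.
  rewrite at_E; case: eqP => // _; apply/polyP => k; rewrite coef0; apply/eqP.
  by apply: contrapT => /negP /(domC _ _ _ Gx) dk; apply: nex; exists k.
pose k := ex_minn ex; have [dk kmin] : dom k /\ forall j, dom j -> (k <= j)%N.
  by rewrite /k; case: ex_minnP.
move: dk => /asboolP[x' Gx']; have ek : em_gr D (e - (k.*2)%:Z) x' = x'.
  have := proj1 pG (e - (k.*2)%:Z) _ Gx' => /=.
  rewrite (hcompZ (@gN_mod _ _ Z) _ _ (atp_homog F k)) opprK subrK ey => Gx''.
  exact: partial_map_eq pG Gx'' Gx'.
have [t' t'E] := Ddiv F k x'.
exists (idm F *: em_gr D e t'); split.
- by rewrite /homog em_hcomp0 ?hcompK ?eqxx //; apply: idem_homog.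
- by rewrite scalerA idem_idem.
have tE : atX F k *: em_gr D e t' = idm F *: x'.
  rewrite -ek -(em_hcomp0 _ _ (@idem_homog _ _ F)) -t'E.
  by rewrite (hcompZ (@em_graded _ _ _ D) _ _ (atp_homog F k)) opprK subrK.
move=> a x Gx; pose p : {poly rat} := (a : prodR _ _) F.
(* The coefficients of [p] below [k] vanish by minimality of [k], so [c^k] divides [p] and the value
   is determined by [x']. *)
have pE : p = drop_poly k p * 'X^k.
  rewrite -{1}(poly_take_drop k p) [take_poly _ _](_ : _ = 0) ?add0r //.
  apply/polyP => j; rewrite coef_take_poly coef0; case: ltnP => // jk.
  apply/eqP; apply: contrapT => /negP /(domC _ _ _ Gx) /kmin.
  by rewrite leqNgt jk.
have Gp := submodZ (atp F (drop_poly k p)) Gx'.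
have -> : idm F *: x = atp F (drop_poly k p) *: x'.
  apply: partial_map_eq pG (atF _ _ Gx) _; move: Gp.
  by rewrite pairZZ -at_mul -pE.
transitivity ((atp F (drop_poly k p)) *: (idm F *: x')).
  by rewrite scalerA mulrC idem_mul at_E eqxx.
by rewrite -tE !scalerA -at_mul -pE mulrC idem_mul.
Qed.

(** Off a finite set [A] the value is already given by [G], and at each [F] in [A] one is given by
    [extend_at]. The sum is finite, and its consistency is checked off [A] and at each [F] in
    [A]. *)
Lemma extend_homog e y : homog (em_gr NZ) e y ->
  exists2 t, homog (em_gr D) e t & forall a x, G (a *: y, x) -> x = a *: t.
Proof.
move=> ey; have [A [t0 Gt0]] := cofinite_domain y.
have [tf tfP] := choice (fun F => extend_at F ey).
have t0e : homog (em_gr D) e t0.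
  have := proj1 pG e _ Gt0 => /=.
  have -> : gN Z e (coid A *: y) = coid A *: y.
    by rewrite (em_hcomp0 (N := NZ) _ _ (@coidem_homog _ _ A)) ey.
  by move=> h; apply: partial_map_eq pG h Gt0.
exists (coid A *: t0 + \sum_(F <- undup A) tf F).
  apply: homogD; first by rewrite /homog em_hcomp0 ?t0e //; apply: coidem_homog.
  rewrite /homog hcomp_bigsum; apply: eq_bigr => F _.
  by case: (tfP F) => h _ _; apply: h.
move=> a x Gx; rewrite -{1}(scale1r x).
rewrite (coidem_split (stalk X) (undup_uniq A)) scalerDl scalerDr; congr (_ + _).
  have cu : coid (undup A) = coid A.
    by apply: prodR_eq => F; rewrite !coidemE mem_undup.
  have AA : coid A = coid A * coid A by rewrite coidem_sub.
  have G1 := submodZ a Gt0; have G2 := submodZ (coid A) Gx.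
  have e1 : coid A *: x = a *: t0.
    apply: partial_map_eq pG G2 _; move: G1.
    by rewrite pairZZ mulrC -scalerA.
  rewrite cu; transitivity (coid A *: (coid A *: x)); first by rewrite scalerA -AA.
  by rewrite e1 !scalerA mulrC.
rewrite scaler_suml scaler_sumr; apply: eq_bigr => F _.
by have [_ _] := tfP F; apply.
Qed.

End Maximal.

Lemma linear_extension G0 : pmap G0 -> covered (G0 : _ -> Prop) ->
  exists f : NZ -> D, [/\ semilinear id f, forall d n, f (em_gr NZ d n) = em_gr D d (f n)
    & forall n t, G0 (n, t) -> f n = t].
Proof.
move=> pG0 cG0; have gA_N : graded_mod (homog (prod_grading K (stalk X))) (em_gr NZ).
  by move=> d e a n /prod_homogP ad; apply: em_graded.
have gA_D : graded_mod (homog (prod_grading K (stalk X))) (em_gr D).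
  by move=> d e a n /prod_homogP ad; apply: em_graded.
have [C C0 CQ Ctot|G [G0G pG cG Gmax]] :=
    maximal_partial_map gA_N gA_D (Q := covered) _ pG0 cG0.
  move=> z [Y CY Yz]; have [r [rY rE]] := CQ _ CY _ Yz; exists r; split=> // y /rY.
  by apply: covers_sub => z' Yz'; exists Y.
have Gall := cover_all pG cG Gmax.
have [e y ey|f [fL fg fE]] := partial_map_total pG.
  (* Once all vectors are covered, every larger graph satisfies [covered], since [P] is spanned by
     [V]. Maximality then holds without restriction. *)
  have [t te tP] := extend_homog pG Gall ey; exists t; apply: (Gmax e) => // z Gz.
  have [r rE] := sVP_spanned (sNP z.1); exists r; split=> // w _.
  exact: covers_sub (@extendS _ _ _ G y t) (Gall w.2).
by exists f; split=> // n t /G0G /fE.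
Qed.

(** If [n] lifts [v], then for almost all [F] the element [w n] is [e_F n_g], with [g] the image of
    [w] and [n_g] a fixed lift of [g v]. As [W_K] is finite, only finitely many torsion elements
    [f n_g] are involved, each with finitely many non-zero coordinates. *)
Lemma finite_act_support (f : NZ -> D) : semilinear id f ->
  forall n : NZ, exists A : seq K, forall F, F \notin A ->
    forall w : WF W F, f (em_act w n) = 0.
Proof.
move=> fL; have fD := linD fL; have fZ := linZ fL.
have act_e F (w : WF W F) (n : NZ) : em_act w n = em_act w (idm F *: n).
  by rewrite em_actZ em_act_idem.
apply: (lift_ind tm) => [m n /germ_at[A AE] [A' A'E]|m n [A AE] [A' A'E]|a v n vn].
- exists (A ++ A') => F; rewrite mem_cat negb_or => /andP[FA FA'] w.
  by rewrite act_e -AE // -act_e A'E.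
- exists (A ++ A') => F; rewrite mem_cat negb_or => /andP[FA FA'] w.
  by rewrite em_actD fD AE // A'E // addr0.
have [ng ngE] := choice (fun g => lift_exists tm (actV g v)).
have [A AE] := choice (fun g => lifts_act tm vn (ngE g)).
have tor g : exists A : seq K, forall F, F \notin A -> f (idm F *: ng g) = 0.
  have [s sf] := Dt (f (ng g)); have [A' A'E] := germ_at (tors_germ0 tm sf).
  by exists A' => F /A'E; rewrite fZ => ->; rewrite scaler0.
have [A' A'E] := choice tor.
exists (flatten [seq A g ++ A' g | g <- enum (WK W)]) => F Fn w.
have [phi Fphi] : exists phi, Whom W F = Some phi.
  by case Fw : (Whom W F) => [phi|]; [exists phi|case: (hW Fw)].
have : F \notin A (phi w) ++ A' (phi w).
  apply: contra Fn => FA; apply/flattenP; exists (A (phi w) ++ A' (phi w)) => //.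
  by apply/mapP; exists (phi w) => //; rewrite mem_enum.
rewrite mem_cat negb_or => /andP[FA FA'].
have e : em_act w (n : NZ) = idm F *: ng (phi w) := AE _ F FA phi Fphi w erefl.
rewrite em_actZ fZ e.
by rewrite A'E // scaler0.
Qed.

(** The averages of [f] at [n] vanish at almost all [F], so their sum is an element of [D]. On the
    stable graph [G0] the map is already equivariant and averaging changes nothing. *)
Lemma torsion_extension G0 : pmap G0 -> covered (G0 : _ -> Prop) ->
  (forall n t, G0 (n, t) -> forall F (w : WF W F), G0 (em_act w n, em_act w t)) ->
  exists2 g : NZ -> D, is_emhom g & forall n t, G0 (n, t) -> g n = t.
Proof.
move=> pG0 cG0 aG0; have [f [fL fg fE]] := linear_extension pG0 cG0.
have sepD := torsion_separated Dt.
have [n|g gh gE] := average fL fg sepD.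
  have [A AE] := finite_act_support fL n.
  exists (\sum_(F <- undup A) avg_at f F n) => F; rewrite scaler_sumr.
  have [FA|FA] := boolP (F \in undup A).
    rewrite (bigD1_seq F) ?undup_uniq //= avg_at_idem big1 ?addr0 // => F' F'F.
    by rewrite -avg_at_idem scalerA idem_neq ?scale0r // eq_sym.
  rewrite big1_seq => [|F' /andP[_ F'A]].
    rewrite /avg_at big1 ?scaler0 // => w _.
    by rewrite AE ?em_act0 // -mem_undup.
  rewrite -avg_at_idem scalerA idem_neq ?scale0r //.
  by apply: contraNneq FA => ->.
exists g => // n t G0t; apply/eqP; rewrite -subr_eq0; apply/eqP/sepD => F.
rewrite scalerBr gE avg_at_fix ?(fE _ _ G0t) ?subrr // => w.
by apply: fE; apply: aG0.
Qed.

End Extension.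

Lemma divisible_extension (D : emod W) :
  torsion D -> divisible D -> extension_property tm D.
Proof.
move=> Dt Ddiv Y Z i iN iV f fh; have [fL fg fa] := fh.
have [iL ig ia] := hom_em tm i.
have [||n t [m [-> ->]] F w|g gh gE] := torsion_extension Dt Ddiv
  (G0 := graph_along iL fL : submod (emod_of tm Z * D)%type).
- exact: graph_along_partial.
- move=> _ [m ->] /=; have [r rE] := sVP_spanned (sNP m).
  exists [seq (z.1, hV i z.2) | z <- r]; split; last first.
    rewrite -(hom_NP i) rE (big_morph _ (homPD i) (homP0 i)) big_map.
    by apply: eq_bigr => z _; rewrite homPZ hom_VP.
  move=> _ /mapP[z _ ->] /=; have [n [A An]] := lift_exists tm z.2.
  exists A, (hN i (coid A *: n)), (f (coid A *: n)); split; first by exists (coid A *: n).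
  by rewrite -hom_NP sNPZ [to_SOK _ *: sNP n]An -hom_VP -homPZ.
- by exists (em_act w m); rewrite ia fa.
by exists g => // n; apply: gE; exists n.
Qed.

End Type1.

Lemma big_support (M : zmodType) (I : eqType) (D E : seq I) (F : I -> M) :
  uniq D -> uniq E -> (forall i, i \notin D -> F i = 0) ->
  (forall i, i \notin E -> F i = 0) -> \sum_(i <- D) F i = \sum_(i <- E) F i.
Proof.
move=> uD uE D0 E0.
rewrite (bigID (mem E)) /= [X in _ + X]big1 ?addr0 => [|i /E0 //].
rewrite [RHS](bigID (mem D)) /= [X in _ = _ + X]big1 ?addr0 => [|i /D0 //].
rewrite -big_filter -[RHS]big_filter; apply: perm_big.
by apply: uniq_perm; rewrite ?filter_uniq // => i; rewrite !mem_filter andbC.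
Qed.

Section MakeDen.
Context (A : comPzRingType) (S : mulset A) (s : A) (Ss : mulset_set S s).

Lemma mkden_subproof : s \in (S : set A). Proof. by rewrite inE. Qed.
Definition mkden : den S := Sub s mkden_subproof.
Lemma val_mkden : val mkden = s. Proof. by []. Qed.

End MakeDen.

(** * Quotients of modules with action *)

Section RangeQuotient.
Context (K : choiceType) (X : sheaf K) (W : compstr X) (N M : emod W).
Context (f : M -> N) (fh : is_emhom f).

Definition range_set (n : N) := exists m, n = f m.

Lemma range0 : range_set 0.
Proof. by have [fL _ _] := fh; exists 0; rewrite (lin0 fL). Qed.

Lemma rangeZD a m n : range_set m -> range_set n -> range_set (a *: m + n).
Proof.
by have [fL _ _] := fh => -[x ->] [y ->]; exists (a *: x + y); rewrite fL.
Qed.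

Definition range_submod : submod N := Submod range0 rangeZD.

Lemma range_gr d n : range_submod n -> range_submod (em_gr N d n).
Proof. by have [_ fg _] := fh => -[m ->]; exists (em_gr M d m); rewrite fg. Qed.

Lemma range_act F (w : WF W F) n : range_submod n -> range_submod (em_act w n).
Proof. by have [_ _ fa] := fh => -[m ->]; exists (em_act w m); rewrite fa. Qed.

End RangeQuotient.

Section QuotEmod.
Context (K : choiceType) (X : sheaf K) (W : compstr X) (N : emod W).
Context (S : submod N) (gS : forall d n, S n -> S (em_gr N d n)).
Context (aS : forall F (w : WF W F) n, S n -> S (em_act w n)).

Definition quot_act F (w : WF W F) (x : quotmod S) : quotmod S :=
  qproj S (em_act w (generic_quotient.repr x)).

Lemma quot_actE F (w : WF W F) n : quot_act w (qproj S n) = qproj S (em_act w n).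
Proof.
rewrite /quot_act; apply/qprojP.
rewrite -[em_act w n]scale1r -scaleNr addrC -(@em_act_lin _ _ _ N F w (-1)).
apply: aS; rewrite scaleN1r addrC; apply/qprojP; exact: reprK.
Qed.

Definition quot_emod : emod W.
Proof.
apply: (@Emod _ _ _ (quotmod S) (quot_grading gS) (quot_graded (@em_graded _ _ _ N))
  quot_act).
- by move=> F x; have [n ->] := qproj_surj x; rewrite quot_actE em_act1 qprojZ.
- by move=> F g h x; have [n ->] := qproj_surj x; rewrite !quot_actE em_actM.
- move=> F g a x y; have [m ->] := qproj_surj x; have [n ->] := qproj_surj y.
  by rewrite -qprojZ -qprojD !quot_actE em_act_lin qprojD qprojZ.
- move=> F g d x; have [n ->] := qproj_surj x.
  by rewrite !(quot_gradingE, quot_actE) em_act_gr.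
Defined.

Lemma qproj_emhom : is_emhom (qproj S : N -> quot_emod).
Proof.
split=> [a m n|d n|F w n] /=; first by rewrite qprojD qprojZ.
  by rewrite quot_gradingE.
by rewrite quot_actE.
Qed.

End QuotEmod.

Lemma comp_emhom (K : choiceType) (X : sheaf K) (W : compstr X) (L M N : emod W)
    (f : M -> N) (g : L -> M) : is_emhom f -> is_emhom g -> is_emhom (f \o g).
Proof.
move=> [fL fg fa] [gL gg ga]; split=> [a x y|d x|F w x] /=.
- by rewrite gL fL.
- by rewrite gg fg.
- by rewrite ga fa.
Qed.

(** * A divisible torsion module containing a given one *)

Section Cofree.
Context (K : choiceType) (W : compstr (type1 K)) (T : emod W).
Local Notation X := (type1 K).
Local Notation O := (OK X).
Local Notation idm F := (idem F : O).
Local Notation coid A := (coidem (stalk X) A : O).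
Local Notation atp F p := (@at_ K (stalk X) F p : O).
Local Notation ev a F := (((a : O) : prodR K (stalk X)) F : {poly rat}).
Local Notation prh := (prod_homog (K := K) (R := stalk X)).
Local Notation pg := (prod_grading K (stalk X)).

Lemma cvar_subproof : (fun=> 'X : {poly rat}) \in @bounded_family K (stalk X).
Proof.
apply/asboolP; exists [:: - 2%:Z] => F d; rewrite inE => d2.
apply/polyP => i; rewrite coef0 /= coef_hcomp_pol coefX; case: eqP => // id.
by case: eqP => // i1; case/eqP: d2; rewrite -id i1.
Qed.

Definition cvar : O := ProdR cvar_subproof.

Lemma cvarX k F : ev (cvar ^+ k) F = 'X^k.
Proof.
elim: k => [|k IH]; first by rewrite !expr0.
by rewrite !exprS [ev _ F]prodR_mulE IH.
Qed.

Lemma cvarX_homog k : prh (- (k.*2)%:Z) (cvar ^+ k).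
Proof.
by move=> F; rewrite cvarX; apply/homog_polP => i; rewrite coefXn;
  have [->|_] := eqVneq i k; rewrite ?eqxx.
Qed.

(** Each degree of [Q[c]] is zero or spanned by one power of [c], the same at all [F]. A map linear
    over the degree 0 part of [O] is thus determined by its values at the powers of [c]. *)
Lemma homog_decomp e b : prh e b ->
  b = 0 \/ exists j r, [/\ prh 0 r, e = - (j.*2)%:Z & b = r * cvar ^+ j].
Proof.
move=> be; have [[j ej]|nj] := pselect (exists j : nat, e = - (j.*2)%:Z).
  right; pose r F : {poly rat} := ((ev b F)`_j)%:P.
  have r0 F : homog (gr_grading (stalk X)) 0 (r F).
    by apply/homog_polP => -[|k]; rewrite coefC //= eqxx.
  exists j, (ProdR (bounded_homog0 r0)); split=> //.
  apply: prodR_eq => F; rewrite prodR_mulE -[X in _ = _ * X]/(ev _ F) cvarX /= /r.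
  apply/polyP => i; rewrite mul_polyC coefZ coefXn.
  have := (proj1 (homog_polP _ _)) (be F) i; case: (eqVneq i j) => [->|ij] h.
    by rewrite mulr1.
  rewrite mulr0; apply/eqP; apply: contraT => /h; rewrite ej => /oppr_inj [].
  by move=> /double_inj /eqP; rewrite (negbTE ij).
left; apply: prodR_eq => F; apply/polyP => i; rewrite coef0.
apply/eqP; apply: contraT => /((proj1 (homog_polP _ _)) (be F) i) ei.
by case: nj; exists i.
Qed.

(** The last two conditions make [h] torsion for the action through the source: it is killed by a
    cofinite idempotent and by a power of [c]. *)
Definition cofree_prop (h : O -> T) : Prop := [/\ forall x y, h (x + y) = h x + h y,
  forall r x, prh 0 r -> h (r * x) = r *: h x,
  exists A, forall x, h (coid A * x) = 0 & exists k, forall x, h (cvar ^+ k * x) = 0].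

Definition cofree_pred : {pred O -> T} := fun h => `[< cofree_prop h >].

Lemma cofree_closed : zmod_closed cofree_pred.
Proof.
split=> [|h h' /asboolP[hD hZ [A hA] [k hk]] /asboolP[h'D h'Z [A' h'A] [k' h'k]]];
    apply/asboolP.
  split=> [x y|r x _||]; rewrite /= ?addr0 ?scaler0 //; first by exists [::].
  by exists 0%N.
split=> [x y|r x r0||].
- by rewrite -![(h - h') _]/(h _ - h' _) hD h'D opprD addrACA.
- by rewrite -![(h - h') _]/(h _ - h' _) hZ // h'Z // scalerBr.
- exists (A ++ A') => x; rewrite -![(h - h') _]/(h _ - h' _) -coidemM -mulrA hA.
  by rewrite mulrCA h'A subrr.
- exists (k + k')%N => x; rewrite -![(h - h') _]/(h _ - h' _) exprD -mulrA hk.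
  by rewrite mulrCA h'k subrr.
Qed.

HB.instance Definition _ :=
  GRing.isZmodClosed.Build (O -> T) cofree_pred cofree_closed.

(* A divisible torsion module containing [T]: the torsion part of the maps
   [O -> T] that are linear over the degree 0 part of [O], on which [O] acts
   through the source. *)
Record cofree := Cofree { cofree_val :> O -> T; cofreeP : cofree_val \in cofree_pred }.
HB.instance Definition _ := [isSub for cofree_val].
HB.instance Definition _ := [Choice of cofree by <:].
HB.instance Definition _ := [SubChoice_isSubZmodule of cofree by <:].

Implicit Types (h : cofree).

Lemma cofree_eq h h' : (forall x, h x = h' x) -> h = h'.
Proof. by move=> hh; apply: val_inj; apply/funext. Qed.

Lemma cofree_propP h : cofree_prop h.
Proof. exact/asboolP/cofreeP. Qed.

Lemma cofD h x y : h (x + y) = h x + h y.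
Proof. by case: (cofree_propP h). Qed.

Lemma cof0 h : h 0 = 0.
Proof. by apply: (addrI (h 0)); rewrite -cofD !addr0. Qed.

Lemma cofZ h r x : prh 0 r -> h (r * x) = r *: h x.
Proof. by case: (cofree_propP h) => _ + _ _; apply. Qed.

Lemma cofree_addE h h' x : (h + h') x = h x + h' x. Proof. by []. Qed.

Lemma cofree_homog_eq h h' :
  (forall e x, prh e x -> h x = h' x) -> h = h'.
Proof.
move=> hh; apply: cofree_eq; apply: (homog_ind (g := pg)).
- by rewrite !cof0.
- by move=> x y hx hy; rewrite !cofD hx hy.
- by move=> d x /prod_homogP; apply: hh.
Qed.

Lemma cof_scale_subproof (a : O) h : (fun x => h (a * x)) \in cofree_pred.
Proof.
have [hD hZ [A hA] [k hk]] := cofree_propP h; apply/asboolP; split=> [x y|r x r0||].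
- by rewrite mulrDr hD.
- by rewrite mulrCA hZ.
- by exists A => x; rewrite mulrCA hA.
- by exists k => x; rewrite mulrCA hk.
Qed.

Definition cof_scale (a : O) h : cofree := Cofree (cof_scale_subproof a h).

Lemma cof_scaleA a b h : cof_scale a (cof_scale b h) = cof_scale (a * b) h.
Proof. by apply: cofree_eq => x /=; congr (h _); ring. Qed.

Lemma cof_scale1 : left_id 1 cof_scale.
Proof. by move=> h; apply: cofree_eq => x /=; rewrite mul1r. Qed.

Lemma cof_scaleDr : right_distributive cof_scale +%R.
Proof. by move=> a h h'; apply: cofree_eq. Qed.

Lemma cof_scaleDl h : {morph cof_scale^~ h : a b / a + b}.
Proof.
move=> a b; apply: cofree_eq => x.
exact: (etrans (congr1 h (mulrDl a b x)) (cofD h (a * x) (b * x))).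
Qed.

HB.instance Definition _ := GRing.Zmodule_isLmodule.Build O cofree
  cof_scaleA cof_scale1 cof_scaleDr cof_scaleDl.

Lemma cof_scaleE (a : O) h x : (a *: h) x = h (a * x). Proof. by []. Qed.

Definition csupp (x : O) : seq int := undup (sval (cid (hcomp_fin pg x))).

Lemma csuppP x d : d \notin csupp x -> pg d x = 0.
Proof. by rewrite mem_undup; apply: (svalP (cid (hcomp_fin pg x))). Qed.

(** The part of [h] that raises degrees by [d]. *)
Definition chcomp_fun (d : int) h (x : O) : T :=
  \sum_(e <- csupp x) em_gr T (d + e) (h (pg e x)).

Lemma chcomp_funE d h x (D : seq int) : uniq D ->
  (forall e, e \notin D -> pg e x = 0) ->
  chcomp_fun d h x = \sum_(e <- D) em_gr T (d + e) (h (pg e x)).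
Proof.
move=> uD D0; apply: big_support => //; first exact: undup_uniq.
  by move=> e /csuppP ->; rewrite cof0 hcomp0.
by move=> e /D0 ->; rewrite cof0 hcomp0.
Qed.

Lemma pg_mul e k (a x : O) : prh k a -> pg e (a * x) = a * pg (e - k) x.
Proof.
move=> ak; apply: (hcompZ (M := O^o) (hA := prh) (g := pg)) => //.
move=> d f b y bd /prod_homogP yf; apply: prodR_eq => F.
by rewrite prod_gradingE; apply: prod_homogM.
Qed.

Lemma chcomp_subproof d h : chcomp_fun d h \in cofree_pred.
Proof.
have [hD hZ [A hA] [k hk]] := cofree_propP h; apply/asboolP; split=> [x y|r x r0||].
- pose D := undup (csupp x ++ csupp y).
  have uD : uniq D by apply: undup_uniq.
  have Dx e : e \notin D -> pg e x = 0.
    by rewrite mem_undup mem_cat negb_or => /andP[/csuppP].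
  have Dy e : e \notin D -> pg e y = 0.
    by rewrite mem_undup mem_cat negb_or => /andP[_ /csuppP].
  rewrite !(@chcomp_funE d h _ D) // => [|e De]; last by rewrite hcompD Dx ?Dy ?addr0.
  by rewrite -big_split; apply: eq_bigr => e _; rewrite hcompD hD hcompD.
- rewrite (@chcomp_funE d h _ (csupp x)) ?undup_uniq // => [|e /csuppP ex].
    rewrite scaler_sumr; apply: eq_bigr => e _.
    by rewrite (pg_mul _ _ r0) subr0 hZ // em_hcomp0.
  by rewrite (pg_mul _ _ r0) subr0 ex mulr0.
- exists A => x; rewrite /chcomp_fun big1 // => e _.
  by rewrite (pg_mul _ _ (@coidem_homog _ _ A)) hA hcomp0.
- exists k => x; rewrite /chcomp_fun big1 // => e _.
  by rewrite (pg_mul _ _ (@cvarX_homog k)) hk hcomp0.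
Qed.

Definition chcomp d h : cofree := Cofree (chcomp_subproof d h).

Lemma chcompE d h e x : prh e x -> chcomp d h x = em_gr T (d + e) (h x).
Proof.
move=> xe; have ex : homog pg e x.
  by apply: prodR_eq => F; rewrite prod_gradingE; apply: xe.
rewrite /= (@chcomp_funE d h x [:: e]) ?big_seq1 ?ex // => f; rewrite inE => fe.
by rewrite (hcomp_homog _ ex) (negbTE fe).
Qed.

Lemma cofree_grading_subproof : exists g : grading cofree, hcomp g = chcomp.
Proof.
apply: grading_of_fin => [d h h'|d f h|h h0|h].
- apply: cofree_homog_eq => e x xe.
  by rewrite cofree_addE !(chcompE _ _ xe) cofree_addE hcompD.
- apply: cofree_homog_eq => e x xe; rewrite !(chcompE _ _ xe) hcompK.
  rewrite (inj_eq (addIr e)); case: eqP => _ //; by rewrite (chcompE _ _ xe).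
- apply: cofree_homog_eq => e x xe; apply: (hcomp_inj (g := em_gr T)) => d.
  by rewrite -{1}(subrK e d) -(chcompE _ _ xe) h0 hcomp0.
(* [h] is determined by its values at [c^j] with [j < k]. The part of degree [d] sends [c^j] to the
   component of degree [d - 2j] of [h (c^j)], so finitely many [d] remain. *)
- have [_ _ _ [k hk]] := cofree_propP h.
  have [D DP] := choice (fun j : nat => hcomp_fin (em_gr T) (h (cvar ^+ j))).
  exists (flatten [seq [seq d + (j.*2)%:Z | d <- D j] | j <- iota 0 k]) => d dD.
  apply: cofree_homog_eq => e x xe; rewrite (chcompE _ _ xe).
  have [->|[j [r [r0 ej ->]]]] := homog_decomp xe; first by rewrite !cof0 hcomp0.
  rewrite cofZ // em_hcomp0 //; have [jk|kj] := ltnP j k; last first.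
    by rewrite -(subnKC kj) exprD hk hcomp0 scaler0.
  rewrite DP ?scaler0 //; apply: contra dD => dD.
  apply/flattenP; exists [seq d + (j.*2)%:Z | d <- D j].
    by apply/mapP; exists j; rewrite ?mem_iota.
  by apply/mapP; exists (d + e) => //; rewrite ej subrK.
Qed.

Definition cofree_grading := sval (cid cofree_grading_subproof).

Lemma cofree_gradingE d h e x : prh e x ->
  cofree_grading d h x = em_gr T (d + e) (h x).
Proof.
by rewrite /cofree_grading (svalP (cid cofree_grading_subproof)); apply: chcompE.
Qed.

Lemma cof_act_subproof F (w : WF W F) h : (fun x => em_act w (h x)) \in cofree_pred.
Proof.
have [hD hZ [A hA] [k hk]] := cofree_propP h; apply/asboolP; split=> [x y|r x r0||].
- by rewrite hD em_actD.
- by rewrite hZ // em_actZ.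
- by exists A => x; rewrite hA em_act0.
- by exists k => x; rewrite hk em_act0.
Qed.

Definition cof_act F (w : WF W F) h : cofree := Cofree (cof_act_subproof w h).

Definition cofree_emod : emod W.
Proof.
apply: (@Emod _ _ _ cofree cofree_grading _ cof_act).
- move=> d e a h ad he; apply: cofree_homog_eq => f x xf.
  rewrite (cofree_gradingE _ _ xf) !cof_scaleE -{2}he.
  by rewrite (cofree_gradingE _ _ (prod_homogM ad xf)) addrA [e + d]addrC.
- move=> F h; apply: cofree_eq => x /=.
  by rewrite em_act1 -cofZ //; apply: idem_homog.
- by move=> F g g' h; apply: cofree_eq => x /=; rewrite em_actM.
- move=> F g a h h'; apply: cofree_eq => x.
  exact: (em_actD g (h (a * x)) (h' x)).
- move=> F g d h; apply: cofree_homog_eq => e x xe.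
  by rewrite /= !(cofree_gradingE _ _ xe) /= em_act_gr.
Defined.

Lemma cden_subproof F k : mulset_set (mset X) (coid [:: F] + atp F 'X^k).
Proof.
exists (fun F' => if F' == F then k else 0%N); split=> [|F'].
  apply: (@sub_finite_set _ _ [set F]) => // F' /=; by case: eqP.
rewrite prodR_addE coidemE at_E inE; case: eqP => _; first by rewrite add0r.
by rewrite addr0 expr0.
Qed.

Definition cden F k : den (mset X) := mkden (cden_subproof F k).

Lemma cden_idem F k : idm F * (val (cden F k) : O) = atp F 'X^k.
Proof.
rewrite idem_mul val_mkden; congr at_; rewrite prodR_addE coidemE at_E inE eqxx.
by rewrite add0r.
Qed.

Lemma cofree_torsion : torsion cofree_emod.
Proof.
move=> h; have [hD hZ [A hA] [k hk]] := cofree_propP h.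
(* The element of [S] equal to [c^k] on [A] and to 1 elsewhere. Its multiples are sums of a multiple
   of [coid A] and one of [c^k], both killed by [h]. *)
pose f F : {poly rat} := if F \in A then 'X^k else 1.
have fb : f \in @bounded_family K (stalk X).
  apply/asboolP; exists [:: - (k.*2)%:Z; 0] => F d.
  rewrite !inE negb_or => /andP[dk d0]; rewrite /f; case: ifP => _.
    by have := cvarX_homog k F; rewrite cvarX => /hcomp_homog ->; rewrite (negbTE dk).
  by rewrite (hcomp_homog _ (gr_homog1 (stalk X))) (negbTE d0).
have fS : mulset_set (mset X) (ProdR fb : prodR K (stalk X)).
  exists (fun F => if F \in A then k else 0%N); split=> [|F].
    apply: (@sub_finite_set _ _ [set` A]); last exact: finite_seq.
    by move=> F /=; case: ifP.
  by rewrite /= /f; case: ifP.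
exists (mkden fS); apply: cofree_eq => x; rewrite cof_scaleE /=.
have -> : (ProdR fb : O) * x = coid A * x + cvar ^+ k * ((1 - coid A) * x).
  apply: prodR_eq => F; rewrite prodR_addE !prodR_mulE prodR_addE prodR_oppE.
  rewrite coidemE -[X in _ + X * _]/(ev _ F) cvarX /= /f.
  by case: ifP => _; rewrite ?subr0 ?subrr ?mul0r ?mul1r ?add0r ?mulr0 ?addr0.
by rewrite hD hA hk addr0.
Qed.

(** Division of the coordinate at [F] by [c^k], dropping lower terms, is linear over the degree 0
    part of [O] but not over [O]. This is why no more linearity is asked of the maps in [cofree]. *)
Lemma drop_fun_subproof F k h :
  (fun x : O => h (atp F (drop_poly k (ev x F)))) \in cofree_pred.
Proof.
have [hD hZ [A hA] [m hm]] := cofree_propP h; apply/asboolP.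
have atD p q : atp F (p + q) = atp F p + atp F q.
  by apply: prodR_eq => F'; rewrite prodR_addE !at_E; case: eqP; rewrite ?addr0.
have at0 : atp F 0 = 0 by apply: prodR_eq => F'; rewrite at_E if_same.
split=> [x y|r x r0||].
- by rewrite [ev _ F]prodR_addE raddfD atD hD.
- rewrite -hZ //; congr (h _); apply: prodR_eq => F'.
  rewrite [RHS]prodR_mulE !at_E; case: eqP => [->|_]; last by rewrite mulr0.
  have rC : ev r F = ((ev r F)`_0)%:P.
    apply/polyP => i; rewrite coefC; case: i => // i /=.
    apply/eqP; apply: contraT => /((proj1 (homog_polP _ _)) (r0 F) i.+1) //.
  rewrite [ev (r * x) F]prodR_mulE [r F]rC !mul_polyC.
  by apply/polyP => i; rewrite coefZ !coef_drop_poly coefZ.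
- exists [:: F] => x; rewrite [ev _ F]prodR_mulE coidemE inE eqxx mul0r raddf0.
  by rewrite at0 cof0.
- exists (m + k)%N => x; rewrite [ev _ F]prodR_mulE -[X in X * _]/(ev _ F) cvarX.
  rewrite -[RHS](hm (atp F (ev x F))); congr (h _); apply: prodR_eq => F'.
  rewrite prodR_mulE !at_E; case: eqP => [->|_]; last by rewrite mulr0.
  rewrite -[X in _ = X * _]/(ev _ F) cvarX exprD -mulrA [_ * x F]mulrC mulrA.
  by apply/polyP => i; rewrite coef_drop_poly coefMXn ltnNge leq_addl /= addnK.
Qed.

Lemma cofree_divisible : divisible cofree_emod.
Proof.
move=> F k h; exists (Cofree (drop_fun_subproof F k h)); apply: cofree_eq => x.
have e : ev (atp F 'X^k * x) F = ev x F * 'X^k.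
  by rewrite [LHS]prodR_mulE at_E eqxx mulrC.
rewrite !cof_scaleE -[LHS]/(h (atp F (drop_poly k (ev (atp F 'X^k * x) F)))) e.
rewrite idem_mul; congr (h (atp F _)).
by apply/polyP => i; rewrite coef_drop_poly coefMXn ltnNge leq_addl /= addnK.
Qed.

Context (Tt : torsion T).

Lemma cofree_incl_subproof (t : T) : (fun x : O => x *: t) \in cofree_pred.
Proof.
apply/asboolP; split=> [x y|r x _||]; first by rewrite scalerDl.
- by rewrite scalerA.
- have [s st] := Tt t; have [eps [feps sE]] := den_set s.
  have [A AE] := (finite_seqP _).1 feps; exists A => x.
  have -> : coid A * x = x * coid A * val s.
    apply: prodR_eq => F; rewrite !prodR_mulE coidemE sE.
    case: ifPn => FA; first by rewrite mulr0 !mul0r.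
    have -> : eps F = 0%N.
      apply/eqP; apply: contraT => /eqP eF; have : [set F | eps F <> 0%N] F by [].
      by rewrite AE /= (negbTE FA).
    by rewrite mul1r expr0 !mulr1.
  by rewrite -scalerA st scaler0.
- have [s st] := Tt t; have [eps [feps sE]] := den_set s.
  have [A AE] := (finite_seqP _).1 feps.
  (* With [k] the largest exponent in [s], the element [s] divides [c^k]. *)
  pose k := \max_(F <- A) eps F; have epsk F : (eps F <= k)%N.
    have [FA|FA] := boolP (F \in A); first exact: leq_bigmax_seq.
    have -> : eps F = 0%N => //.
    apply/eqP; apply: contraT => /eqP eF; have : [set F | eps F <> 0%N] F by [].
    by rewrite AE /= (negbTE FA).
  exists k => x; pose f F : {poly rat} := 'X^(k - eps F).
  have fb : f \in @bounded_family K (stalk X).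
    apply/asboolP; exists [seq - (j.*2)%:Z | j <- iota 0 k.+1] => F d dD.
    have := cvarX_homog (k - eps F) F; rewrite cvarX => /hcomp_homog ->.
    case: eqP => // dE; case/negP: dD; apply/mapP; exists (k - eps F)%N => //.
    by rewrite mem_iota add0n ltnS leq_subr.
  have -> : cvar ^+ k * x = x * (ProdR fb : O) * val s.
    apply: prodR_eq => F; rewrite !prodR_mulE sE -[X in X * _]/(ev _ F) cvarX /= /f.
    by rewrite -mulrA -exprD subnK // mulrC.
  by rewrite -scalerA st scaler0.
Qed.

Definition cofree_incl (t : T) : cofree_emod := Cofree (cofree_incl_subproof t).

Lemma cofree_incl_emhom : is_emhom cofree_incl.
Proof.
split=> [a t u|d t|F w t].
- apply: cofree_eq => x; rewrite cofree_addE cof_scaleE /= scalerDr scalerA.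
  by rewrite mulrC.
- apply: cofree_homog_eq => e x xe; rewrite (cofree_gradingE _ _ xe) /=.
  by rewrite (hcompZ (@em_graded _ _ _ T) _ _ xe) addrK.
- by apply: cofree_eq => x /=; rewrite em_actZ.
Qed.

Lemma cofree_incl_inj : injective cofree_incl.
Proof.
by move=> t u /(congr1 (fun h : cofree => h 1)) /=; rewrite !scale1r.
Qed.

End Cofree.

(** * Resolutions and dimension in Type 1 *)

Section Type1Final.
Context (K : choiceType) (W : compstr (type1 K)).
Context (hW : forall F, Whom W F <> None).
Local Notation X := (type1 K).
Local Notation O := (OK X).
Local Notation B := (SOK X).
Local Notation idm F := (idem F : O).
Local Notation vden s := (val (s : den (mset X)) : O).
Local Notation atX F k := (@at_ K (stalk X) F ('X^k : {poly rat}) : O).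

Lemma tame_type1 : tame W.
Proof.
split=> [s [eps [feps sE]]|s [eps [feps sE]]|F w r|F /hW //].
- have [A AE] := (finite_seqP _).1 feps; exists A => F FA; rewrite sE.
  have -> : eps F = 0%N; last by rewrite expr0.
  apply/eqP; apply: contraT => /eqP eF; have : [set F | eps F <> 0%N] F by [].
  by rewrite AE /= (negbTE FA).
- have [A AE] := (finite_seqP _).1 feps.
  exists (fun F => - ((eps F).*2)%:Z), (0 :: [seq - ((eps F).*2)%:Z | F <- A]) => F.
  split; last by rewrite sE; have := cvarX_homog (eps F) F; rewrite cvarX.
  rewrite inE; have [e|eF] := eqVneq (eps F) 0%N; first by rewrite e.
  apply/orP; right; apply/mapP; exists F => //.
  have : [set F | eps F <> 0%N] F by move=> /=; apply/eqP.
  by rewrite AE.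
- have fX : WF_act w ('X : {poly rat}) = 'X.
    have := @W_mset_inv _ _ W _ (cden_subproof F 1) F w.
    by rewrite prodR_addE coidemE at_E inE eqxx add0r expr1.
  have fZ := additive_rat (rmorphD (WF_act w)).
  move: r; apply: (@poly_ind rat (fun r : {poly rat} => WF_act w r = r)).
    exact: rmorph0.
  move=> p c IH; rewrite rmorphD rmorphM IH fX; congr (_ + _).
  by rewrite -alg_polyC fZ rmorph1.
Qed.

Let tm := tame_type1.

(** [S] contains the element equal to [c^k] at [F] and to 1 elsewhere, and it acts invertibly on
    [P]. *)
Lemma act_divisible_SOK (P : lmodType B) F k (p : resP P) :
  exists q : resP P, atX F k *: q = idm F *: p.
Proof.
exists (isok (cden F k) *: (p : P)).
rewrite !res_scaleE scalerA -(cden_idem F k) to_SOKM -mulrA -/(tsok (cden F k)).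
by rewrite tsokK mulr1.
Qed.

Section Resolution.
Context (Y : smobj W).

Definition tors_submod : submod (sN Y).
Proof.
apply: (@Submod _ _ (fun n => sNP n = 0)); first exact: sNP0.
by move=> a m n m0 n0; rewrite sNPD sNPZ m0 n0 scaler0 addr0.
Defined.

Lemma tors_gr d n : tors_submod n -> tors_submod (gN Y d n).
Proof. by move=> /= n0; rewrite sNP_deg n0 hcomp0. Qed.

Lemma tors_act F (w : WF W F) (n : sN Y) : tors_submod n -> tors_submod (actN w n).
Proof.
by move=> /= n0; rewrite (sNP_act tm) n0 (lin0 (pact_lin _)) scaler0.
Qed.

Definition tors_emod := sub_emod (N := emod_of tm Y) tors_gr tors_act.

Lemma tors_emod_torsion : torsion tors_emod.
Proof.
move=> n; have [s sn] := sNP_eq0 (submP n : sNP _ = 0).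
by exists s; apply: subm_eq.
Qed.

Let D := cofree_emod tors_emod.
Let Dt : torsion D := cofree_torsion (T := tors_emod).
Let Ddiv : divisible D := cofree_divisible (T := tors_emod).

Lemma tors_map : exists2 f : sN Y -> D, is_emhom (M := emod_of tm Y) f &
  forall n : tors_emod, f (submval n) = cofree_incl tors_emod_torsion n.
Proof.
have [cL cg ca] := cofree_incl_emhom tors_emod_torsion.
have vL : semilinear id (@submval _ _ tors_submod) by [].
have [||_ _ [n [-> ->]] F w|f fh fE] := torsion_extension hW Dt Ddiv
    (G0 := graph_along vL cL : submod (emod_of tm Y * D)%type).
- apply: graph_along_partial cg; first by move=> x y; apply: subm_eq.
  by move=> d x; rewrite sub_gradingE.
(* Torsion has image 0 in [P], so the empty sum represents it and no vector has to be covered. *)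
- move=> _ [n ->]; exists [::]; split=> //; rewrite big_nil; exact: (submP n).
- by exists (em_act w (n : tors_emod)); rewrite ca.
by exists f => // n; apply: fE; exists n.
Qed.

Definition res0 : smobj W := half_obj tm Y Dt.

(** The kernel of [N -> P] is the torsion, and on it the component in [D] is the embedding
    [cofree_incl]. *)
Lemma res_embedding : exists i : smhom Y res0, [/\ injective (hN i),
  forall v, hV i v = v & forall p, hP i p = p].
Proof.
have [f fh fE] := tors_map.
have idh : is_vhom (U := vrep_of Y) (V := vrep_of Y) id by [].
have [i [i2 iV]] := half_hom (Y := Y) Dt fh idh.
have iP p : hP i p = p.
  apply: (linear_eq_spanned (@sVP_spanned _ _ _ Y) (homP_lin i) (k := id)) => // v.
  by rewrite hom_VP iV.
exists i; split=> // m n mn; apply/eqP; rewrite -subr_eq0; apply/eqP.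
have [fL _ _] := fh; have fD := linD fL.
have mn0 : hN i (m - n) = 0 by rewrite (homNB tm) mn subrr.
have t0 : tors_submod (m - n).
  by have := hom_NP i (m - n); rewrite iP mn0 sNP0.
have := fE (sub_in t0); rewrite /= -i2 mn0 => /esym.
have [cL _ _] := cofree_incl_emhom tors_emod_torsion.
have c0 : cofree_incl tors_emod_torsion 0 = 0 := lin0 cL.
rewrite -[X in _ = X -> _]c0 => /cofree_incl_inj /(congr1 (@submval _ _ _)).
exact.
Qed.

Lemma injdim1_type1 : injdim_le (C := standard_model W) 1 Y.
Proof.
have [i [iN iV iP]] := res_embedding; have ih := hom_em tm i.
pose R := range_submod ih.
pose J := quot_emod (@range_gr _ _ _ _ _ _ ih) (@range_act _ _ _ _ _ _ ih).
have im1 n : (hN i n : half_mod Y D).1 = sNP n.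
  by have := hom_NP i n; rewrite iP => ->.
(* A denominator [s] makes [s p] the image of some [n]; subtracting the image of [n] leaves an
   element of [D], which is torsion. *)
have Jt : torsion J.
  move=> x; have [[p d] ->] := qproj_surj x.
  have [n [s pn]] := sNP_surj (p : sP Y).
  have [t td] := Dt (vden s *: d - (hN i n : half_mod Y D).2).
  exists (denM t s); rewrite -qprojZ; apply/qproj_eq0; exists (vden t *: n).
  rewrite (homNZ tm i) val_denM -scalerA; apply/eqP.
  rewrite -subr_eq0 -scalerBr; apply/eqP.
  have -> : vden s *: ((p, d) : half_mod Y D) - (hN i n : half_mod Y D) =
      (0, vden s *: d - (hN i n : half_mod Y D).2).
    have -> : (hN i n : half_mod Y D) = (sNP n : resP (sP Y), (hN i n : half_mod Y D).2).
      by rewrite -im1 -surjective_pairing.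
    by congr pair; rewrite /= -pn; apply: subrr.
  by congr pair; first exact: scaler0.
(* Divisibility passes to quotients, and both [P] and [D] are divisible. *)
have Jdiv : divisible J.
  move=> F k x; have [[p d] ->] := qproj_surj x.
  have [q qE] := act_divisible_SOK F k p; have [e eE] := Ddiv F k d.
  exists (qproj R ((q, e) : half_mod Y D)); rewrite -!qprojZ; congr qproj.
  exact: (f_equal2 pair qE eE).
have q_eh : is_emhom (M := emod_of tm res0) (qproj R : sN res0 -> J).
  exact: qproj_emhom.
have zh : is_vhom (U := vrep_of res0) (V := vrep_of (zero_obj tm)) (fun=> 0).
  by split=> [q u v|d v|w v]; exact (@zero_objV _ _ _ tm _ _).
have [p [p2 pV]] := half_hom Jt q_eh zh.
have p1 n : (hN p n : half_mod (zero_obj tm) J).1 = 0 by exact (@zero_objP _ _ _ tm _ _).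
exists res0, (tors_obj tm Jt), i, p; split.
- exact: half_injective (divisible_extension hW Dt Ddiv).
- apply: (short_exact_crit tm) => //.
  + by move=> u v; rewrite !iV.
  + move=> n; rewrite [LHS]surjective_pairing p1 p2; congr pair.
    by apply/qproj_eq0; exists n.
  + move=> n pn0; have /qproj_eq0 : qproj R n = 0 by rewrite -p2 pn0.
    by case=> m ->; exists m.
  + by move=> v _; exists v.
  + move=> [z x]; have [n ->] := qproj_surj x; exists n.
    rewrite [RHS]surjective_pairing p1 p2; congr pair; exact (@zero_objP _ _ _ tm _ _).
  + by move=> v; exists 0; exact (@zero_objV _ _ _ tm _ _).
- exact: half_injective (divisible_extension hW Jt Jdiv).
Qed.

End Resolution.

(* [Q[c]/(c)] concentrated at [F0] is not divisible. *)
Section NonInjective.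
Context (F0 : K).
Local Notation cf a := ((((a : O) : prodR K (stalk X)) F0 : {poly rat})`_0).

Definition residue_submod : submod (unit_emod W).
Proof.
apply: (@Submod _ (unit_emod W : lmodType O) (fun a : O => cf a = 0)); first exact: coef0.
move=> a x y x0 y0; rewrite [(a *: x + y) F0](_ : _ = a F0 * x F0 + y F0) //.
by rewrite coefD y0 addr0 coef0M x0 mulr0.
Defined.

Lemma residue_gr d (a : unit_emod W) :
  residue_submod a -> residue_submod (em_gr (unit_emod W) d a).
Proof. by move=> /= a0; rewrite prod_gradingE /= coef_hcomp_pol a0 if_same. Qed.

Lemma residue_act F (w : WF W F) (a : unit_emod W) :
  residue_submod a -> residue_submod (em_act w a).
Proof.
move=> a0; change (cf (idm F * (a : O)) = 0); rewrite prodR_mulE idemE.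
by case: ifP => _; rewrite ?mul0r ?mul1r ?coef0.
Qed.

Definition residue_emod := quot_emod residue_gr residue_act.

Lemma residue_kill (x : residue_emod) : atX F0 1 *: x = 0.
Proof.
have [a ->] := qproj_surj x; rewrite -qprojZ; apply/qproj_eq0.
change (cf (atX F0 1 * (a : O)) = 0).
by rewrite prodR_mulE at_E eqxx expr1 mulrC coefMX.
Qed.

Lemma residue_torsion : torsion residue_emod.
Proof.
move=> x; have [a ->] := qproj_surj x; exists (cden F0 1).
rewrite -qprojZ; apply/qproj_eq0.
change (cf (vden (cden F0 1) * (a : O)) = 0); rewrite prodR_mulE.
rewrite val_mkden prodR_addE coidemE at_E inE eqxx add0r expr1 mulrC.
by rewrite coefMX.
Qed.

(** In the divisible module the image of the class of 1 has the form [c d] at [F0]. A retraction of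
    the embedding would make this non-zero class [c] times an element of a module killed by [c]. *)
Lemma noninjective_type1 :
  ~ forall Y : standard_model W, injdim_le (C := standard_model W) 0 Y.
Proof.
move=> inj; pose T := tors_obj tm residue_torsion.
pose Ct := cofree_torsion (T := residue_emod); pose I := tors_obj tm Ct.
have ch := cofree_incl_emhom residue_torsion.
have th : is_emhom (M := emod_of tm T)
    (fun n : sN T => cofree_incl residue_torsion (n : half_mod _ _).2).
  apply: comp_emhom ch _; exact: half_hom2 (smid T).
have zh : is_vhom (U := vrep_of T) (V := vrep_of (zero_obj tm)) id by [].
have [i [i2 iV]] := half_hom Ct th zh.
have mi : mono (C := standard_model W) i.
  apply: mono_of_injective => [[z x] [z' x'] e|u v _]; last exact (@zero_objV _ _ _ tm _ _).
  congr pair; first exact (@zero_objP _ _ _ tm _ _).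
  have := congr1 (fun n : sN I => (n : half_mod _ _).2) e; rewrite !i2.
  exact: cofree_incl_inj.
have [r rE] := inj T _ _ i (smid T) mi.
pose t : residue_emod := qproj residue_submod (1 : O).
have [d dE] := cofree_divisible F0 1 (cofree_incl residue_torsion t).
have e1 : atX F0 1 *: ((0, d) : half_mod (zero_obj tm) _) =
    idm F0 *: hN i ((0, t) : half_mod (zero_obj tm) _).
  rewrite [hN i _]surjective_pairing i2.
  by congr pair => //; exact (@zero_objP _ _ _ tm _ _).
have rr n : hN r (hN i n) = n := congr1 (fun h : smhom T T => hN h n) rE.
have : (hN r (atX F0 1 *: ((0, d) : half_mod (zero_obj tm) _)) : half_mod _ _).2
    = 0 by rewrite (homNZ tm r); apply: residue_kill.
rewrite e1 (homNZ tm r) rr -[LHS]/(idm F0 *: t) -qprojZ => /qproj_eq0.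
change (cf (idm F0 * (1 : O)) = 0 -> False); rewrite prodR_mulE idemE eqxx mul1r coef1.
by move/eqP; rewrite oner_eq0.
Qed.

End NonInjective.

Lemma has_injdim_type1 : inhabited K -> has_injdim (standard_model W) 1.
Proof.
case=> F0; split=> [Y|m]; first exact: injdim1_type1.
by case: m => // /(noninjective_type1 F0).
Qed.

End Type1Final.

(** * Type 0 *)

Section TensorModule.
Context (k B : comPzRingType) (f : k -> B) (V : lmodType k).

(** [tensor] is only a set; a module structure is needed here, where [P] is constructed from [V]. *)
Definition tens : Type := tensor f V.
HB.instance Definition _ := Choice.on tens.

Definition tpi (r : seq (B * V)) : tens := \pi_(tensor f V) r.

Lemma tpiP r t : tpi r = tpi t <-> tens_eq f r t.
Proof.
split=> [/eqmodP/asboolP //|rt]; by apply/eqmodP/asboolP.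
Qed.

Lemma tpi_surj x : exists r, x = tpi r.
Proof. by exists (generic_quotient.repr x); rewrite /tpi reprK. Qed.

Definition tadd (x y : tens) : tens :=
  tpi (generic_quotient.repr x ++ generic_quotient.repr y).

Definition smul (b : B) (r : seq (B * V)) := [seq (b * z.1, z.2) | z <- r].

Definition tscale (b : B) (x : tens) : tens := tpi (smul b (generic_quotient.repr x)).

Lemma tadd_pi r t : tadd (tpi r) (tpi t) = tpi (r ++ t).
Proof. by apply/tpiP; apply: tens_cat; apply/tpiP; apply: reprK. Qed.

Lemma smul_eq b r t : tens_eq f r t -> tens_eq f (smul b r) (smul b t).
Proof.
elim=> {r t}.
- by move=> x; apply: tens_refl.
- by move=> x y _ IH; apply: tens_sym.
- by move=> x y z _ IH _; apply: tens_trans IH.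
- by move=> x x' y y' _ IH _ IH'; rewrite /smul !map_cat; apply: tens_cat.
- by move=> x y; rewrite /smul !map_cat; apply: tens_swap.
- by move=> c c' v /=; rewrite mulrDr; apply: tens_addl.
- by move=> c u v; apply: tens_addr.
- by move=> c q v /=; rewrite mulrA; apply: tens_scale.
- by move=> v /=; rewrite mulr0; apply: tens_zero.
Qed.

Lemma tscale_pi b r : tscale b (tpi r) = tpi (smul b r).
Proof. by apply/tpiP; apply: smul_eq; apply/tpiP; apply: reprK. Qed.

Lemma taddA : associative tadd.
Proof.
move=> x y z; have [r ->] := tpi_surj x; have [s ->] := tpi_surj y.
by have [t ->] := tpi_surj z; rewrite !tadd_pi catA.
Qed.

Lemma taddC : commutative tadd.
Proof.
move=> x y; have [r ->] := tpi_surj x; have [s ->] := tpi_surj y.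
by rewrite !tadd_pi; apply/tpiP; apply: tens_swap.
Qed.

Lemma tadd0 : left_id (tpi [::]) tadd.
Proof. by move=> x; have [r ->] := tpi_surj x; rewrite tadd_pi. Qed.

Lemma tadd_cons z r : tpi (z :: r) = tadd (tpi [:: z]) (tpi r).
Proof. by rewrite tadd_pi. Qed.

Lemma tscaleDl_subproof a b x : tscale (a + b) x = tadd (tscale a x) (tscale b x).
Proof.
have [r ->] := tpi_surj x; rewrite !tscale_pi.
elim: r => [|z r IH]; first by rewrite tadd_pi.
rewrite /= (tadd_cons _ (smul (a + b) r)) (tadd_cons _ (smul a r)).
rewrite (tadd_cons _ (smul b r)) IH.
rewrite -!taddA; transitivity (tadd (tadd (tpi [:: (a * z.1, z.2)]) (tpi [:: (b * z.1, z.2)]))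
  (tadd (tpi (smul a r)) (tpi (smul b r)))).
  by congr tadd; rewrite tadd_pi; apply/tpiP; rewrite mulrDl; apply: tens_addl.
by rewrite -!taddA; congr tadd; rewrite !taddA; congr tadd; apply: taddC.
Qed.

Lemma tscale0_subproof x : tscale 0 x = tpi [::].
Proof.
have [r ->] := tpi_surj x; rewrite tscale_pi.
elim: r => [//|z r IH]; rewrite /= (tadd_cons _ (smul 0 r)) IH tadd_pi.
by apply/tpiP; rewrite mul0r; apply: tens_zero.
Qed.

Lemma tscale1 : left_id 1 tscale.
Proof.
move=> x; have [r ->] := tpi_surj x; rewrite tscale_pi; congr tpi.
by rewrite -[RHS]map_id; apply: eq_map => -[b v]; rewrite mul1r.
Qed.

Lemma taddN : left_inverse (tpi [::]) (tscale (-1)) tadd.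
Proof.
by move=> x; rewrite -{2}[x]tscale1 -tscaleDl_subproof addNr tscale0_subproof.
Qed.

HB.instance Definition _ := GRing.isZmodule.Build tens taddA taddC tadd0 taddN.

Lemma tscaleA a b x : tscale a (tscale b x) = tscale (a * b) x.
Proof.
have [r ->] := tpi_surj x; rewrite !tscale_pi; congr tpi.
by rewrite /smul -map_comp; apply: eq_map => z /=; rewrite mulrA.
Qed.

Lemma tscaleDr : right_distributive tscale +%R.
Proof.
move=> a x y; have [r ->] := tpi_surj x; have [t ->] := tpi_surj y.
by rewrite -![_ + _]/(tadd _ _) tadd_pi !tscale_pi tadd_pi /smul map_cat.
Qed.

Lemma tscaleDl x : {morph tscale^~ x : a b / a + b}.
Proof. by move=> a b; apply: tscaleDl_subproof. Qed.

HB.instance Definition _ := GRing.Zmodule_isLmodule.Build B tens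
  tscaleA tscale1 tscaleDr tscaleDl.

Definition tmk (v : V) : tens := tpi [:: (1, v)].

Lemma tmk_lin : semilinear f tmk.
Proof.
move=> q u v; rewrite -[RHS]/(tadd (tscale (f q) (tmk u)) (tmk v)).
rewrite tscale_pi tadd_pi; apply/tpiP.
apply: tens_trans (tens_addr _ _ _ _) _ => /=.
rewrite mulr1 -[f q]mul1r -[_ :: _](cat1s (1, q *: u)) -[_ :: [:: (1, v)]]cat1s.
by apply: tens_cat; [apply/tens_sym/tens_scale|apply: tens_refl].
Qed.

Lemma tpiE r : tpi r = \sum_(z <- r) z.1 *: tmk z.2.
Proof.
elim: r => [|[b v] r IH]; first by rewrite big_nil.
rewrite big_cons (tadd_cons _ r) IH -[RHS]/(tadd _ _); congr tadd.
by rewrite -[RHS]/(tscale _ _) tscale_pi /= mulr1.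
Qed.

End TensorModule.

(** * Scalars, families and germs in Type 0 *)

Section Type0.
Context (K : choiceType) (W : compstr (type0 K)).
Local Notation X := (type0 K).
Local Notation O := (OK X).
Local Notation B := (SOK X).
Local Notation idm F := (idem F : O).
Local Notation coid A := (coidem (stalk X) A : O).
Local Notation vden s := (val (s : den (mset X)) : O).
Local Notation prh := (prod_homog (K := K) (R := stalk X)).

Lemma den_idem (s : den (mset X)) : vden s * vden s = vden s.
Proof.
have [s01 _] := den_set s; apply: prodR_eq => F; rewrite prodR_mulE.
by case: (s01 F) => ->; rewrite ?mulr0 ?mulr1.
Qed.

Lemma coid_subproof A : mulset_set (mset X) (coid A).
Proof.
split=> [F|]; first by rewrite coidemE; case: ifP; [left|right].
apply: (@sub_finite_set _ _ [set` A]); last exact: finite_seq.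
by move=> F /=; case: ifP.
Qed.

Definition coden A : den (mset X) := mkden (coid_subproof A).

(** An invertible idempotent is 1. *)
Lemma tsok_type0 s : tsok s = 1 :> B.
Proof.
have e : tsok s * tsok s = tsok s by rewrite -to_SOKM den_idem.
by rewrite -[LHS]mul1r -(isokK s) -mulrA e.
Qed.

Lemma SOK_type0 (x : B) : exists a, x = to_SOK a.
Proof.
have [a [s ->]] := SOK_frac x; exists a.
by rewrite -[isok s]mul1r -(tsok_type0 s) tsokK mul1r.
Qed.

Lemma to_SOK_coid A : to_SOK (coid A) = 1.
Proof. exact: (tsok_type0 (coden A)). Qed.

Lemma to_SOK_idem F : to_SOK (idm F) = 0.
Proof.
rewrite -[LHS]mul1r -(to_SOK_coid [:: F]) -to_SOKM coidem_idem inE eqxx.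
exact: to_SOK0.
Qed.

Lemma tame_type0 : tame W.
Proof.
split=> [s [s01 fs]|s _|F w r|F _]; last exact: to_SOK_idem.
- have [A AE] := (finite_seqP _).1 fs; exists A => F FA.
  apply: contrapT => s1; have : [set F | s F <> 1] F by [].
  by rewrite AE /= (negbTE FA).
- by exists (fun=> 0), [:: 0] => F; rewrite inE eqxx.
- have fZ := additive_rat (rmorphD (WF_act w)).
  have := fZ r 1; rewrite rmorph1.
  by rewrite -[r *: 1]/((r : rat) * (1 : rat)) mulr1.
Qed.

Let tm := tame_type0.

Lemma prod_homog_type0 (a : O) : prh 0 a.
Proof. by []. Qed.

(** Off a finite set [s(F) = 1] forces [e(F) = 0], so [a(F)] has degree [d] there and vanishes for
    non-zero [d]. The remaining coordinates die in [S^{-1}O]. *)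
Lemma loc_homog_type0 d (x : B) : loc_homog d x -> d = 0 \/ x = 0.
Proof.
move=> [a [s [e [-> eh ah]]]]; have [->|d0] := eqVneq d 0; [by left|right].
have [A AE] := tame_one tm (den_set s).
rewrite rfracE -[to_SOK a]mul1r -(to_SOK_coid A) -to_SOKM.
rewrite (_ : coid A * a = 0) ?to_SOK0 ?mulr0 //.
apply: prodR_eq => F; rewrite prodR_mulE coidemE.
case: ifPn => FA; first by rewrite mul0r.
rewrite mul1r; have := eh F; rewrite AE // => e1.
have e0 : e F = 0.
  apply/eqP; apply: contraT => eF; move: e1.
  rewrite /homog /= /hcomp_triv (negbTE eF) => /esym/eqP.
  by rewrite oner_eq0.
have := ah F; rewrite e0 addr0 /homog /= /hcomp_triv (negbTE d0) => <- //.
Qed.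

Lemma lifts_type0 (Y : smobj W) (v : sV Y) n : lifts v n -> sNP n = sVP v.
Proof. by move=> [A]; rewrite !res_scaleE to_SOK_coid !scale1r. Qed.

Lemma sNP_surj0 (Y : smobj W) (p : sP Y) : exists n, p = sNP n.
Proof. by have [n [s]] := sNP_surj p; rewrite tsok_type0 scale1r; exists n. Qed.

Lemma sNP_act0 (Y : smobj W) F (w : WF W F) (n : sN Y) : sNP (actN w n) = 0.
Proof. by rewrite (sNP_act tm) to_SOK_idem scale0r. Qed.

Lemma lifts_hcomp (Y : smobj W) d (v : sV Y) n :
  lifts v n -> lifts (gV Y d v) (gN Y d n).
Proof.
by move=> /lifts_type0 nv; exists [::]; rewrite sNP_deg sVP_deg nv.
Qed.

Section Families.
Context (N : emod W).

Definition fam_set (m : K -> N) := (forall F, idm F *: m F = m F) /\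
  exists D : seq int, forall d, d \notin D -> forall F, em_gr N d (m F) = 0.

Lemma fam0 : fam_set 0.
Proof.
split=> [F|]; first exact: scaler0.
by exists [::] => d _ F; apply: hcomp0.
Qed.

Lemma famZD (a : O) m n : fam_set m -> fam_set n -> fam_set (a *: m + n).
Proof.
move=> [em [D DP]] [en [E EP]]; split=> [F|].
  rewrite -[(a *: m + n) F]/(a *: m F + n F) scalerDr en.
  by rewrite scalerA mulrC -scalerA em.
exists (D ++ E) => d; rewrite mem_cat negb_or => /andP[/DP Dm /EP En] F.
rewrite -[(a *: m + n) F]/(a *: m F + n F) hcompD En em_hcomp0 //.
by rewrite Dm scaler0 addr0.
Qed.

Definition fam_submod : submod (K -> N) := Submod fam0 famZD.

(* The product of the [e_F N], formed degreewise. *)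
Definition fam : lmodType O := subm fam_submod.

Definition at_fam (m : fam) (F : K) : N := submval m F.

Definition mkfam m (mS : fam_set m) : fam := sub_in (mS : fam_submod m).

Lemma mkfamE m (mS : fam_set m) F : at_fam (mkfam mS) F = m F.
Proof. by []. Qed.

Lemma fam_eq (m n : fam) : (forall F, at_fam m F = at_fam n F) -> m = n.
Proof. by move=> mn; apply: subm_eq; apply/funext. Qed.

Lemma at_famD (m n : fam) F : at_fam (m + n) F = at_fam m F + at_fam n F.
Proof. by []. Qed.
Lemma at_famZ (a : O) (m : fam) F : at_fam (a *: m) F = a *: at_fam m F.
Proof. by []. Qed.
Lemma at_fam0 F : at_fam 0 F = 0.
Proof. by []. Qed.

Lemma at_fam_idem (m : fam) F : idm F *: at_fam m F = at_fam m F.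
Proof. by case: (submP m) => + _; apply. Qed.

Lemma at_fam_idem_neq (m : fam) F F' : F' != F -> idm F' *: at_fam m F = 0.
Proof. by move=> FF'; rewrite -at_fam_idem scalerA idem_neq // scale0r. Qed.

Lemma at_fam_coid (m : fam) A F :
  coid A *: at_fam m F = if F \in A then 0 else at_fam m F.
Proof.
rewrite -at_fam_idem scalerA coidem_idem.
by case: ifP; rewrite ?scale0r.
Qed.

Lemma fam_bound (m : fam) :
  exists D : seq int, forall d, d \notin D -> forall F, em_gr N d (at_fam m F) = 0.
Proof. by case: (submP m). Qed.

Lemma fam_hcomp_subproof d (m : fam) : fam_set (fun F => em_gr N d (at_fam m F)).
Proof.
split=> [F|].
  by rewrite -em_hcomp0 ?at_fam_idem //.
have [D DP] := fam_bound m; exists D => e eD F; rewrite hcompK.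
by case: eqP => // <-; apply: DP.
Qed.

Definition fam_hcomp d m : fam := mkfam (fam_hcomp_subproof d m).

Lemma fam_grading_subproof : exists g : grading fam, hcomp g = fam_hcomp.
Proof.
apply: grading_of_fin => [d m n|d e m|m m0|m].
- by apply: fam_eq => F; rewrite at_famD !mkfamE at_famD hcompD.
- apply: fam_eq => F; rewrite !mkfamE hcompK.
  by case: eqP => // _; rewrite mkfamE.
- apply: fam_eq => F; apply: (hcomp_inj (g := em_gr N)) => d.
  by rewrite at_fam0 hcomp0 -(at_fam0 F) -(m0 d) mkfamE.
- have [D DP] := fam_bound m; exists D => d dD.
  by apply: fam_eq => F; rewrite mkfamE DP.
Qed.

Definition fam_grading := sval (cid fam_grading_subproof).

Lemma fam_gradingE d m F : at_fam (fam_grading d m) F = em_gr N d (at_fam m F).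
Proof.
by rewrite /fam_grading (svalP (cid fam_grading_subproof)) mkfamE.
Qed.

Definition single_fun F (n : N) : K -> N := fun F' => if F' == F then idm F *: n else 0.

Lemma single_subproof F n : fam_set (single_fun F n).
Proof.
split=> [F'|].
  rewrite /single_fun; case: eqP => [->|_]; last exact: scaler0.
  by rewrite scalerA idem_idem.
have [D DP] := hcomp_fin (em_gr N) n; exists D => d dD F'.
rewrite /single_fun; case: ifP => _; last exact: hcomp0.
by rewrite em_hcomp0 // DP // scaler0.
Qed.

Definition single F n : fam := mkfam (single_subproof F n).

Lemma singleE F n F' : at_fam (single F n) F' = if F' == F then idm F *: n else 0.
Proof. by []. Qed.

Definition fam_emod : emod W.
Proof.
apply: (@Emod _ _ _ fam fam_grading _
  (fun F (w : WF W F) m => single F (em_act w (at_fam m F)))).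
- move=> d e a m ad me; apply: fam_eq => F; rewrite fam_gradingE !at_famZ.
  by apply: em_graded => //; rewrite /homog -fam_gradingE me.
- move=> F m; apply: fam_eq => F'; rewrite singleE at_famZ em_act1.
  have [->|F'F] := eqVneq F' F; first by rewrite !at_fam_idem.
  by rewrite at_fam_idem_neq // eq_sym.
- move=> F g h m; apply: fam_eq => F'; rewrite !singleE eqxx.
  by case: ifP => // _; rewrite !em_act_idem em_actM.
- move=> F g a m n; apply: fam_eq => F'.
  transitivity (a *: at_fam (single F (em_act g (at_fam m F))) F' +
      at_fam (single F (em_act g (at_fam n F))) F') => //.
  rewrite !singleE !em_act_idem; case: ifP => _; first exact: em_act_lin.
  by rewrite scaler0 addr0.
- move=> F g d m; apply: fam_eq => F'; rewrite singleE !fam_gradingE singleE.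
  case: ifP => _; last by rewrite hcomp0.
  by rewrite em_act_gr em_hcomp0.
Defined.

Lemma fam_actE F (w : WF W F) (m : fam_emod) F' :
  at_fam (em_act w m) F' = if F' == F then em_act w (at_fam m F) else 0.
Proof. by rewrite singleE em_act_idem. Qed.

Lemma fam_separated : separated fam_emod.
Proof.
move=> m m0; apply: fam_eq => F.
by rewrite -at_fam_idem -at_famZ m0.
Qed.

Definition fin_set (m : fam) := exists A, coid A *: m = 0.

Lemma fin0 : fin_set 0. Proof. by exists [::]; rewrite scaler0. Qed.

Lemma finZD (a : O) m n : fin_set m -> fin_set n -> fin_set (a *: m + n).
Proof.
move=> [A mA] [A' nA']; exists (A ++ A').
rewrite scalerDr scalerA [_ * a]mulrC -scalerA.
have -> : coid (A ++ A') *: m = 0.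
  by rewrite -coidemM mulrC -scalerA mA scaler0.
by rewrite -coidemM -scalerA nA' !scaler0 addr0.
Qed.

Definition fin_submod : submod fam := Submod fin0 finZD.

Lemma fin_gr d (m : fam_emod) : fin_submod m -> fin_submod (em_gr fam_emod d m).
Proof.
move=> [A mA]; exists A.
transitivity (em_gr fam_emod d (coid A *: (m : fam_emod))).
  by rewrite em_hcomp0.
by have -> : coid A *: (m : fam_emod) = 0 := mA; rewrite hcomp0.
Qed.

(* The localization of [fam]: the elements of [S] already act on these germs at
   infinity as the identity. *)
Definition germs : Type := quotmod fin_submod.
HB.instance Definition _ := GRing.Zmodule.on germs.

Definition germ (m : fam) : germs := qproj fin_submod m.

Lemma germ_surj x : exists m, x = germ m.
Proof. exact: qproj_surj. Qed.

Lemma germD m n : germ (m + n) = germ m + germ n.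
Proof. exact: qprojD. Qed.

Lemma germP m n : germ m = germ n <-> germ_eq m n.
Proof.
split=> [/qprojP[A]|[A mn]].
  rewrite scalerBr => /eqP; rewrite subr_eq0 => /eqP mn; by exists A.
by apply/qprojP; exists A; rewrite scalerBr mn subrr.
Qed.

Lemma germ_single F n : germ (single F n) = 0.
Proof.
rewrite -[RHS](_ : germ 0 = 0); last by apply/qproj_eq0; apply: fin0.
apply/germP; exists [:: F]; rewrite scaler0; apply: fam_eq => F'.
by rewrite at_famZ at_fam_coid inE singleE; case: eqP.
Qed.

(** Scalars are lifted to [O] by choice. Two lifts agree after multiplication by an element of [S],
    which acts on germs as the identity. *)
Definition germ_scale (x : B) (g : germs) : germs :=
  (sval (cid (SOK_type0 x)) *: (g : quotmod fin_submod)).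

Lemma germ_scaleE a m : germ_scale (to_SOK a) (germ m) = germ (a *: m).
Proof.
rewrite /germ_scale; move: (svalP (cid (SOK_type0 (to_SOK a)))).
move: (sval _) => b /esym /rfracP[u]; rewrite !val_denE !mul1r => ub.
rewrite -[LHS]qprojZ; apply/germP.
apply: germ_trans (germ_sym (germ_den tm u (b *: m))) _.
rewrite scalerA ub -scalerA; exact: (germ_den tm u).
Qed.

Lemma germ_scaleA x y g : germ_scale x (germ_scale y g) = germ_scale (x * y) g.
Proof.
have [a ->] := SOK_type0 x; have [b ->] := SOK_type0 y; have [m ->] := germ_surj g.
by rewrite -to_SOKM !germ_scaleE scalerA.
Qed.

Lemma germ_scale1 : left_id 1 germ_scale.
Proof.
by move=> g; have [m ->] := germ_surj g; rewrite -to_SOK1 germ_scaleE scale1r.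
Qed.

Lemma germ_scaleDr : right_distributive germ_scale +%R.
Proof.
move=> x g h; have [a ->] := SOK_type0 x; have [m ->] := germ_surj g.
have [n ->] := germ_surj h.
by rewrite -germD !germ_scaleE scalerDr germD.
Qed.

Lemma germ_scaleDl g : {morph germ_scale^~ g : x y / x + y}.
Proof.
move=> x y /=; have [a ->] := SOK_type0 x; have [b ->] := SOK_type0 y.
have [m ->] := germ_surj g.
by rewrite -to_SOKD !germ_scaleE scalerDl germD.
Qed.

HB.instance Definition _ := GRing.Zmodule_isLmodule.Build B germs
  germ_scaleA germ_scale1 germ_scaleDr germ_scaleDl.

Lemma germZ a m : germ (a *: m) = to_SOK a *: germ m.
Proof. exact/esym/germ_scaleE. Qed.

End Families.
End Type0.

Section TensorIso.
Context (K : choiceType) (X : sheaf K) (V : lmodType rat).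
Local Notation B := (SOK X).

Definition tensV : lmodType B := tens (@unitSOK K X) V.
Definition tmkV (v : V) : tensV := tmk (@unitSOK K X) v.

Lemma tmkV_lin : semilinear (@unitSOK K X) tmkV.
Proof. exact: tmk_lin. Qed.

Lemma tmkV_iso : bijective (@ind_tens K X tensV V tmkV).
Proof.
exists id => x; have [r ->] := tpi_surj x; rewrite -?[LHS]/(ind_tens _ (tpi _ r)).
  by rewrite [LHS](ind_tens_pi tmkV_lin) tpiE.
by rewrite [LHS](ind_tens_pi tmkV_lin) tpiE.
Qed.

Lemma tmkV_spanned : spanned tmkV.
Proof. exact: (tens_spanned tmkV_lin tmkV_iso). Qed.

Section Lift.
Context (Q : lmodType B) (h : V -> Q) (hL : semilinear (@unitSOK K X) h).

Definition tlift : tensV -> Q := sval (cid (tens_univ tmkV_lin tmkV_iso hL)).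

Lemma tlift_lin : semilinear id tlift.
Proof. by rewrite /tlift; case: (svalP (cid (tens_univ tmkV_lin tmkV_iso hL))). Qed.

Lemma tliftE v : tlift (tmkV v) = h v.
Proof. by rewrite /tlift; case: (svalP (cid (tens_univ tmkV_lin tmkV_iso hL))). Qed.

End Lift.
End TensorIso.

(** * Maps into products of the [e_F N], and the coinduced representation *)

Section Godement.
Context (K : choiceType) (W : compstr (type0 K)).
Local Notation X := (type0 K).
Local Notation O := (OK X).
Local Notation idm F := (idem F : O).
Local Notation ev a F := (((a : O) : prodR K (stalk X)) F : rat).
Local Notation tm := (tame_type0 W).

Section Extension.
Context (N L M : emod W) (i : L -> M) (f : L -> fam_emod N).
Context (ih : is_emhom i) (fh : is_emhom f) (inj_i : injective i).

(** The value at [y] is chosen one coordinate at a time, because [O] acts at [F] through the field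
    Q: if [a *: y] is in the domain and [a(F)] is non-zero, then [e_F y] is in the domain and its
    value is forced. All coordinates have degree [e], so they form a family, and Zorn's lemma is
    applied without a side condition. *)
Lemma fam_linear_extension : exists g : M -> fam_emod N,
  [/\ semilinear id g, forall d n, g (em_gr M d n) = em_gr (fam_emod N) d (g n)
    & forall n, g (i n) = f n].
Proof.
have [iL ig _] := ih; have [fL fg _] := fh.
have gA_M : graded_mod (homog (prod_grading K (stalk X))) (em_gr M).
  by move=> d e a n /prod_homogP ad; apply: em_graded.
have gA_F : graded_mod (homog (prod_grading K (stalk X))) (em_gr (fam_emod N)).
  by move=> d e a n /prod_homogP ad; apply: em_graded.
have [||G [G0G pG _ Gmax]] := maximal_partial_map gA_M gA_F (Q := fun=> True) _
  (graph_along_partial iL fL inj_i ig fg) => //.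
have [e y ey|g [gL gg gE]] := partial_map_total pG; last first.
  by exists g; split=> // n; apply/esym/gE/G0G; exists n.
have pick F : exists t : fam N, homog (em_gr (fam_emod N)) e t /\
    ((exists t', G (idm F *: y, t')) -> G (idm F *: y, t)).
  have [[t Gt]|nt] := pselect (exists t', G (idm F *: y, t')).
    exists (em_gr (fam_emod N) e t); split; first exact: homog_hcomp.
    move=> _; have := proj1 pG e _ Gt; rewrite /= em_hcomp0 ?ey //.
  by exists 0; split=> //; apply: homog0.
have [tf tfP] := choice pick.
have tfe F : em_gr N e (at_fam (tf F) F) = at_fam (tf F) F.
  have te : fam_grading N e (tf F) = tf F := proj1 (tfP F).
  by rewrite -fam_gradingE te.
have tS : fam_set (fun F => at_fam (tf F) F).
  split=> [F|]; first exact: at_fam_idem.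
  exists [:: e] => d; rewrite inE => de F.
  by rewrite (hcomp_homog _ (tfe F)) (negbTE de).
exists (mkfam tS); apply: (Gmax e) => //.
  by apply: fam_eq => F; rewrite fam_gradingE mkfamE tfe.
move=> a x Gx; apply: fam_eq => F; rewrite at_famZ mkfamE.
have GF : G ((@at_ K (stalk X) F (ev a F) : O) *: y, idm F *: (x : fam_emod N)).
  have := submodZ (idm F) Gx.
  by rewrite pairZZ idem_mul.
rewrite -[LHS]at_fam_idem -(at_famZ (idm F)).
have aF (n : N) : a *: (idm F *: n) = (@at_ K (stalk X) F (ev a F) : O) *: n.
  by rewrite scalerA mulrC idem_mul.
rewrite -[at_fam (tf F) F]at_fam_idem aF.
have [a0|a0] := eqVneq (ev a F) 0.
  have z : @at_ K (stalk X) F (ev a F) = 0 :> O.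
    by apply: prodR_eq => F'; rewrite at_E a0 if_same.
  rewrite z scale0r; rewrite z scale0r in GF.
  exact: (congr1 (fun t => at_fam t F) (proj2 pG _ GF)).
have unit_at : (@at_ K (stalk X) F (ev a F) : O) * const (ev a F)^-1 = idm F.
  apply: prodR_eq => F'; rewrite prodR_mulE !at_E; case: ifP => _; rewrite ?mul0r //.
  by rewrite -[(const _ : prodR _ _) F']/((ev a F)^-1 *: (1 : rat^o)) [_ *: _]mulr1 mulfV.
have Gy : G (idm F *: y, (const (ev a F)^-1 : O) *: (idm F *: x)).
  have := submodZ (const (ev a F)^-1 : O) GF.
  by rewrite pairZZ mulrC unit_at.
have Gt : G (idm F *: y, tf F : fam_emod N).
  by apply: (proj2 (tfP F)); eexists; exact: Gy.
have -> : tf F = (const (ev a F)^-1 : O) *: (idm F *: (x : fam N)) :=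
  partial_map_eq pG Gt Gy.
by rewrite !at_famZ !scalerA unit_at idem_idem.
Qed.

Lemma fam_extension : exists2 g : M -> fam_emod N, is_emhom g &
  forall n, g (i n) = f n.
Proof.
have [g [gL gg gE]] := fam_linear_extension.
have [_ _ ia] := ih; have [_ _ fa] := fh.
have [n|k kh kE] := average gL gg (@fam_separated _ _ N).
  have [D DP] := hcomp_fin (em_gr M) n.
  (* Averages respect degrees, so the degrees occurring in [n] bound those of all coordinates at
     once. *)
  have tS : fam_set (fun F => at_fam (avg_at g F n) F).
    split=> [F|]; first exact: at_fam_idem.
    exists D => d /DP nd F; rewrite -fam_gradingE.
    rewrite -[fam_grading N d _]/(em_gr (fam_emod N) d _) -(avg_at_gr gg) nd.
    by rewrite (lin0 (avg_at_lin gL F)).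
  exists (mkfam tS) => F; apply: fam_eq => F'; rewrite at_famZ mkfamE.
  have [->|F'F] := eqVneq F' F; first by rewrite at_fam_idem.
  have FF' : F != F' by rewrite eq_sym.
  have -> : at_fam (avg_at g F n) F' = idm F *: at_fam (avg_at g F n : fam N) F'.
    by rewrite -[in LHS](avg_at_idem g F n).
  by transitivity (0 : N); [exact: at_fam_idem_neq|exact/esym/at_fam_idem_neq].
exists k => // n; apply/eqP; rewrite -subr_eq0; apply/eqP/fam_separated => F.
rewrite scalerBr kE avg_at_fix ?gE ?subrr // => w.
by rewrite -ia gE fa.
Qed.

End Extension.

Section Coinduced.
Context (N : emod W).
Implicit Types (m : fam N).

Definition germ_gr : grading (germs N) := quot_grading (@fin_gr _ _ N).

Lemma germ_grE d m : germ_gr d (germ m) = germ (em_gr (fam_emod N) d m).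
Proof. exact: quot_gradingE. Qed.

Lemma germ_atP m n : germ m = germ n <->
  exists A : seq K, forall F, F \notin A -> at_fam m F = at_fam n F.
Proof.
rewrite germP; split=> -[A mn]; exists A.
  move=> F FA; have := congr1 (fun x => at_fam x F) mn.
  by rewrite !at_famZ !at_fam_coid (negbTE FA).
apply: fam_eq => F; rewrite !at_famZ !at_fam_coid.
by case: ifPn => // /mn.
Qed.

(** A relation and not an action: [m'] is constrained only at those [F] where [g] comes from [W_F],
    and several [w] over one [g] impose conditions on [m] as well. *)
Definition germ_rel (g : WK W) m m' := exists A : seq K, forall F, F \notin A ->
  forall phi, Whom W F = Some phi -> forall w : WF W F, phi w = g ->
    em_act w (at_fam m F) = at_fam m' F.

Lemma germ_rel_germ g m m' n n' : germ_rel g m m' -> germ m = germ n ->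
  germ m' = germ n' -> germ_rel g n n'.
Proof.
move=> [A AE] /germ_atP[A1 A1E] /germ_atP[A2 A2E]; exists (A ++ A1 ++ A2) => F.
rewrite !mem_cat !negb_or => /and3P[FA FA1 FA2] phi Fphi w wg.
by rewrite -A1E // -A2E //; apply: AE Fphi w wg.
Qed.

Lemma germ_relZD g (a : O) m m' n n' : germ_rel g m m' -> germ_rel g n n' ->
  germ_rel g (a *: m + n) (a *: m' + n').
Proof.
move=> [A AE] [A1 A1E]; exists (A ++ A1) => F.
rewrite !mem_cat !negb_or => /andP[FA FA1] phi Fphi w wg.
by rewrite !at_famD !at_famZ em_act_lin (AE F FA phi) // (A1E F FA1 phi).
Qed.

Lemma germ_rel0 g : germ_rel g 0 0.
Proof. by exists [::] => F _ phi _ w _; rewrite at_fam0 em_act0. Qed.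

Lemma germ_rel_gr g d m m' : germ_rel g m m' ->
  germ_rel g (em_gr (fam_emod N) d m) (em_gr (fam_emod N) d m').
Proof.
move=> [A AE]; exists A => F FA phi Fphi w wg.
by rewrite !fam_gradingE em_act_gr (AE F FA phi).
Qed.

Lemma germ0 : germ (0 : fam N) = 0.
Proof. by apply/qproj_eq0; apply: fin0. Qed.

Definition germsQ : Type := germs N.
HB.instance Definition _ := GRing.Zmodule.on germsQ.

Definition germ_qscale (q : rat) (g : germsQ) : germsQ := unitSOK X q *: (g : germs N).

Lemma unitSOKM p q : unitSOK X (p * q) = unitSOK X p * unitSOK X q.
Proof. by rewrite /unitSOK -to_SOKM constM. Qed.

Lemma unitSOKD p q : unitSOK X (p + q) = unitSOK X p + unitSOK X q.
Proof. by rewrite /unitSOK -to_SOKD constD. Qed.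

Lemma germ_qscaleA p q g : germ_qscale p (germ_qscale q g) = germ_qscale (p * q) g.
Proof. by rewrite /germ_qscale scalerA unitSOKM. Qed.

Lemma germ_qscale1 : left_id 1 germ_qscale.
Proof. by move=> g; rewrite /germ_qscale unitSOK1 scale1r. Qed.

Lemma germ_qscaleDr : right_distributive germ_qscale +%R.
Proof. by move=> q g h; rewrite /germ_qscale scalerDr. Qed.

Lemma germ_qscaleDl g : {morph germ_qscale^~ g : p q / p + q}.
Proof. by move=> p q; rewrite /germ_qscale unitSOKD scalerDl. Qed.

HB.instance Definition _ := GRing.Zmodule_isLmodule.Build rat germsQ
  germ_qscaleA germ_qscale1 germ_qscaleDr germ_qscaleDl.

Local Notation funs := (WK W -> germsQ).

Lemma funs_lin (q : rat) (y z : funs) h :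
  (q *: y + z) h = unitSOK X q *: (y h : germs N) + z h.
Proof. by []. Qed.

Lemma germ_qlin q m n :
  unitSOK X q *: germ m + germ n = germ ((const q : O) *: m + n).
Proof. by rewrite germD germZ. Qed.

Definition fun_hcomp d (y : funs) : funs := fun h => germ_gr d (y h).

Lemma fun_grading_subproof : exists g : grading funs, hcomp g = fun_hcomp.
Proof.
apply: grading_of_fin => [d y z|d e y|y y0|y].
- by apply/funext => h; apply: hcompD.
- apply/funext => h; rewrite /fun_hcomp hcompK.
  by case: eqP.
- apply/funext => h; apply: (hcomp_inj (g := germ_gr)) => d.
  rewrite [RHS](hcomp0 germ_gr).
  exact: (congr1 (fun z : funs => z h) (y0 d)).
- have [D DP] := choice (fun h => hcomp_fin germ_gr (y h)).
  exists (flatten [seq D h | h <- enum (WK W)]) => d dD.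
  apply/funext => h; apply: DP; apply: contra dD => dD.
  by apply/flattenP; exists (D h) => //; apply/mapP; exists h; rewrite ?mem_enum.
Qed.

Definition fun_grading := sval (cid fun_grading_subproof).

Lemma fun_gradingE d y h : fun_grading d y h = germ_gr d (y h).
Proof. by rewrite /fun_grading (svalP (cid fun_grading_subproof)). Qed.

(** The value [y h] stands for the germ at infinity of [h v], as in [to_coind]. By [germ_rel_germ]
    the condition does not depend on the representatives. *)
Definition coind_set (y : funs) := forall h g, exists m m',
  [/\ germ m = y h, germ m' = y (g * h)%g & germ_rel g m m'].

Lemma coind0 : coind_set 0.
Proof. by move=> h g; exists 0, 0; split; rewrite ?germ0 //; apply: germ_rel0. Qed.

Lemma coindZD (q : rat) y z : coind_set y -> coind_set z -> coind_set (q *: y + z).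
Proof.
move=> cy cz h g; have [m [m' [mE m'E mm']]] := cy h g.
have [n [n' [nE n'E nn']]] := cz h g.
exists ((const q : O) *: m + n), ((const q : O) *: m' + n'); split.
- by rewrite funs_lin -germ_qlin mE nE.
- by rewrite funs_lin -germ_qlin m'E n'E.
- exact: germ_relZD.
Qed.

Definition coind_submod : submod funs := Submod coind0 coindZD.

Lemma coind_gr d y : coind_submod y -> coind_submod (fun_grading d y).
Proof.
move=> cy h g; have [m [m' [mE m'E mm']]] := cy h g.
exists (em_gr (fam_emod N) d m), (em_gr (fam_emod N) d m'); split.
- by rewrite fun_gradingE -mE germ_grE.
- by rewrite fun_gradingE -m'E germ_grE.
- exact: germ_rel_gr.
Qed.

Lemma coind_act_subproof (k : WK W) (y : subm coind_submod) :
  coind_submod (fun h => submval y (h * k)%g).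
Proof.
move=> h g; have [m [m' [mE m'E mm']]] := submP y (h * k)%g g.
by exists m, m'; split=> //; rewrite m'E mulgA.
Qed.

Definition coind_act k (y : subm coind_submod) : subm coind_submod :=
  sub_in (coind_act_subproof k y).

(* The right adjoint of [V |-> ] germs of families: the [W_K]-representation
   coinduced from the partial actions of the [W_F] on germs. *)
Definition coind : vrep W.
Proof.
apply: (@Vrep _ _ _ (subm coind_submod) (sub_grading coind_gr) coind_act).
- by move=> y; apply: subm_eq; apply/funext => h /=; rewrite mulg1.
- by move=> g k y; apply: subm_eq; apply/funext => h /=; rewrite mulgA.
- by move=> g q y z; apply: subm_eq; apply/funext => h.
- move=> g d y; apply: subm_eq; rewrite sub_gradingE; apply/funext => h.
  rewrite fun_gradingE -[LHS]/(submval (sub_grading coind_gr d y) (h * g)%g).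
  by rewrite sub_gradingE fun_gradingE.
Defined.

Definition coind_at (y : coind) (h : WK W) : germs N := submval y h.

Lemma coind_eq (y z : coind) : (forall h, coind_at y h = coind_at z h) -> y = z.
Proof. by move=> yz; apply: subm_eq; apply/funext. Qed.

Lemma coind_at_act (y : coind) g h : coind_at (vr_act g y) h = coind_at y (h * g)%g.
Proof. by []. Qed.

Lemma coind_at_lin (q : rat) (y z : coind) h :
  coind_at (q *: y + z) h = unitSOK X q *: coind_at y h + coind_at z h.
Proof. by []. Qed.

Lemma coind_at_gr d (y : coind) h :
  coind_at (vr_gr coind d y) h = germ_gr d (coind_at y h).
Proof.
rewrite /coind_at -fun_gradingE.
exact: (congr1 (fun f : funs => f h) (sub_gradingE coind_gr d y)).
Qed.

Lemma coind_rel (y : coind) h g m m' :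
  germ m = coind_at y h -> germ m' = coind_at y (g * h)%g -> germ_rel g m m'.
Proof.
move=> my m'y; have [n [n' [nE n'E nn']]] := submP y h g.
by apply: germ_rel_germ nn' _ _; rewrite ?nE ?n'E ?my ?m'y.
Qed.

Section FromObject.
Context (Z : smobj W) (f : sN Z -> fam_emod N).
Context (fh : is_emhom (M := emod_of tm Z) f).

Definition lift (v : sV Z) : sN Z := sval (cid (lift_exists tm v)).

Lemma liftP v : lifts v (lift v).
Proof. exact: (svalP (cid (lift_exists tm v))). Qed.

Lemma germ_lift v n : lifts v n -> germ (f n : fam N) = germ (f (lift v) : fam N).
Proof.
move=> vn; have [A AE] := lifts_uniq tm vn (liftP v); have [fL _ _] := fh.
apply/germP; exists A.
by have fZ := linZ fL; rewrite -!fZ AE.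
Qed.

(** This is [lifts_act] for the vectors [h v] and [g h v], transported by the equivariant map
    [f]. *)
Lemma to_coind_subproof v : coind_set (fun h => germ (f (lift (actV h v)) : fam N)).
Proof.
move=> h g; exists (f (lift (actV h v))), (f (lift (actV (g * h)%g v))); split=> //.
have l2 : lifts (actV g (actV h v)) (lift (actV (g * h)%g v)).
  by rewrite -actVM; apply: liftP.
have [A AE] := lifts_act tm (liftP (actV h v)) l2.
have [fL _ fa] := fh; have fZ := linZ fL.
exists A => F FA phi Fphi w wg.
have e1 := fa F w (lift (actV h v)).
have e2 : em_act w (f (lift (actV h v))) = idm F *: f (lift (actV (g * h)%g v)).
  by rewrite -e1 -fZ; congr (f _); exact: (AE F FA phi Fphi w wg).
have := congr1 (fun x => at_fam x F) e2.
by rewrite fam_actE eqxx at_famZ at_fam_idem.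
Qed.

Definition to_coind (v : sV Z) : coind :=
  sub_in (to_coind_subproof v : coind_submod (fun h => germ (f (lift (actV h v)) : fam N))).

Lemma to_coindE v h : coind_at (to_coind v) h = germ (f (lift (actV h v)) : fam N).
Proof. by []. Qed.

Lemma to_coind1 v n : lifts v n -> coind_at (to_coind v) 1%g = germ (f n : fam N).
Proof. by move=> vn; rewrite to_coindE; apply/esym/germ_lift; rewrite actV1. Qed.

Lemma to_coind_vhom : is_vhom (U := vrep_of Z) to_coind.
Proof.
have [fL fg _] := fh; split=> [q u v|d v|w v]; apply: coind_eq => h.
- rewrite coind_at_lin !to_coindE germ_qlin.
  transitivity (germ (f ((const q : O) *: lift (actV h u) + lift (actV h v)) : fam N)).
    apply/esym/germ_lift; rewrite (obj_actV_lin h).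
    by apply: liftsZD; apply: liftP.
  by rewrite fL.
- rewrite coind_at_gr !to_coindE germ_grE.
  transitivity (germ (f (gN Z d (lift (actV h v))) : fam N)).
    apply/esym/germ_lift; change (vr_gr (vrep_of Z) d v) with (gV Z d v).
    have -> : actV h (gV Z d v) = gV Z d (actV h v) := @vr_act_gr _ _ _ (vrep_of Z) h d v.
    exact: (lifts_hcomp d (liftP (actV h v))).
  by rewrite fg.
- rewrite coind_at_act !to_coindE; congr (germ (f (lift _))).
  by rewrite -actVM.
Qed.

End FromObject.
End Coinduced.
End Godement.

(** * Gluing a product of the [e_F N] to a representation at infinity *)

Section GodementObject.
Context (K : choiceType) (W : compstr (type0 K)).
Local Notation X := (type0 K).
Local Notation O := (OK X).
Local Notation idm F := (idem F : O).
Local Notation coid A := (coidem (stalk X) A : O).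
Local Notation vden s := (val (s : den (mset X)) : O).
Local Notation TV U := (tensV X U).

Section TensorGrading.
Context (U : vrep W).
Implicit Types (x : TV U).

Lemma tgr_subproof d :
  semilinear (@unitSOK K X) (fun u : U => tmkV X (vr_gr U d u)).
Proof.
move=> q u v; rewrite hcompD (additive_rat (hcompD (vr_gr U) d)).
exact: tmkV_lin.
Qed.

Definition tgr d : TV U -> TV U := tlift (tgr_subproof d).

Lemma tgr_lin d : semilinear id (tgr d). Proof. exact: tlift_lin. Qed.
Lemma tgrE d u : tgr d (tmkV X u) = tmkV X (vr_gr U d u).
Proof. exact: tliftE. Qed.

Lemma tmk0 : tmkV X (0 : U) = 0. Proof. exact: unit_lin0 (@tmkV_lin _ X U). Qed.

Lemma tgrD d x y : tgr d (x + y) = tgr d x + tgr d y.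
Proof. exact: (linD (tgr_lin d)). Qed.

Lemma tgrK d e x : tgr d (tgr e x) = if d == e then tgr e x else 0.
Proof.
have kL : semilinear id (fun x : TV U => if d == e then tgr e x else 0).
  by move=> b y z; case: eqP => _; [exact: tgr_lin|rewrite scaler0 addr0].
apply: (linear_eq_spanned (@tmkV_spanned _ X U) (h := tgr d \o tgr e) _ kL) => [b y z|u] /=.
  by rewrite (tgr_lin e) (tgr_lin d).
by rewrite !tgrE hcompK; case: eqP => // _; apply: tmk0.
Qed.

Lemma tgr_sum x : exists2 D : seq int, uniq D & x = \sum_(d <- D) tgr d x.
Proof.
(* Stated for every list containing [D], so that the lists of two summands can be merged. *)
suff [D DP] : exists D : seq int, forall E, uniq E -> {subset D <= E} ->
    x = \sum_(d <- E) tgr d x.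
  exists (undup D); rewrite ?undup_uniq //; apply: DP; first exact: undup_uniq.
  by move=> d; rewrite mem_undup.
apply: (spanned_ind (Q := fun x => exists D : seq int, forall E, uniq E ->
  {subset D <= E} -> x = \sum_(d <- E) tgr d x) (@tmkV_spanned _ X U)) => [|y z [D DP] [E EP]|b u].
- exists [::] => E _ _; rewrite big1 // => d _.
  exact: lin0 (tgr_lin d).
- exists (D ++ E) => H uH DEH.
  rewrite (eq_bigr _ (fun d _ => tgrD d y z)) big_split /= -DP -?EP //.
    by move=> d dE; apply: DEH; rewrite mem_cat dE orbT.
  by move=> d dD; apply: DEH; rewrite mem_cat dD.
- have [D DP] := hcomp_fin (vr_gr U) u; exists D => E uE DE.
  transitivity (b *: tmkV X (\sum_(d <- E) vr_gr U d u)).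
    congr (_ *: tmkV _ _); apply: hcomp_supp => // d dE; apply: DP.
    by apply: contra dE; apply: DE.
  rewrite (big_morph _ (unit_linD (@tmkV_lin _ X U)) tmk0) scaler_sumr.
  apply: eq_bigr => d _.
  by rewrite (linZ (tgr_lin d)) tgrE.
Qed.

Definition tens_grading : grading (TV U) := Grading tgrD tgrK tgr_sum.

Definition tens_pmod : pmod X.
Proof.
apply: (@Pmod _ _ (TV U) tens_grading) => d e x p xd pe.
have [d0|x0] := loc_homog_type0 W xd; last by rewrite x0 scale0r; apply: homog0.
rewrite d0 add0r /homog.
rewrite [LHS](linZ (tgr_lin e)); congr (_ *: _); exact: pe.
Defined.

End TensorGrading.

Section Object.
Context (N : emod W) (U : vrep W) (kap : U -> germs N).
Context (kapL : semilinear (@unitSOK K X) kap).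
Context (kap_gr : forall d u, kap (vr_gr U d u) = germ_gr N d (kap u)).
Context (kap_rel : forall g u m m', germ m = kap u -> germ m' = kap (vr_act g u) ->
  germ_rel g m m').

Definition theta : TV U -> germs N := tlift kapL.
Lemma theta_lin : semilinear id theta. Proof. exact: tlift_lin. Qed.
Lemma thetaE u : theta (tmkV X u) = kap u. Proof. exact: tliftE. Qed.

Lemma theta_gr d p : theta (tens_grading U d p) = germ_gr N d (theta p).
Proof.
apply: (spanned_ind (Q := fun p => theta (tgr d p) = germ_gr N d (theta p))
  (@tmkV_spanned _ X U)) => [|x y hx hy|b u].
- rewrite (lin0 (tgr_lin d)) (lin0 theta_lin).
  by rewrite hcomp0.
- by rewrite tgrD !(linD theta_lin) hcompD hx hy.
- rewrite (linZ (tgr_lin d)) !(linZ theta_lin).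
  rewrite tgrE !thetaE kap_gr; have [a ->] := SOK_type0 b.
  have [m ->] := germ_surj (kap u); rewrite -germZ !germ_grE -germZ.
  by rewrite em_hcomp0.
Qed.

Definition pull_mod : lmodType O := (fam N * resP (TV U))%type.

(** The fibre product of families and [S^{-1}O (x) U] over germs: sections with given coordinates at
    the [F] and a given value at infinity. *)
Definition pull_set (n : pull_mod) := germ n.1 = theta n.2.

Lemma pull0 : pull_set 0.
Proof. by rewrite /pull_set germ0 [RHS](lin0 theta_lin). Qed.

Lemma pullZD (a : O) m n : pull_set m -> pull_set n -> pull_set (a *: m + n).
Proof.
rewrite /pull_set => hm hn.
rewrite -[X in germ X]/(a *: m.1 + n.1) -[X in theta X]/(to_SOK a *: (m.2 : TV U) + n.2).
by rewrite theta_lin germD germZ hm hn.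
Qed.

Definition pull_submod : submod pull_mod := Submod pull0 pullZD.

Definition pull_gr : grading pull_mod :=
  pair_grading (em_gr (fam_emod N)) (tens_grading U).

(** [W_F] acts on the second factor by 0, because [e_F] is 0 in [S^{-1}O]. *)
Definition pull_ambient : emod W.
Proof.
apply: (@Emod _ _ _ pull_mod pull_gr _ (fun F (w : WF W F) (n : pull_mod) =>
  ((em_act w (n.1 : fam_emod N), 0) : pull_mod))).
- apply: pair_graded; first exact: (@em_graded _ _ _ (fam_emod N)).
  move=> d e a p ad pe; apply: (@pm_graded _ _ (tens_pmod U) d e) => //.
  exact: to_SOK_homog.
- move=> F n; have e1 := em_act1 F (n.1 : fam_emod N).
  have e2 : (0 : resP (TV U)) = idm F *: n.2.
    by rewrite res_scaleE to_SOK_idem scale0r.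
  exact: (f_equal2 pair e1 e2).
- move=> F g h n.
  exact: (f_equal2 pair (em_actM g h (n.1 : fam_emod N)) erefl).
- move=> F g a m n.
  have e1 := em_act_lin g a (m.1 : fam_emod N) (n.1).
  have e2 : (0 : resP (TV U)) = a *: 0 + 0 by rewrite scaler0 addr0.
  exact: (f_equal2 pair e1 e2).
- move=> F g d n; rewrite /pull_gr !pair_gradingE.
  exact: (f_equal2 pair (em_act_gr g d (n.1 : fam_emod N))
    (esym (hcomp0 (tens_grading U) d))).
Defined.

Lemma pull_set_gr d n : pull_submod n -> pull_submod (em_gr pull_ambient d n).
Proof.
move=> nS; rewrite /= /pull_set /pull_gr pair_gradingE /= theta_gr -nS.
by rewrite germ_grE.
Qed.

Lemma pull_set_act F (w : WF W F) n : pull_submod n ->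
  pull_submod (em_act w (n : pull_ambient)).
Proof.
move=> _; rewrite /= /pull_set /= (lin0 theta_lin).
exact: germ_single.
Qed.

Definition pull_emod : emod W :=
  sub_emod (N := pull_ambient) pull_set_gr pull_set_act.

Definition pull_fam (n : pull_emod) : fam_emod N := (submval n).1.
Definition pull_tens (n : pull_emod) : tens_pmod U := (submval n).2.

Lemma pullP (n : pull_emod) : germ (pull_fam n : fam N) = theta (pull_tens n).
Proof. exact: submP n. Qed.

Definition mkpull (m : fam N) (p : TV U) (h : germ m = theta p) : pull_emod :=
  sub_in (h : pull_submod ((m, p) : pull_mod)).

Lemma pull_eq (m n : pull_emod) :
  pull_fam m = pull_fam n -> pull_tens m = pull_tens n -> m = n.
Proof.
move=> e1 e2; apply: subm_eq.
by rewrite [LHS]surjective_pairing [RHS]surjective_pairing; congr pair.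
Qed.

Lemma pull_fam_emhom : is_emhom pull_fam.
Proof.
split=> [a m n|d n|F w n] //.
transitivity (pull_gr d (submval n)).1; last by rewrite /pull_gr pair_gradingE.
exact: (congr1 fst (sub_gradingE _ d n)).
Qed.

Lemma pull_tens_lin : semilinear (@to_SOK K X) pull_tens.
Proof. by []. Qed.

Lemma pull_tens_gr d n : pull_tens (em_gr pull_emod d n) = pm_gr (tens_pmod U) d (pull_tens n).
Proof.
transitivity (pull_gr d (submval n)).2; last by rewrite /pull_gr pair_gradingE.
exact: (congr1 snd (sub_gradingE _ d n)).
Qed.

Lemma pull_tens_act F (w : WF W F) n : pull_tens (em_act w n) = 0.
Proof. by []. Qed.

(** The kernel consists of families with zero germ, which an element of [S] kills, and every germ
    comes from a family. *)
Lemma pull_iso : bijective (@ind_loc K X pull_emod (tens_pmod U) pull_tens).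
Proof.
apply: (ind_loc_bij pull_tens_lin) => [n n0|p].
  have /qproj_eq0[A mA] : germ (pull_fam n : fam N) = 0.
    by rewrite pullP n0 (lin0 theta_lin).
  exists (coden A); apply: pull_eq; first exact: mA.
  rewrite [LHS](loc_linZ pull_tens_lin) n0; exact: scaler0.
have [m mE] := germ_surj (theta p).
by exists (mkpull (esym mE)), (den1 _); rewrite tsok1 scale1r.
Qed.

Lemma pull_equiv g u n n' (s s' : den (mset X)) :
  pull_tens n = tsok s *: tmkV X u ->
  pull_tens n' = tsok s' *: tmkV X (vr_act g u) ->
  exists t : den (mset X), forall F phi, Whom W F = Some phi ->
    forall w : WF W F, phi w = g ->
      vden t *: (vden s' *: em_act w n) = vden t *: (vden s *: (idm F *: n')).
Proof.
rewrite !tsok_type0 !scale1r => nu n'u.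
have [||A AE] := @kap_rel g u (pull_fam n) (pull_fam n').
- by rewrite pullP nu thetaE.
- by rewrite pullP n'u thetaE.
(* Elements of [S] are idempotent: [s] and [s'] are put into the multiplier so that it absorbs them
   on both sides. *)
exists (denM (coden A) (denM s s')) => F phi Fphi w wg.
have stab a : vden (denM (coden A) (denM s s')) * vden s' * a =
    vden (denM (coden A) (denM s s')) * a.
  rewrite !val_denM; transitivity (coid A * (vden s * (vden s' * vden s')) * a).
    by rewrite /coden val_mkden; ring.
  by rewrite den_idem.
have stab' : vden (denM (coden A) (denM s s')) * vden s =
    vden (denM (coden A) (denM s s')).
  rewrite !val_denM; transitivity (coid A * ((vden s * vden s) * vden s')).
    by rewrite /coden val_mkden; ring.
  by rewrite den_idem.
have -> : vden (denM (coden A) (denM s s')) *: (vden s' *: em_act w n) =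
    vden (denM (coden A) (denM s s')) *: em_act w n.
  by rewrite scalerA -[_ * vden s']mulr1 stab mulr1.
have -> : vden (denM (coden A) (denM s s')) *: (vden s *: (idm F *: n')) =
    vden (denM (coden A) (denM s s')) *: (idm F *: n').
  by rewrite [LHS]scalerA stab'.
have -> : vden (denM (coden A) (denM s s')) = vden (denM s s') * coid A.
  by rewrite val_denM /coden val_mkden mulrC.
rewrite -!scalerA; congr (_ *: (_ *: _)); apply: pull_eq.
  have [fL _ fa] := pull_fam_emhom; have fZ := linZ fL.
  rewrite !fZ fa; apply: fam_eq => F'; rewrite !at_famZ fam_actE.
  have [->|F'F] := eqVneq F' F.
    rewrite at_fam_idem; case: (boolP (F \in A)) => FA; last first.
      by rewrite (AE F FA phi Fphi w wg).
    by rewrite at_fam_coid FA -em_act_idem scalerA coidem_idem FA scale0r.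
  by rewrite at_fam_idem_neq // eq_sym.
rewrite !(loc_linZ pull_tens_lin) pull_tens_act scaler0 to_SOK_idem.
by rewrite scale0r scaler0.
Qed.

End Object.
End GodementObject.

Section PairVrep.
Context (K : choiceType) (X : sheaf K) (W : compstr X) (U V : vrep W).

Definition pair_vrep : vrep W.
Proof.
apply: (@Vrep _ _ _ (U * V)%type (pair_grading (vr_gr U) (vr_gr V))
  (fun g z => (vr_act g z.1, vr_act g z.2))).
- by move=> [u v]; rewrite !vr_act1.
- by move=> g h [u v]; rewrite !vr_actM.
- by move=> g q [u v] [u' v']; congr pair; apply: vr_act_lin.
- by move=> g d [u v]; rewrite !pair_gradingE /= !vr_act_gr.
Defined.

End PairVrep.

(** * Resolutions and dimension in Type 0 *)

Section Type0Final.
Context (K : choiceType) (W : compstr (type0 K)).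
Local Notation X := (type0 K).
Local Notation O := (OK X).
Local Notation idm F := (idem F : O).
Local Notation coid A := (coidem (stalk X) A : O).
Local Notation tm := (tame_type0 W).

Section Object.
Context (N : emod W) (V0 : vrep W).

Definition gd_vrep := pair_vrep V0 (coind N).
Local Notation U := gd_vrep.

Definition gd_kap (u : U) : germs N := coind_at (u : V0 * coind N)%type.2 1%g.

Lemma gd_kapL : semilinear (@unitSOK K X) gd_kap.
Proof.
move=> q u v.
exact (coind_at_lin q (u : V0 * coind N)%type.2 (v : V0 * coind N)%type.2 1%g).
Qed.

Lemma gd_kap_gr d u : gd_kap (vr_gr U d u) = germ_gr N d (gd_kap u).
Proof. by rewrite /gd_kap /= pair_gradingE /= coind_at_gr. Qed.

Lemma gd_kap_rel g u m m' : germ m = gd_kap u -> germ m' = gd_kap (vr_act g u) ->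
  germ_rel g m m'.
Proof.
move=> mu m'u; pose y := (u : V0 * coind N)%type.2.
have m'y : germ m' = coind_at y (1 * g)%g := m'u.
by apply: (coind_rel (y := y) (h := 1%g)) => //; rewrite m'y mul1g mulg1.
Qed.

(* The right adjoint of [Y |-> (V, (e_F N)_F)] applied to [V0] and [(e_F N)_F]. *)
Definition gd_obj : smobj W := @mk_obj _ _ _ tm (pull_emod gd_kapL gd_kap_gr)
  (tens_pmod U) U (@pull_tens _ _ _ _ _ gd_kapL gd_kap_gr) (@tmkV _ X U)
  (@pull_tens_lin _ _ _ _ _ gd_kapL gd_kap_gr) (@tmkV_lin _ X U)
  (@pull_tens_gr _ _ _ _ _ gd_kapL gd_kap_gr) (fun d u => esym (tgrE d u))
  (pull_iso gd_kapL gd_kap_gr) (@tmkV_iso _ X U)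
  (@pull_equiv _ _ _ _ _ gd_kapL gd_kap_gr gd_kap_rel).

Definition gd_fam (n : sN gd_obj) : fam_emod N :=
  @pull_fam _ _ _ _ _ gd_kapL gd_kap_gr n.
Definition gd_V0 (v : sV gd_obj) : V0 := (v : V0 * coind N)%type.1.
Definition gd_co (v : sV gd_obj) : coind N := (v : V0 * coind N)%type.2.

Lemma gd_eq (m n : sN gd_obj) : gd_fam m = gd_fam n -> sNP m = sNP n -> m = n.
Proof. exact: pull_eq. Qed.

Lemma gd_mk (m : fam N) (p : sP gd_obj) : germ m = theta gd_kapL p ->
  exists n : sN gd_obj, gd_fam n = m /\ sNP n = p.
Proof. by move=> h; exists (mkpull gd_kap_gr h). Qed.

Lemma gdP (n : sN gd_obj) : germ (gd_fam n : fam N) = theta gd_kapL (sNP n).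
Proof. exact: pullP. Qed.

Lemma gd_fam_emhom : is_emhom (M := emod_of tm gd_obj) gd_fam.
Proof. exact: pull_fam_emhom. Qed.

(** The gluing condition [comp] is checked on lifts by [lift_ind]; there it says that [to_coind]
    takes at 1 the germ of the image of a lift. *)
Lemma gd_hom (Z : smobj W) (f : sN Z -> fam_emod N) (f0 : sV Z -> V0) :
  forall fh : is_emhom (M := emod_of tm Z) f, is_vhom (U := vrep_of Z) f0 ->
  exists h : smhom Z gd_obj, [/\ forall n, gd_fam (hN h n) = f n,
    forall v, gd_V0 (hV h v) = f0 v & forall v, gd_co (hV h v) = to_coind fh v].
Proof.
move=> fh f0h; pose fU (v : sV Z) : U := (f0 v, to_coind fh v).
have fUh : is_vhom (U := vrep_of Z) fU.
  have [aL ag aa] := f0h; have [bL bg ba] := to_coind_vhom fh.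
  split=> [q u v|d v|w v].
  - by rewrite /fU aL bL.
  - rewrite /fU ag bg; exact/esym/(pair_gradingE (vr_gr V0) (vr_gr (coind N)) d).
  - by rewrite /fU aa ba.
have [UL _ _] := fUh.
have sL : semilinear (@unitSOK K X) (fun v : sV Z => tmkV X (fU v)).
  by move=> q u v; have -> := UL q u v; apply: tmkV_lin.
have [k [kL kE]] := vobj_univ sL.
have [fL fg fa] := fh; have fD := linD fL.
have fZ := linZ fL.
have thD := linD (theta_lin gd_kapL).
have thZ := linZ (theta_lin gd_kapL).
have kD := linD kL; have kZ := linZ kL.
have comp n : germ (f n : fam N) = theta gd_kapL (k (sNP n)).
  apply: (lift_ind tm (Q := fun n => germ (f n : fam N) = theta gd_kapL (k (sNP n))))
    n => [m n [A An] hm|m n hm hn|a v n vn].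
  - have -> : germ (f n : fam N) = germ (f m : fam N).
      by apply/germP; exists A; rewrite -!fZ An.
    rewrite hm; congr (theta _ (k _)).
    have := congr1 (@sNP _ _ Z) An.
    by rewrite !sNPZ !to_SOK_coid !scale1r.
  - by rewrite fD germD hm hn sNPD kD thD.
  - rewrite fZ germZ sNPZ kZ thZ; congr (_ *: _).
    rewrite (lifts_type0 vn) kE thetaE; exact/esym/(to_coind1 fh vn).
pose fN (n : sN Z) : pull_emod gd_kapL gd_kap_gr := mkpull gd_kap_gr (comp n).
have fNh : is_emhom (M := emod_of tm Z) fN.
  split=> [a m n|d n|F w n]; apply: pull_eq.
  - exact: fL.
  - by rewrite -[LHS]/(k (sNP (a *: m + n))) (@sNP_lin _ _ Z) kL.
  - have [_ -> _] := @pull_fam_emhom _ _ _ _ _ gd_kapL gd_kap_gr.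
    exact: fg.
  - rewrite pull_tens_gr -[LHS]/(k (sNP (gN Z d n))) sNP_deg.
    exact: (@spanned_graded _ _ _ tm (pmod_of Z) (tens_pmod U) (vrep_of Z) U
      _ _ fU k (@sVP_spanned _ _ _ Z) (@sVP_deg _ _ Z) (fun d u => esym (tgrE d u))
      (let: And3 _ h _ := fUh in h) kL kE).
  - have [_ _ ->] := @pull_fam_emhom _ _ _ _ _ gd_kapL gd_kap_gr.
    exact: fa.
  - rewrite pull_tens_act -[LHS]/(k (sNP (actN w n))) sNP_act0.
    exact: lin0 kL.
have hh : @is_smhom _ _ _ Z gd_obj fN k fU.
  by apply: (@build_hom _ _ _ tm Z gd_obj fN k fU).
by exists (SMHom hh).
Qed.

Lemma gd_co1 (Z : smobj W) (h : smhom Z gd_obj) v n : lifts v n ->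
  coind_at (gd_co (hV h v)) 1%g = germ (gd_fam (hN h n) : fam N).
Proof.
move=> vn; rewrite gdP -hom_NP (lifts_type0 vn) hom_VP.
by rewrite [theta _ _](thetaE gd_kapL).
Qed.

(** The coinduced component is determined by its values at 1 on all translates [g v], and these are
    germs of families by [gd_co1]. *)
Lemma gd_hom_eq (Z : smobj W) (h k : smhom Z gd_obj) :
  (forall n, gd_fam (hN h n) = gd_fam (hN k n)) ->
  (forall v, gd_V0 (hV h v) = gd_V0 (hV k v)) -> h = k.
Proof.
move=> e1 e2; have coE (l : smhom Z gd_obj) v g :
    coind_at (gd_co (hV l v)) g = coind_at (gd_co (hV l (actV g v))) 1%g.
  have [_ _ la] := hom_v l; have -> := la g v.
  by rewrite [RHS]coind_at_act mul1g.
have eV v : hV h v = hV k v.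
  rewrite [LHS](surjective_pairing (hV h v : V0 * coind N)%type).
  rewrite [RHS](surjective_pairing (hV k v : V0 * coind N)%type).
  congr pair; first exact: e2.
  apply: coind_eq => g.
  transitivity (coind_at (gd_co (hV h (actV g v))) 1%g); first exact: coE.
  transitivity (coind_at (gd_co (hV k (actV g v))) 1%g); last exact/esym/coE.
  have [n vn] := lift_exists tm (actV g v).
  by rewrite !(gd_co1 _ vn) e1.
have eP p : hP h p = hP k p.
  apply: (linear_eq_spanned (@sVP_spanned _ _ _ Z) (homP_lin h) (homP_lin k)) => v.
  by rewrite !hom_VP eV.
apply: smhom_eq => // n; apply: gd_eq => //.
by rewrite -!hom_NP eP.
Qed.

Lemma gd_injective : injective_ob (C := standard_model W) gd_obj.
Proof.
move=> Y Z i f mi; have [iN iV] := injective_of_mono tm mi.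
have fMh : is_emhom (M := emod_of tm Y) (fun n => gd_fam (hN f n)).
  exact: (comp_emhom gd_fam_emhom (hom_em tm f)).
have [gM gMh gME] := fam_extension (hom_em tm i) fMh iN.
have f0h : is_vhom (U := vrep_of Y) (fun v => gd_V0 (hV f v)).
  have [fL fg fa] := hom_v f; split=> [q u v|d v|w v].
  - by rewrite fL.
  - by rewrite fg /gd_V0 /= pair_gradingE.
  - by rewrite fa.
have [g0 g0h g0E] := vrep_extension (hom_v i) f0h iV.
have [g [gfam gV0 _]] := gd_hom gMh g0h; exists g.
apply: gd_hom_eq => [n|v] /=; first by rewrite gfam gME.
by rewrite gV0 g0E.
Qed.

End Object.

Section Resolution.
Context (Y : smobj W).
Local Notation NY := (emod_of tm Y).

Lemma diag_subproof (n : NY) : fam_set (fun F => idm F *: n).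
Proof.
split=> [F|]; first by rewrite scalerA idem_idem.
have [D DP] := hcomp_fin (em_gr NY) n; exists D => d /DP nd F.
by rewrite em_hcomp0 // nd scaler0.
Qed.

Definition diag (n : NY) : fam_emod NY := mkfam (diag_subproof n).

Lemma diagE n F : at_fam (diag n) F = idm F *: n. Proof. by []. Qed.

Lemma diag_emhom : is_emhom diag.
Proof.
split=> [a m n|d n|F w n]; apply: fam_eq => F'.
- by rewrite at_famD at_famZ !diagE scalerDr !scalerA mulrC.
- by rewrite fam_gradingE !diagE em_hcomp0.
- rewrite fam_actE !diagE; have [->|F'F] := eqVneq F' F.
    by rewrite em_act_idem em_actZ em_act_idem.
  by rewrite -(em_act_idem w n) scalerA idem_neq ?scale0r.
Qed.

Definition gd0 := gd_obj NY (vrep_of Y).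
(** With the zero module for [D], only [P] and [V] of the inner object are kept: this is the
    skyscraper at infinity of the coinduced representation. *)
Definition gd1 := half_obj tm (gd_obj NY (zero_vrep W)) (zero_torsion (N := NY)).

Lemma gd_embedding : exists i : smhom Y gd0,
  [/\ forall n, gd_fam (hN i n) = diag n, forall v, gd_V0 (hV i v) = v &
    forall v, gd_co (hV i v) = to_coind diag_emhom v].
Proof.
have idh : is_vhom (U := vrep_of Y) (V := vrep_of Y) id by [].
exact: (gd_hom diag_emhom idh).
Qed.

Lemma gd_proj : exists rho : sP gd0 -> sP Y, semilinear id rho /\
  forall v : sV gd0, rho (sVP v) = sVP (gd_V0 v).
Proof. by apply: vobj_univ => q u v; exact: (@sVP_lin _ _ Y). Qed.

(** An element of the kernel has image 0 in [P], hence zero germ; as its coordinates are zero too,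
    it vanishes. *)
Lemma gd_embedding_inj (i : smhom Y gd0) :
  (forall n, gd_fam (hN i n) = diag n) -> (forall v, gd_V0 (hV i v) = v) ->
  injective (hN i).
Proof.
move=> ifam iV0; have [rho [rhoL rhoE]] := gd_proj.
have rhoi p : rho (hP i p) = p.
  apply: (linear_eq_spanned (@sVP_spanned _ _ _ Y) (h := rho \o hP i) (k := id)) =>
  // [a x y|v] /=; first by rewrite (homP_lin i) rhoL.
by rewrite hom_VP rhoE iV0.
move=> m n mn; apply/eqP; rewrite -subr_eq0; apply/eqP.
have mn0 : hN i (m - n) = 0 by rewrite (homNB tm) mn subrr.
have d0 F : idm F *: (m - n) = 0.
  by have := ifam (m - n); rewrite mn0 => /(congr1 (fun x => at_fam x F)).
have : sNP (m - n) = 0.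
  by rewrite -(rhoi (sNP (m - n))) hom_NP mn0 sNP0 (lin0 rhoL).
move=> /sNP_eq0[s smn]; have [A] := tors_germ0 tm smn; rewrite scaler0 => Amn.
rewrite -(scale1r (m - n)) (coidem_split (stalk X) (undup_uniq A)) scalerDl.
have -> : coid (undup A) = coid A.
  by apply: prodR_eq => F; rewrite !coidemE mem_undup.
by rewrite Amn add0r scaler_suml big1.
Qed.

Lemma injdim1_type0 : injdim_le (C := standard_model W) 1 Y.
Proof.
have [i [ifam iV0 ico]] := gd_embedding.
have [rho [rhoL rhoE]] := gd_proj.
have i_inj := gd_embedding_inj ifam iV0.
pose co := coind NY; pose ga := to_coind diag_emhom.
(* The difference between the coinduced component and the one dictated by the [V]-component; it
   vanishes exactly on the image of [Y]. *)
pose pV (v : sV gd0) : sV gd1 := (0 : zero_vrep W, gd_co v - ga (gd_V0 v)).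
have [gaL gag gaa] := to_coind_vhom diag_emhom.
have pVh : is_vhom (U := vrep_of gd0) (V := vrep_of (gd_obj NY (zero_vrep W))) pV.
  split=> [q u v|d v|w v].
  - congr pair; first exact: (@zero_subm rat (rat^o)).
    have e : (q *: gd_co u + gd_co v) - ga (q *: gd_V0 u + gd_V0 v) =
        q *: (gd_co u - ga (gd_V0 u)) + (gd_co v - ga (gd_V0 v)).
      by rewrite /ga gaL opprD addrACA scalerBr.
    exact: e.
  - rewrite [RHS](pair_gradingE (vr_gr (zero_vrep W)) (vr_gr co)).
    congr pair; first exact: (@zero_subm rat (rat^o)).
    rewrite hcompB; have e := pair_gradingE (vr_gr (vrep_of Y)) (vr_gr co) d v.
    have -> : gd_co (vr_gr (vrep_of gd0) d v) = vr_gr co d (gd_co v).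
      exact: (congr1 snd e).
    have -> : gd_V0 (vr_gr (vrep_of gd0) d v) = vr_gr (vrep_of Y) d (gd_V0 v).
      exact: (congr1 fst e).
    by congr (_ - _); apply: gag.
  - congr pair.
    have vB (x y : co) : vr_act w (x - y) = vr_act w x - vr_act w y.
      by rewrite -scaleN1r addrC (@vr_act_lin _ _ _ co) scaleN1r addrC.
    have e : vr_act w (gd_co v) - ga (actV w (gd_V0 v)) =
        vr_act w (gd_co v - ga (gd_V0 v)).
      by rewrite vB; congr (_ - _); apply: gaa.
    exact: e.
have zh : is_emhom (M := emod_of tm gd0) (N := zero_emod NY) (fun=> 0).
  by split=> [a m n|d n|F w n]; exact: (@zero_subm O NY).
have [p [_ ppV]] := half_hom (zero_torsion (N := NY)) zh pVh.
have pi0 : smcomp p i = smzero Y gd1.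
  apply: half_hom_eq => [n|v]; first exact: (@zero_subm O NY).
  by rewrite /= ppV /pV ico iV0 subrr.
have pN1 n : (hN p n : half_mod _ _).1 = hP p (sNP n) by rewrite hom_NP.
(* A section of [hP p]. Together with [rho] it splits the sequence of [P]-components, from which
   exactness on [N] is deduced. *)
have [iota [iotaL iotaE]] : exists iota : sP gd1 -> sP gd0, semilinear id iota /\
    forall v : sV gd1, iota (sVP v) =
      sVP ((0 : vrep_of Y, gd_co (v : sV (gd_obj NY (zero_vrep W)))) : sV gd0).
  apply: (@vobj_univ _ _ _ gd1) => q u v; rewrite -(@sVP_lin _ _ gd0).
  have e0 : (0 : vrep_of Y) = q *: 0 + 0 by rewrite scaler0 addr0.
  by congr sVP; congr pair; exact: e0.
have decomp q : q = hP i (rho q) + iota (hP p q).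
  apply: (linear_eq_spanned (@sVP_spanned _ _ _ gd0) (h := id)
    (k := fun q => hP i (rho q) + iota (hP p q))) => // [a x y|[v y]].
    by rewrite rhoL !(homP_lin, iotaL) addrACA scalerDr.
  rewrite rhoE !hom_VP ppV iotaE -(unit_linD (@sVP_lin _ _ gd0)); congr sVP.
  rewrite [hV i _]surjective_pairing; congr pair.
    rewrite -[LHS]addr0; congr (_ + _); exact/esym/iV0.
  rewrite -[X in _ = X + _]/(gd_co (hV i v)) ico /gd_co /pV /=.
  by rewrite addrC subrK.
have piota (y : coind NY) : hP p (sVP ((0 : vrep_of Y, y) : sV gd0)) =
    sVP ((0 : zero_vrep W, y) : sV gd1).
  rewrite hom_VP ppV /pV; congr sVP; congr pair.
  by rewrite /gd_co /gd_V0 /= /ga (lin0 gaL) subr0.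
exists gd0, gd1, i, p; split; first exact: gd_injective.
- apply: (short_exact_crit tm) => //.
  + by move=> u v uv; rewrite -(iV0 u) uv iV0.
  + exact: (fun n => congr1 (fun h : smhom Y gd1 => hN h n) pi0).
  + by move=> v; rewrite ppV /pV ico iV0 subrr.
  + move=> n pn0; have pP0 : hP p (sNP n) = 0 by rewrite -pN1 pn0.
    have nE : sNP n = hP i (rho (sNP n)).
      by rewrite {1}(decomp (sNP n)) pP0 (lin0 iotaL) addr0.
    have [n1 n1E] := sNP_surj0 (rho (sNP n)).
    have /germP[A AE] : germ (gd_fam n : fam NY) = germ (diag n1 : fam NY).
      by rewrite gdP nE n1E hom_NP -gdP ifam.
    (* [n] and the image of [n1] agree in [P] and off [A]. The finitely many coordinates in which
       they differ are added to [n1]; its image in [P] does not change, since [e_F] is 0 there. *)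
    pose c F := at_fam (gd_fam n : fam NY) F - idm F *: n1.
    have cF F : idm F *: c F = c F.
      by rewrite scalerBr at_fam_idem scalerA idem_idem.
    exists (n1 + \sum_(F <- undup A) c F); apply: gd_eq.
      rewrite ifam; apply: fam_eq => F; rewrite diagE scalerDr scaler_sumr.
      have cFF F' : F' != F -> idm F *: c F' = 0.
        by move=> F'F; rewrite -cF scalerA idem_neq ?scale0r // eq_sym.
      have [FA|FA] := boolP (F \in undup A).
        rewrite (bigD1_seq F) ?undup_uniq //= big1 => [|F' F'F]; last exact: cFF.
        by rewrite cF addr0 /c addrC subrK.
      rewrite big1_seq ?addr0 => [|F' /andP[_ F'A]]; last first.
        by apply: cFF; apply: contraNneq FA => <-.
      have := congr1 (fun x => at_fam x F) AE.
      by rewrite !at_famZ !at_fam_coid -mem_undup (negbTE FA).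
    rewrite nE n1E -hom_NP; congr (hP i _).
    rewrite sNPD (big_morph (@sNP _ _ Y) (@sNPD _ _ _ Y) (@sNP0 _ _ _ Y)).
    rewrite big1 ?addr0 // => F _.
    by rewrite -cF sNPZ to_SOK_idem scale0r.
  + move=> [z y] pv0; exists z; rewrite [RHS]surjective_pairing; congr pair.
      exact/esym/iV0.
    have /eqP := congr1 snd (etrans (esym (ppV (z, y))) pv0).
    rewrite subr_eq0 => /eqP yE; rewrite -[RHS]/(gd_co (hV i z)) ico; exact: yE.
  + move=> [q z].
    have piq : hP p (iota q) = q.
      apply: (linear_eq_spanned (@sVP_spanned _ _ _ gd1) (h := hP p \o iota)
        (k := id)) => // [a x x'|[z' y]] /=; first by rewrite iotaL (homP_lin p).
      rewrite iotaE piota.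
      by have -> : z' = 0 by exact: (@zero_subm rat (rat^o)).
    have [m mE] := germ_surj (theta (@gd_kapL NY (vrep_of Y)) (iota q)).
    have [n [_ nE]] := gd_mk (esym mE); exists n.
    rewrite [RHS]surjective_pairing pN1 nE piq; congr pair.
    exact: (@zero_subm O NY).
  + move=> [z y]; exists ((0 : vrep_of Y, y) : sV gd0); rewrite ppV /pV.
    congr pair; first exact: zero_subm.
    by rewrite /gd_co /gd_V0 /= /ga (lin0 gaL) subr0.
- exact: half_injective (zero_extension (N := NY)).
Qed.

End Resolution.

(* [\bigoplus_F Q], whose natural extension by the constant sheaf is not split. *)
Section NonInjective.
Context (Kinf : infinite_set [set: K]).

Definition finsupp_set (a : unit_emod W) := exists A, coid A * (a : O) = 0.

Lemma finsupp0 : finsupp_set 0. Proof. by exists [::]; rewrite mulr0. Qed.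

Lemma finsuppZD (a : O) x y : finsupp_set x -> finsupp_set y -> finsupp_set (a *: x + y).
Proof.
move=> [A xA] [A' yA']; exists (A ++ A'); rewrite -coidemM -[a *: x]/(a * (x : O)).
transitivity (coid A' * a * (coid A * (x : O)) + coid A * (coid A' * (y : O))).
  by rewrite mulrDr; congr (_ + _); ring.
by rewrite xA yA' !mulr0 addr0.
Qed.

Definition finsupp : submod (unit_emod W) := Submod finsupp0 finsuppZD.

Lemma finsupp_gr d (a : unit_emod W) : finsupp a -> finsupp (em_gr (unit_emod W) d a).
Proof.
move=> [A aA]; exists A.
have := em_hcomp0 d a (prod_homog_type0 (coid A)).
by have -> : coid A *: a = 0 := aA; rewrite hcomp0 => /esym.
Qed.

Lemma finsupp_act (F : K) (w : WF W F) (a : unit_emod W) : finsupp a -> finsupp (em_act w a).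
Proof.
move=> [A aA]; exists A; change (coid A * (idm F * (a : O)) = 0).
by rewrite mulrCA aA mulr0.
Qed.

Definition finsupp_emod := sub_emod finsupp_gr finsupp_act.

Lemma finsupp_torsion : torsion finsupp_emod.
Proof.
by move=> x; have [A xA] := submP x; exists (coden A); apply: subm_eq; apply: xA.
Qed.

Let T := tors_obj tm finsupp_torsion.
Local Notation NT := (emod_of tm T).

Lemma finsupp_idem (F : K) : finsupp (idm F : unit_emod W).
Proof. by exists [:: F]; rewrite coidem_idem inE eqxx. Qed.

Definition finsupp_at (F : K) : NT :=
  (0, sub_in (finsupp_idem F)) : half_mod (zero_obj tm) finsupp_emod.

Lemma finsupp_atE (a b : NT) :
  submval (a : half_mod _ finsupp_emod).2 = submval (b : half_mod _ finsupp_emod).2 ->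
  a = b.
Proof.
case: a b => [p x] [q y] e; congr pair; first exact (@zero_objP _ _ _ tm _ _).
exact: subm_eq.
Qed.

Lemma finsupp_fam_subproof : fam_set finsupp_at.
Proof.
split=> [F|]; first by apply: finsupp_atE; apply: idem_idem.
exists [:: 0] => d; rewrite inE => d0 F; apply: finsupp_atE.
have -> : em_gr NT d (finsupp_at F) = (0, sub_grading finsupp_gr d (sub_in (finsupp_idem F))) :> half_mod (zero_obj tm) finsupp_emod.
  rewrite [LHS]pair_gradingE; congr pair; exact (@zero_objP _ _ _ tm _ _).
rewrite sub_gradingE; apply: prodR_eq => F'.
rewrite prod_gradingE (hcomp_homog _ (@idem_homog K (stalk X) F F')) (negbTE d0) //.
Qed.

Definition finsupp_fam : fam NT := mkfam finsupp_fam_subproof.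

(** The actions on [O] are trivial, so the germ of the family of all [e_F] is invariant. *)
Lemma finsupp_co_subproof : coind_set (fun=> germ finsupp_fam : germsQ NT).
Proof.
move=> h g; exists finsupp_fam, finsupp_fam; split=> //.
exists [::] => F _ phi _ w _; apply: finsupp_atE; exact: idem_idem.
Qed.

(** The family of all [e_F], with its germ at infinity, gives an element [n] of the ambient object
    for which [e_F n] is the image of [e_F]. A retraction would send [n] to a finitely supported [a]
    with [e_F a = e_F] for every [F]. *)
Lemma noninjective_type0 :
  ~ forall Y : standard_model W, injdim_le (C := standard_model W) 0 Y.
Proof.
move=> inj; have [i [ifam iV0 _]] := gd_embedding T.
have mi : mono (C := standard_model W) i.
  apply: mono_of_injective; first exact: gd_embedding_inj ifam iV0.
  by move=> u v uv; rewrite -(iV0 u) uv iV0.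
have [r rE] := inj T _ _ i (smid T) mi.
have rr n : hN r (hN i n) = n := congr1 (fun h : smhom T T => hN h n) rE.
pose y : coind NT := sub_in (finsupp_co_subproof : coind_submod NT (fun=> germ finsupp_fam)).
have [|n [nfam nP]] := @gd_mk NT (vrep_of T) finsupp_fam
  (tmkV X ((0 : vrep_of T, y) : gd_vrep NT (vrep_of T))).
  by rewrite thetaE.
have atn F : idm F *: n = hN i (finsupp_at F).
  apply: gd_eq.
    have [fL _ _] := gd_fam_emhom NT (vrep_of T).
    rewrite (linZ fL) nfam ifam; apply: fam_eq => F'.
    rewrite at_famZ mkfamE diagE; apply: finsupp_atE.
    change (idm F * idm F' = idm F' * idm F); exact: mulrC.
  rewrite sNPZ to_SOK_idem scale0r -hom_NP.
  have -> : sNP (finsupp_at F : sN T) = 0 by [].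
  by rewrite homP0.
pose a : O := submval (hN r n : half_mod (zero_obj tm) finsupp_emod).2.
have aF F : idm F * a = idm F.
  have : idm F *: hN r n = finsupp_at F by rewrite -(homNZ tm r) atn rr.
  move=> /(congr1 (fun t : half_mod (zero_obj tm) finsupp_emod => t.2)) e.
  have {}e : idm F *: (hN r n : half_mod (zero_obj tm) finsupp_emod).2 =
      sub_in (finsupp_idem F) := e.
  have := congr1 (@submval _ _ finsupp) e.
  have -> x : submval (idm F *: (x : finsupp_emod)) = idm F * (submval x : O) by [].
  by [].
have [A aA] := submP (hN r n : half_mod (zero_obj tm) finsupp_emod).2.
apply: Kinf; apply: (@sub_finite_set _ _ [set` A]); last exact: finite_seq.
move=> F _ /=; apply: contraT => FA.
have e0 : coid A * a = 0 := aA.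
have : idm F * (coid A * a) = idm F.
  by rewrite mulrA [idm F * _]mulrC coidem_idem (negbTE FA) aF.
rewrite e0 mulr0 => /(congr1 (fun x : prodR K (stalk X) => x F)).
by rewrite idemE eqxx => /esym/eqP; rewrite oner_eq0.
Qed.

End NonInjective.

Lemma has_injdim_type0 : infinite_set [set: K] -> has_injdim (standard_model W) 1.
Proof.
move=> Kinf; split=> [Y|m]; first exact: injdim1_type0.
by case: m => // /(noninjective_type0 Kinf).
Qed.

End Type0Final.

Theorem lemma5p4 (K : countType) (K_nonempty : inhabited K) :
  (infinite_set [set: K] ->
     forall W : compstr (type0 K), has_injdim (standard_model W) 1) /\
  (forall W : compstr (type1 K), (forall F : K, Whom W F <> None) ->
     has_injdim (standard_model W) 1).
Proof.
split=> [Kinf W|W hW]; first exact: has_injdim_type0.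
exact: has_injdim_type1.
Qed.
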